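(* For $c_1,c_2\ge0$, \[ V_{\mathbb D_5}(c_1,c_2,0,0,0)=\frac{2\,\mathrm{Li}_2(1)+\log^2\dfrac{\cosh c_1+1}{\cosh c_2+1}+2\displaystyle\sum_{i=1,2}\mathrm{Li}_2\!\left(\frac{\cosh c_i-1}{\cosh c_i+1}\right)}{\cosh c_1+\cosh c_2}, \] where $\mathrm{Li}_2(x)=\sum_{k\ge1}x^k/k^2$ is the dilogarithm and $V_{\mathbb D_5}(c_1,c_2,0,0,0)$ is the generalised Mirzakhani volume of the moduli space of flippered pentagons with strap lengths $c_1,c_2,0,0,0$.
   Context: **Flippered polygons.** $\mathbb D_n$ ($n\ge3$) is the closed disk with $n$ cyclically ordered labelled boundary points $q_1,\dots,q_n$ removed. A flippered surface $X$ of type $\mathbb D_n$ is $\mathbb D_n$ with a complete hyperbolic metric whose boundary components are bi-infinite geodesics, called arches $\alpha_1,\dots,\alpha_n$. Each $q_j$ is either a tine (its two adjacent arches are asymptotic; strap length $0$) or a flipper (a half-funnel); in the latter case the $j$-th strap $\sigma_j$ is the geodesic segment which cuts off the flipper and is orthogonal to the two adjacent arches, and the strap length is its length. $X$ is crowned if all strap lengths are $0$. $\mathcal M_{\mathbb D_n}(\vec c)$ is the space of (label- and orientation-preserving) isometry classes of such $X$ with strap lengths $\vec c$. **Action.** An orthojectory on $X$ is an inextensible oriented geodesic starting orthogonally at a point of $\partial X$ (its base point). It is peripheral if it can be properly homotoped (endpoints moving in $\partial X$) arbitrarily deeply into a flipper or tine, and essential otherwise. $\mathbb I_i\subset\alpha_i$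 is the smallest closed interval containing all base points of essential orthojectories starting on $\alpha_i$. The generalised Chekhov action is $S(X)=\frac12\sum_{i=1}^n\ell(\mathbb I_i)+\sum_{i=1}^n\log\cosh(c_i/2)$, with $c_i$ the strap lengths of $X$. **Volume form.** Put $\mathcal A=\{j:c_j>0\}$ and let $\dot{\mathbb D}_n(\mathcal A)$ be $\mathbb D_n$ with each $q_j$, $j\in\mathcal A$, replaced by two adjacent boundary punctures. For a flippered surface $X$ whose strap lengths are positive exactly at $j\in\mathcal A$, removing from each flipper the largest open half-plane contained in it gives a crowned surface (ideal polygon) $\mathrm{Clip}(X)$ of type $\dot{\mathbb D}_n(\mathcal A)$. Choose an ideal triangulation of $\dot{\mathbb D}_n(\mathcal A)$ by diagonals and let $s_1,\dots,s_N$ be the shearing coordinates of $\mathrm{Clip}(X)$ (signed distances between the feet of the perpendiculars dropped on a diagonal from the opposite ideal vertices of its two adjacent ideal triangles, left shears positive). Then $\Omega^{\mathrm{WP}}(\vec c)$ is the top-degree form on $\mathcal M_{\mathbb D_n}(\vec c)$ with $\bigwedge_i ds_i=\pm\bigwedge_{j\in\mathcal A}d\bigl(2\log\sinh\tfrac{\ell(\sigma_j)}2\bigr)\wedge\Omega^{\mathrm{WP}}(\vec c)$. It does not depend on the triangulation up to sign; the sign is chosen so that volumes are positive. **Volume.** $V_{\mathbb D_n}(\vec c)=\int_{\mathcal M_{\mathbb D_n}(\vec c)}e^{-S}\,\Omega^{\mathrm{WP}}(\vec c)$. *)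

(* Defs.v *)
From HB Require Import structures.
From mathcomp Require Import all_boot all_order all_algebra.
From mathcomp Require Import all_classical all_reals all_analysis.
Set Implicit Arguments.
Unset Strict Implicit.
Unset Printing Implicit Defensive.
Import Order.TTheory GRing.Theory Num.Theory.
Import numFieldNormedType.Exports.
Local Open Scope classical_set_scope.
Local Open Scope ring_scope.

Section special_functions.
Context {R : realType}.
Implicit Type x : R.

Definition cosh x : R := (expR x + expR (- x)) / 2.
Definition sinh x : R := (expR x - expR (- x)) / 2.
Definition arcosh x : R := ln (x + Num.sqrt (x ^+ 2 - 1)).

Definition Li2 x : R := limn (series (fun k => x ^+ k.+1 / k.+1%:R ^+ 2)).

End special_functions.

(* The hyperboloid model.  Tangent vectors at p are the v with mdot p v = 0;   *)
(* points at infinity are the future null rays, ideal t being the one in the  *)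
(* direction t, and increasing t is the counterclockwise direction.           *)
Section hyperbolic_plane.
Context {R : realType}.
Implicit Types (p q u v w : 'rV[R]_3) (t a b : R).

Definition mdot u v : R := u 0 1 * v 0 1 + u 0 2 * v 0 2 - u 0 0 * v 0 0.

Definition H2 : set 'rV[R]_3 := [set p | mdot p p = -1 /\ 0 < p 0 0].

Definition hdist p q : R := arcosh (- mdot p q).

(* Unit speed geodesic through p with unit tangent vector v, and its velocity. *)
Definition geodesic p v t := cosh t *: p + sinh t *: v.
Definition velocity p v t := sinh t *: p + cosh t *: v.

Definition ideal t : 'rV[R]_3 := \row_k [:: 1; cos t; sin t]`_k.

(* For a < b < a + 2 * pi, the unit normal of the geodesic from ideal a to     *)
(* ideal b which points to the left of it: mdot p (left_normal a b) is >= 0    *)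
(* exactly on the closed half-plane whose ideal points go counterclockwise     *)
(* from b to a.  It is the unit normal at every point of the geodesic.         *)
Definition left_normal a b : 'rV[R]_3 :=
  let m := (a + b) / 2 in let d := (b - a) / 2 in
  - (sin d)^-1 *: \row_k [:: cos d; cos m; sin m]`_k.

(* The foot, on the geodesic with null endpoints u and v, of the perpendicular *)
(* dropped from the ideal point w is the orthogonal projection of w on the     *)
(* plane spanned by u and v, scaled back to the hyperboloid.                   *)
Definition foot u v w : 'rV[R]_3 :=
  let y := (mdot w v / mdot u v) *: u + (mdot w u / mdot u v) *: v in
  (Num.sqrt (- mdot y y))^-1 *: y.

(* For p, q on a geodesic ending at the null vector u, the distance from p to  *)
(* q counted positively towards u; mdot _ u decays like expR (- t) along a     *)
(* unit speed geodesic tending to u.                                           *)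
Definition signed_dist u p q : R := ln (mdot p u / mdot q u).

(* The shear along the diagonal uv of the ideal quadrilateral with vertices    *)
(* u, w1, v, w2 in counterclockwise order.  For a viewer in the triangle of w1 *)
(* who faces the diagonal, u is on the left.                                   *)
Definition shear u v w1 w2 : R :=
  signed_dist u (foot u v w1) (foot u v w2).

End hyperbolic_plane.

(* A complete simply connected hyperbolic surface with geodesic boundary is,   *)
(* up to isometry, a convex region of the hyperbolic plane bounded by pairwise *)
(* disjoint geodesics.  The i-th arch is the geodesic from ideal (tail i) to   *)
(* ideal (head i), with the surface on its left.                               *)
Record polygon (R : realType) (n : nat) :=
  Polygon { tail : 'I_n -> R; head : 'I_n -> R }.

Section flippered_polygons.
Context {R : realType} {n : nat}.
Implicit Types (P Q : polygon R n) (i j : 'I_n) (p : 'rV[R]_3) (t c : R).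

(* The end q_j lies between the arches j and ordS j; the arches follow each    *)
(* other counterclockwise and turn once around the circle at infinity.         *)
Definition flippered P : Prop :=
  [/\ (3 <= n)%N,
      forall i, tail P i < head P i &
      forall j, head P j <= tail P (ordS j) + (if j.+1 == n then 2 * pi else 0)].

Definition normal P i := left_normal (tail P i) (head P i).

Definition arch P i : set 'rV[R]_3 := [set p | H2 p /\ mdot p (normal P i) = 0].

Definition surface P : set 'rV[R]_3 :=
  [set p | H2 p /\ forall i, 0 <= mdot p (normal P i)].

Definition boundary P : set 'rV[R]_3 := \bigcup_i arch P i.

(* Restrictions to surface P of orientation preserving isometries of H2.       *)
Definition isometric P Q : Prop :=
  exists M : 'M[R]_3,
    [/\ forall x y : 'rV[R]_3, mdot (x *m M) (y *m M) = mdot x y,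
        forall x, H2 x -> H2 (x *m M),
        \det M = 1,
        [set x *m M | x in surface P] = surface Q &
        forall i, [set x *m M | x in arch P i] = arch Q i].

Definition tine P j : Prop := ideal (head P j) = ideal (tail P (ordS j)).

Definition is_strap_length P j c : Prop :=
  0 < c /\ exists p, [/\ arch P j p,
    arch P (ordS j) (geodesic p (normal P j) c) &
    velocity p (normal P j) c = - normal P (ordS j)].

Definition strap P j : R :=
  if `[< tine P j >] then 0 else xget 0 [set c | is_strap_length P j c].

(* The orthojectory based at p on the arch i is geodesic p (normal P i) on     *)
(* this interval, which is of the form [0, l] or [0, +oo[.                     *)
Definition orthojectory_dom P i p : set R :=
  [set t | 0 <= t /\ surface P (geodesic p (normal P i) t)].

(* h is a proper homotopy of g : D -> surface P, endpoints moving in the       *)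
(* boundary.                                                                   *)
Definition proper_homotopy P (D : set R) (g : R -> 'rV[R]_3)
    (h : R * R -> 'rV[R]_3) : Prop :=
  let B := `[0, 1]%classic `*` D in
  [/\ {within B, continuous h},
      h @` B `<=` surface P,
      forall K, compact K -> K `<=` surface P -> compact (B `&` h @^-1` K),
      forall t, D t -> h (0, t) = g t &
      forall s t, B (s, t) -> boundary P (g t) -> boundary P (h (s, t))].

(* Outside a large compact set, the connected subsets of the surface joining   *)
(* the arches j and ordS j are those lying deep in the end q_j.                *)
Definition peripheral P i p : Prop :=
  exists j, forall K, compact K -> K `<=` surface P ->
    exists (h : R * R -> 'rV[R]_3) (C : set 'rV[R]_3),
      [/\ proper_homotopy P (orthojectory_dom P i p)
            (geodesic p (normal P i)) h,
          connected C /\ C `<=` surface P `\` K,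
          C `&` arch P j !=set0,
          C `&` arch P (ordS j) !=set0 &
          forall t, orthojectory_dom P i p t -> C (h (1, t))].

Definition essential_bases P i : set 'rV[R]_3 :=
  [set p | arch P i p /\ ~ peripheral P i p].

(* The smallest closed interval of the arch i containing these base points.    *)
Definition base_interval P i : set 'rV[R]_3 :=
  \bigcap_(J in [set J : set 'rV[R]_3 | [/\ closed J, connected J,
      J `<=` arch P i & essential_bases P i `<=` J]]) J.

Definition base_length P i : R :=
  sup [set hdist p q | p in base_interval P i & q in base_interval P i].

Definition action P : R :=
  2^-1 * \sum_i base_length P i + \sum_i ln (cosh (strap P i / 2)).

(* The largest open half-plane contained in the flipper q_j is bounded by the  *)
(* geodesic joining the ideal points head j and tail (ordS j), so that Clip P  *)
(* is the ideal polygon with the following vertices, counterclockwise.         *)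
Definition clip_vertices P : seq R :=
  flatten [seq tail P i :: (if `[< tine P i >] then [::] else [:: head P i])
          | i <- enum 'I_n].

(* Shearing coordinates of Clip P for the triangulation by the diagonals       *)
(* issuing from its vertex 0; N is the number of these diagonals.              *)
Definition shears (N : nat) P : 'rV[R]_N :=
  let v k := ideal (nth 0 (clip_vertices P) k) in
  \row_k shear (v 0%N) (v k.+2) (v k.+1) (v k.+3).

Definition flippers_at (A : {set 'I_n}) P : Prop :=
  forall j, (j \in A) = (0 < strap P j).

(* Global coordinates on the space of isometry classes of flippered surfaces   *)
(* with flippers exactly at A, the last #|A| coordinates being the positive    *)
(* strap lengths.                                                              *)
Definition adapted_coordinates (A : {set 'I_n})
    (W : set 'rV[R]_(n - 3 + #|A|)) (Phi : 'rV[R]_(n - 3 + #|A|) -> polygon R n)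
    : Prop :=
  [/\ open W,
      forall x, W x -> [/\ flippered (Phi x), flippers_at A (Phi x) &
        forall j : 'I_#|A|, strap (Phi x) (enum_val j) = x 0 (rshift _ j)],
      forall P, flippered P -> flippers_at A P ->
        exists2 x, W x & isometric (Phi x) P,
      forall x y, W x -> W y -> isometric (Phi x) (Phi y) -> x = y &
      forall x, W x -> differentiable (shears (n - 3 + #|A|) \o Phi) x /\
        'J (shears (n - 3 + #|A|) \o Phi) x \in unitmx].

(* In adapted coordinates (u, l), where l lists the strap lengths, the         *)
(* identity ds = +/- d(2 log sinh (l / 2)) /\ Omega determines Omega as        *)
(* wp_density * du on the slices where l is constant.                          *)
Definition wp_density (A : {set 'I_n})
    (Phi : 'rV[R]_(n - 3 + #|A|) -> polygon R n) (x : 'rV[R]_(n - 3 + #|A|)) : R :=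
  `|\det ('J (shears (n - 3 + #|A|) \o Phi) x)| /
  \prod_(j in A) `|derive1 (fun l : R => 2 * ln (sinh (l / 2))) (strap (Phi x) j)|.

End flippered_polygons.

Section volume.
Context {R : realType}.

Definition slice (c : 'I_5 -> R) (A : {set 'I_5}) (u : R * R) :
    'rV[R]_(5 - 3 + #|A|) :=
  row_mx (\row_k [:: u.1; u.2]`_k) (\row_j c (enum_val j)).

(* v is the volume of the moduli space of flippered pentagons with strap       *)
(* lengths c, the integral being computed in adapted coordinates.  It does not *)
(* depend on them, by the change of variables formula.                         *)
Definition pentagon_volume (c : 'I_5 -> R) (v : \bar R) : Prop :=
  let A := [set j | 0 < c j]%SET in
  exists (W : set 'rV[R]_(5 - 3 + #|A|))
         (Phi : 'rV[R]_(5 - 3 + #|A|) -> polygon R 5),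
    adapted_coordinates W Phi /\
    v = (\int[(@lebesgue_measure R \x @lebesgue_measure R)%E]_
           (u in [set u | W (slice c A u)])
           (expR (- action (Phi (slice c A u))) *
            wp_density Phi (slice c A u))%:E)%E.

End volume.

(* Main.v *)
Require Import Defs.
From HB Require Import structures.
From mathcomp Require Import all_boot all_order all_algebra.
From mathcomp Require Import all_classical all_reals all_analysis.
From mathcomp Require Import ring lra zify measurable_realfun.
Import Order.TTheory GRing.Theory Num.Theory.
Import numFieldNormedType.Exports.
Local Open Scope classical_set_scope.
Set Implicit Arguments.
Unset Strict Implicit.
Unset Printing Implicit Defensive.
Local Open Scope ring_scope.

(** The moduli space has two coordinates in which the action and the volume form
    are explicit; the integral is then evaluated by dilogarithms.

    Geometry. A surface is a region of the hyperboloid cut out by half-planes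
    with unit normals N_i, and isometries are recognised by the Gram matrix of
    these normals (isometric_lorentz, isometric_gram). The straps satisfy
    cosh c_j = - <N_j, N_{j+1}> (cosh_strap). To find the action one must know
    which orthojectories are essential. An orthojectory from the arch i which
    ends behind an adjacent arch, or in an adjacent gap, can be pushed into the
    end between them (peripheral_segment, peripheral_ray). One which ends
    behind another arch is essential, because no connected set which avoids
    the sides of a suitable geodesic triangle meets three arches
    (three_arches, essential_segment); one which escapes through another gap
    is essential because a segment cuts this gap off (essential_ray). So the
    base interval of the arch i is bounded by the base points of the
    orthojectories asymptotic to the far ends of the two adjacent arches, and
    its length is half the logarithm of a cross ratio (base_length_cross).

    Coordinates. With flippers at most at the first two ends, a pentagon has a
    unique model in the upper half-plane with ends at infinity and at points of
    the real line with successive gaps g1, 1, g3, g4, g5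
    (pentagon_normal_form). In the gaps, exp (- S) and cosh c_1, cosh c_2 are
    rational (action_pentagon, cosh_strap0, cosh_strap1), and the shears are
    differences of logarithms of consecutive gaps (shears_pentagon). Replacing
    g1 and g3 by the strap lengths, and g4 and g5 by u = ln (g4 / (1 + g3)) and
    w = ln g5, gives adapted coordinates (adapted_pentagons), and a computation
    of the Jacobian determinant of the shears shows that the volume form is
    exactly du dw (det_shears, wp_density1).

    Integration. Put A = sinh^2 (c_1 / 2), B = sinh^2 (c_2 / 2). The integral in
    w is elementary (integral_inner). The integral in u is that of a logarithm
    of a rational function of z = 1 / (1 + A + (1 + A + B) exp u) against
    dz / z, hence a sum of dilogarithms (drv_prim). Its value at the limits
    contains Li2 1 and the dilogarithms of A B / ((1 + A) (1 + B)),
    A / (1 + A + B) and B / (1 + A + B), which the five-term relation turns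
    into those of A / (1 + A) and B / (1 + B) (five_term, dilogs_value).
    Finally cosh c_1 = 1 + 2 A and cosh c_2 = 1 + 2 B. *)

(** * Algebra of the hyperboloid *)

Section lorentz.
Context {R : realType}.
Implicit Types (u v w p q : 'rV[R]_3) (k a b s t : R).

Definition vec3 (x y z : R) : 'rV[R]_3 := \row_k [:: x; y; z]`_k.

Lemma vec3E x y z : (vec3 x y z 0 0 = x) * (vec3 x y z 0 1 = y) * (vec3 x y z 0 2 = z).
Proof. by rewrite !mxE. Qed.

Lemma scale_vec3 k x y z : k *: vec3 x y z = vec3 (k * x) (k * y) (k * z).
Proof. by apply/rowP => -[[|[|[|//]]] hi]; rewrite !mxE. Qed.

Lemma row3P u v : u 0 0 = v 0 0 -> u 0 1 = v 0 1 -> u 0 2 = v 0 2 -> u = v.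
Proof.
move=> h0 h1 h2; apply/rowP => -[[|[|[|//]]] hi].
- by rewrite [Ordinal hi](_ : _ = 0) //; apply/val_inj.
- by rewrite [Ordinal hi](_ : _ = 1) //; apply/val_inj.
- by rewrite [Ordinal hi](_ : _ = 2) //; apply/val_inj.
Qed.

Lemma mdotC u v : mdot u v = mdot v u.
Proof. by rewrite /mdot; ring. Qed.
Lemma mdotDl u v w : mdot (u + v) w = mdot u w + mdot v w.
Proof. by rewrite /mdot !mxE; ring. Qed.
Lemma mdotDr u v w : mdot u (v + w) = mdot u v + mdot u w.
Proof. by rewrite /mdot !mxE; ring. Qed.
Lemma mdotZl k u w : mdot (k *: u) w = k * mdot u w.
Proof. by rewrite /mdot !mxE; ring. Qed.
Lemma mdotZr k u w : mdot u (k *: w) = k * mdot u w.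
Proof. by rewrite /mdot !mxE; ring. Qed.
Lemma mdotNl u w : mdot (- u) w = - mdot u w.
Proof. by rewrite /mdot !mxE; ring. Qed.
Lemma mdotNr u w : mdot u (- w) = - mdot u w.
Proof. by rewrite /mdot !mxE; ring. Qed.

Definition mdotE := (mdotDl, mdotDr, mdotZl, mdotZr, mdotNl, mdotNr).

(** The point at infinity with homogeneous coordinates x and y on the real
    projective line which bounds the upper half-plane; null vectors are the
    squares of such spinors. *)
Definition null (x y : R) : 'rV[R]_3 :=
  vec3 (x ^+ 2 + y ^+ 2) (x ^+ 2 - y ^+ 2) (2 * (x * y)).

(** The unit normal of the geodesic which joins the points at infinity with
    spinors (x1, x2) and (y1, y2). In this form every scalar product is a
    polynomial identity in the spinors. *)
Definition nspin (x1 x2 y1 y2 : R) : 'rV[R]_3 :=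
  - (x1 * y2 - x2 * y1)^-1 *:
    vec3 (x1 * y1 + x2 * y2) (x1 * y1 - x2 * y2) (x1 * y2 + x2 * y1).

Lemma mdot_null x1 x2 y1 y2 :
  mdot (null x1 x2) (null y1 y2) = - 2 * (x1 * y2 - x2 * y1) ^+ 2.
Proof. by rewrite /mdot /null !vec3E; ring. Qed.

Lemma mdot_null_nspin z1 z2 x1 x2 y1 y2 :
  mdot (null z1 z2) (nspin x1 x2 y1 y2) =
  2 * (z1 * x2 - z2 * x1) * (z1 * y2 - z2 * y1) / (x1 * y2 - x2 * y1).
Proof. by rewrite /nspin mdotZr /mdot /null !vec3E; ring. Qed.

Lemma mdot_nspin x1 x2 y1 y2 z1 z2 t1 t2 :
  mdot (nspin x1 x2 y1 y2) (nspin z1 z2 t1 t2) =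
  - ((x1 * z2 - x2 * z1) * (y1 * t2 - y2 * t1)
     + (x1 * t2 - x2 * t1) * (y1 * z2 - y2 * z1))
  / ((x1 * y2 - x2 * y1) * (z1 * t2 - z2 * t1)).
Proof.
rewrite /nspin mdotZr mdotZl invfM /mdot !vec3E. ring.
Qed.

Lemma nspinZ k l x1 x2 y1 y2 : k != 0 -> l != 0 ->
  nspin (k * x1) (k * x2) (l * y1) (l * y2) = nspin x1 x2 y1 y2.
Proof.
move=> k0 l0; rewrite /nspin.
have -> : k * x1 * (l * y2) - k * x2 * (l * y1) = (k * l) * (x1 * y2 - x2 * y1) by ring.
rewrite invfM !scale_vec3.
by set d := (_ - _)^-1; congr vec3; field; rewrite k0 l0.
Qed.

(** The spinor of the point of angle t consists of the cosine and sine of t /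
    2. *)
Lemma idealE t : ideal t = null (cos (t / 2)) (sin (t / 2)).
Proof.
have e : t = t / 2 + t / 2 by field.
rewrite /null {2}(sin2cos2 (t / 2)) {1}(sin2cos2 (t / 2)).
have -> : 2 * (cos (t / 2) * sin (t / 2)) = sin t by rewrite {3}e sinD; ring.
have -> : cos (t / 2) ^+ 2 - (1 - cos (t / 2) ^+ 2) = cos t.
  by rewrite {3}e cosD -!expr2 (sin2cos2 (t / 2)).
by rewrite subrKC.
Qed.

Lemma left_normalE a b :
  left_normal a b = nspin (cos (a / 2)) (sin (a / 2)) (cos (b / 2)) (sin (b / 2)).
Proof.
rewrite /left_normal /nspin.
rewrite (_ : (b - a) / 2 = b / 2 - a / 2); last by field.
rewrite (_ : (a + b) / 2 = b / 2 + a / 2); last by field.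
rewrite sinB cosB cosD sinD.
rewrite [X in X^-1](_ : _ = cos (a / 2) * sin (b / 2) - sin (a / 2) * cos (b / 2)); last by ring.
congr (_ *: _); apply: row3P; rewrite mxE vec3E /=; ring.
Qed.

(** The determinant of three vectors; as a function of w it is a linear form
    which vanishes on the geodesic through u and v. *)
Definition triple u v w : R :=
  u 0 0 * (v 0 1 * w 0 2 - v 0 2 * w 0 1)
  - u 0 1 * (v 0 0 * w 0 2 - v 0 2 * w 0 0)
  + u 0 2 * (v 0 0 * w 0 1 - v 0 1 * w 0 0).

Lemma mdot_ideal s t : mdot (ideal s) (ideal t) = - 2 * sin ((t - s) / 2) ^+ 2.
Proof.
rewrite !idealE mdot_null (_ : (t - s) / 2 = t / 2 - s / 2); last by field.
by rewrite sinB; ring.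
Qed.

Lemma mdot_ideal_normal t a b : mdot (ideal t) (left_normal a b) =
  2 * sin ((t - a) / 2) * sin ((t - b) / 2) / sin ((b - a) / 2).
Proof.
rewrite idealE left_normalE mdot_null_nspin.
rewrite !(mulrBl 2^-1) !sinB.
by congr (_ / _); ring.
Qed.

Lemma mdot_normal a b a' b' : mdot (left_normal a b) (left_normal a' b') =
  - (sin ((a' - a) / 2) * sin ((b' - b) / 2) + sin ((b' - a) / 2) * sin ((a' - b) / 2))
  / (sin ((b - a) / 2) * sin ((b' - a') / 2)).
Proof.
rewrite !left_normalE mdot_nspin.
rewrite !(mulrBl 2^-1) !sinB.
by congr (_ / _); ring.
Qed.

Lemma triple_ideal r s t : triple (ideal r) (ideal s) (ideal t) =
  4 * sin ((s - r) / 2) * sin ((t - s) / 2) * sin ((t - r) / 2).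
Proof.
rewrite !idealE /triple /null !vec3E !(mulrBl 2^-1) !sinB.
ring.
Qed.

Lemma triple_rot u v w : triple u v w = triple v w u.
Proof. by rewrite /triple; ring. Qed.
Lemma triple_swap u v w : triple u v w = - triple v u w.
Proof. by rewrite /triple; ring. Qed.
Lemma tripleDl u v w z : triple (u + v) w z = triple u w z + triple v w z.
Proof. by rewrite /triple !mxE; ring. Qed.
Lemma tripleZl k u w z : triple (k *: u) w z = k * triple u w z.
Proof. by rewrite /triple !mxE; ring. Qed.
Lemma tripleDm u v w z : triple w (u + v) z = triple w u z + triple w v z.
Proof. by rewrite /triple !mxE; ring. Qed.
Lemma tripleZm k u w z : triple w (k *: u) z = k * triple w u z.
Proof. by rewrite /triple !mxE; ring. Qed.
Lemma tripleDr u v w z : triple w z (u + v) = triple w z u + triple w z v.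
Proof. by rewrite /triple !mxE; ring. Qed.
Lemma tripleZr k u w z : triple w z (k *: u) = k * triple w z u.
Proof. by rewrite /triple !mxE; ring. Qed.

Definition tripleE := (tripleDl, tripleDm, tripleDr, tripleZl, tripleZm, tripleZr).

(** Three vectors orthogonal to n are linearly dependent: each coordinate of n
    is a coefficient of the determinant expanded against the products with n. *)
Lemma triple_orth0 n u v w : mdot n n = 1 -> mdot u n = 0 -> mdot v n = 0 ->
  mdot w n = 0 -> triple u v w = 0.
Proof.
move=> nn un vn wn.
have e0 : triple u v w * n 0 0 = 0.
  transitivity (- ((v 0 1 * w 0 2 - v 0 2 * w 0 1) * mdot u n
    - (u 0 1 * w 0 2 - u 0 2 * w 0 1) * mdot v n
    + (u 0 1 * v 0 2 - u 0 2 * v 0 1) * mdot w n)).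
    by rewrite /triple /mdot; ring.
  by rewrite un vn wn; ring.
have e1 : triple u v w * n 0 1 = 0.
  transitivity (- (v 0 0 * w 0 2 - v 0 2 * w 0 0) * mdot u n
    + (u 0 0 * w 0 2 - u 0 2 * w 0 0) * mdot v n
    - (u 0 0 * v 0 2 - u 0 2 * v 0 0) * mdot w n).
    by rewrite /triple /mdot; ring.
  by rewrite un vn wn; ring.
have e2 : triple u v w * n 0 2 = 0.
  transitivity ((v 0 0 * w 0 1 - v 0 1 * w 0 0) * mdot u n
    - (u 0 0 * w 0 1 - u 0 1 * w 0 0) * mdot v n
    + (u 0 0 * v 0 1 - u 0 1 * v 0 0) * mdot w n).
    by rewrite /triple /mdot; ring.
  by rewrite un vn wn; ring.
rewrite -[LHS]mulr1 -nn /mdot mulrBr mulrDr !mulrA e0 e1 e2; ring.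
Qed.

(** Both sides are linear in q and agree at n; on the orthogonal of n they
    vanish. *)
Lemma triple_plane n u v q : mdot n n = 1 -> mdot u n = 0 -> mdot v n = 0 ->
  triple u v q = triple u v n * mdot q n.
Proof.
move=> nn un vn.
have := @triple_orth0 n u v (q + (- mdot q n) *: n) nn un vn.
rewrite !mdotE nn mulr1 subrr !tripleE => /(_ erefl) h; lra.
Qed.

(** The reversed Cauchy-Schwarz inequality of the forward cone. *)
Lemma causal_lt u v : mdot u u <= 0 -> mdot v v < 0 -> 0 < u 0 0 -> 0 < v 0 0 ->
  mdot u v < 0.
Proof.
rewrite /mdot; set x0 := u 0 0; set x1 := u 0 1; set x2 := u 0 2.
set y0 := v 0 0; set y1 := v 0 1; set y2 := v 0 2 => hu hv x0p y0p.
rewrite ltNge; apply/negP => hs.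
have h1 : x0 * y0 <= x1 * y1 + x2 * y2 by lra.
have h2 : (x0 * y0) ^+ 2 <= (x1 * y1 + x2 * y2) ^+ 2.
  have h0 : 0 <= x0 * y0 by rewrite mulr_ge0 ?ltW.
  by rewrite ler_pXn2r // ?nnegrE //; exact: le_trans h1.
have h3 : (x1 * y1 + x2 * y2) ^+ 2 <= (x1 * x1 + x2 * x2) * (y1 * y1 + y2 * y2).
  rewrite -subr_ge0 (_ : _ - _ = (x1 * y2 - x2 * y1) ^+ 2); last by ring.
  exact: sqr_ge0.
have h4 : (x1 * x1 + x2 * x2) * (y1 * y1 + y2 * y2) <= (x0 * x0) * (y1 * y1 + y2 * y2).
  by rewrite ler_wpM2r ?addr_ge0 -?expr2 ?sqr_ge0 //; rewrite !expr2; lra.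
have h5 : (x0 * x0) * (y1 * y1 + y2 * y2) < (x0 * x0) * (y0 * y0).
  by rewrite ltr_pM2l ?mulr_gt0 //; lra.
have : (x0 * y0) ^+ 2 = x0 * x0 * (y0 * y0) by ring.
lra.
Qed.

Lemma ideal00 t : ideal t 0 0 = 1.
Proof. by rewrite mxE. Qed.

Lemma ideal_null t : mdot (ideal t) (ideal t) = 0.
Proof. by rewrite mdot_ideal subrr mul0r sin0 expr0n mulr0. Qed.

Lemma mdot_H2_ideal p t : H2 p -> mdot p (ideal t) < 0.
Proof.
move=> [pp p0]; rewrite mdotC; apply: causal_lt => //.
- by rewrite ideal_null.
- by rewrite pp ltrN10.
- by rewrite ideal00.
Qed.

Lemma mdot_H2 p q : H2 p -> H2 q -> mdot p q < 0.
Proof. by move=> [pp p0] [qq q0]; apply: causal_lt; rewrite ?pp ?qq ?lerN10 ?ltrN10. Qed.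

Lemma future_of p q : H2 p -> mdot q q <= 0 -> mdot q p < 0 -> 0 < q 0 0.
Proof.
move=> [pp p0] qq qp; case: (ltrgtP (q 0 0) 0) => // h.
- have : mdot (- q) p < 0.
    apply: causal_lt => //; first by rewrite mdotNl mdotNr opprK.
    + by rewrite pp ltrN10.
    + by rewrite mxE oppr_gt0.
  by rewrite mdotNl; lra.
- have e1 : q 0 1 = 0 by move: qq; rewrite /mdot h; nra.
  have e2 : q 0 2 = 0 by move: qq; rewrite /mdot h; nra.
  by move: qp; rewrite /mdot h e1 e2; lra.
Qed.

(** The orthogonal of a timelike vector is positive definite. *)
Lemma orth_timelike0 p z : H2 p -> mdot p z = 0 -> mdot z z <= 0 -> z = 0.
Proof.
move=> [pp p0] pz zz.
have e : p 0 0 ^+ 2 * mdot z z = z 0 1 ^+ 2 + z 0 2 ^+ 2 + (p 0 1 * z 0 2 - p 0 2 * z 0 1) ^+ 2.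
  have h0 : p 0 0 * z 0 0 = p 0 1 * z 0 1 + p 0 2 * z 0 2 by move: pz; rewrite /mdot; lra.
  have h1 : p 0 0 ^+ 2 = 1 + p 0 1 ^+ 2 + p 0 2 ^+ 2 by move: pp; rewrite /mdot; lra.
  rewrite /mdot (_ : p 0 0 ^+ 2 * _ = p 0 0 ^+ 2 * (z 0 1 ^+ 2 + z 0 2 ^+ 2) - (p 0 0 * z 0 0) ^+ 2).
    by rewrite h0 h1; ring.
  by ring.
have le0 : p 0 0 ^+ 2 * mdot z z <= 0 by rewrite mulr_ge0_le0 // sqr_ge0.
have [[s1 s2] s3] := (sqr_ge0 (z 0 1), sqr_ge0 (z 0 2), sqr_ge0 (p 0 1 * z 0 2 - p 0 2 * z 0 1)).
have z1 : z 0 1 = 0 by apply/eqP; rewrite -sqrf_eq0; apply/eqP; lra.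
have z2 : z 0 2 = 0 by apply/eqP; rewrite -sqrf_eq0; apply/eqP; lra.
have z0 : z 0 0 = 0.
  have : p 0 0 * z 0 0 = 0 by move: pz; rewrite /mdot z1 z2; lra.
  by move/eqP; rewrite mulf_eq0 gt_eqF //= => /eqP.
by apply: row3P; rewrite ?z0 ?z1 ?z2 mxE.
Qed.

Lemma cramer x y z p : triple x y z *: p =
  triple p y z *: x + triple x p z *: y + triple x y p *: z.
Proof. by apply: row3P; rewrite !mxE /triple; ring. Qed.

(** Since x and y are separated by n they are independent, so that mdot x y ^+
    2 - 1 is not zero; it is the determinant of x, y and their cross product
    m, and Cramer solves for p. *)
Lemma triple_span x y p n : H2 x -> H2 y -> mdot x n = 0 -> mdot y n != 0 ->
  triple x y p = 0 -> exists k l, p = k *: x + l *: y.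
Proof.
move=> Hx Hy xn yn xyp.
set D := mdot x y ^+ 2 - 1.
have D0 : D != 0.
  apply/eqP => D0; case/negP: yn; apply/eqP.
  have z0 : y + mdot x y *: x = 0.
    apply: (@orth_timelike0 x) => //.
      by rewrite !mdotE; case: Hx => -> _; ring.
    rewrite !mdotE; case: Hx => -> _; case: Hy => -> _; rewrite (mdotC y x).
    by move: D0; rewrite /D; lra.
  have : mdot (y + mdot x y *: x) n = 0 by rewrite z0 /mdot !mxE; ring.
  by rewrite !mdotE xn; lra.
set m := vec3 (- (x 0 1 * y 0 2 - x 0 2 * y 0 1)) (- (x 0 0 * y 0 2 - x 0 2 * y 0 0))
    (x 0 0 * y 0 1 - x 0 1 * y 0 0).
have Dm : D = triple x y m.
  have [xx _] := Hx; have [yy _] := Hy.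
  rewrite /D (_ : 1 = mdot x x * mdot y y); last by rewrite xx yy; ring.
  by rewrite /triple /m !vec3E /mdot; ring.
exists (triple p y m / D), (triple x p m / D).
have e : D *: p = triple p y m *: x + triple x p m *: y.
  by rewrite Dm cramer xyp scale0r addr0.
by rewrite -[LHS](scalerK D0) e scalerDr !scalerA; congr (_ *: _ + _ *: _); exact: mulrC.
Qed.

Lemma cosh_gt0 t : 0 < cosh t.
Proof. by rewrite /cosh divr_gt0 // addr_gt0 ?expR_gt0. Qed.
Lemma cosh2 t : cosh t ^+ 2 = 1 + sinh t ^+ 2.
Proof.
rewrite /cosh /sinh expRN; have := expR_gt0 t; set e := expR t => e0.
by field; rewrite gt_eqF.
Qed.
Lemma coshDsinh t : cosh t + sinh t = expR t.
Proof. by rewrite /cosh /sinh; field. Qed.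
Lemma coshBsinh t : cosh t - sinh t = expR (- t).
Proof. by rewrite /cosh /sinh; field. Qed.
Lemma coshN t : cosh (- t) = cosh t.
Proof. by rewrite /cosh opprK addrC. Qed.
Lemma sinh_ge0 t : 0 <= t -> 0 <= sinh t.
Proof. by move=> t0; rewrite /sinh divr_ge0 // subr_ge0 ler_expR; lra. Qed.
Lemma sinh_gt0 t : 0 < t -> 0 < sinh t.
Proof. by move=> t0; rewrite /sinh divr_gt0 // subr_gt0 ltr_expR; lra. Qed.
Lemma cosh_ge1 t : 1 <= cosh t.
Proof.
have := cosh2 t; have := sqr_ge0 (sinh t); have := cosh_gt0 t => c0 s0 e.
by rewrite leNgt; apply/negP => h; nra.
Qed.
Lemma arcosh_cosh t : 0 <= t -> arcosh (cosh t) = t.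
Proof.
move=> t0; rewrite /arcosh cosh2 addrAC subrr add0r sqrtr_sqr ger0_norm ?sinh_ge0 //.
by rewrite coshDsinh expRK.
Qed.
Lemma cosh_half t : cosh t = 2 * sinh (t / 2) ^+ 2 + 1.
Proof.
rewrite /cosh /sinh (_ : expR t = expR (t / 2) ^+ 2); last first.
  by rewrite -expRM_natl; congr expR; lra.
rewrite (_ : expR (- t) = expR (- (t / 2)) ^+ 2); last first.
  by rewrite -expRM_natl; congr expR; lra.
rewrite expRN; have := expR_gt0 (t / 2); set e := expR (t / 2) => e0.
by field; rewrite gt_eqF.
Qed.

Lemma mdot_geodesic p n t q : mdot (geodesic p n t) q = cosh t * mdot p q + sinh t * mdot n q.
Proof. by rewrite /geodesic !mdotE. Qed.

Lemma H2_geodesic p n t : H2 p -> mdot p n = 0 -> mdot n n = 1 -> H2 (geodesic p n t).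
Proof.
move=> Hp pn nn; have [pp p0] := Hp.
have gg : mdot (geodesic p n t) (geodesic p n t) = -1.
  rewrite mdot_geodesic (mdotC p) (mdotC n) !mdot_geodesic pp nn (mdotC n p) pn.
  by have := cosh2 t; lra.
split => //; apply: (future_of Hp); first by rewrite gg lerN10.
by rewrite mdot_geodesic pp (mdotC n) pn; have := cosh_gt0 t; lra.
Qed.

End lorentz.

(** * Half-planes and ideal points *)

Section angles.
Context {R : realType}.
Implicit Types (p q x y z u v w : 'rV[R]_3) (a b s t : R).

Lemma idealD2pi t : ideal (t + 2 * pi) = ideal t.
Proof. by rewrite /ideal mulrC mulr_natr cosD2pi sinD2pi. Qed.

Lemma left_normalD2pi a b : left_normal (a + 2 * pi) (b + 2 * pi) = left_normal a b.
Proof.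
rewrite /left_normal.
rewrite (_ : (a + 2 * pi + (b + 2 * pi)) / 2 = (a + b) / 2 + 2 * pi); last by field.
rewrite (_ : (b + 2 * pi - (a + 2 * pi)) / 2 = (b - a) / 2); last by field.
by rewrite (mulrC 2 pi) mulr_natr cosD2pi sinD2pi.
Qed.

(** All inequalities between angles reduce to the sign of a chord, the sine of
    half an angle between 0 and 2 * pi. *)
Lemma chord_gt0 a b : a < b < a + 2 * pi -> 0 < sin ((b - a) / 2).
Proof. by move=> /andP[h1 h2]; apply: sin_gt0_pi; apply/andP; split; lra. Qed.

Lemma chord_ge0 a b : a <= b <= a + 2 * pi -> 0 <= sin ((b - a) / 2).
Proof. by move=> /andP[h1 h2]; apply: sin_ge0_pi; apply/andP; split; lra. Qed.

Lemma side_ge0 a b t : a < b -> b <= t -> t <= a + 2 * pi -> b < a + 2 * pi ->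
  0 <= mdot (ideal t) (left_normal a b).
Proof.
move=> h1 h2 h3 h4; rewrite mdot_ideal_normal.
rewrite divr_ge0 ?mulr_ge0 //; apply: chord_ge0; apply/andP; split; lra.
Qed.

Lemma side_gt0 a b t : a < b -> b < t -> t < a + 2 * pi ->
  0 < mdot (ideal t) (left_normal a b).
Proof.
move=> h1 h2 h3; rewrite mdot_ideal_normal.
rewrite divr_gt0 ?mulr_gt0 //; apply: chord_gt0; apply/andP; split; lra.
Qed.

Lemma side_lt0 a b t : a < t -> t < b -> b < a + 2 * pi ->
  mdot (ideal t) (left_normal a b) < 0.
Proof.
move=> h1 h2 h3; rewrite mdot_ideal_normal.
have -> : (t - b) / 2 = - ((b - t) / 2) by lra.
rewrite sinN mulrN mulNr oppr_lt0.
rewrite divr_gt0 ?mulr_gt0 //; apply: chord_gt0; apply/andP; split; lra.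
Qed.

Lemma left_normal_unit a b : a < b < a + 2 * pi ->
  mdot (left_normal a b) (left_normal a b) = 1.
Proof.
move=> /chord_gt0 h; rewrite mdot_normal subrr mul0r sin0 mul0r add0r.
have -> : (a - b) / 2 = - ((b - a) / 2) by lra.
by rewrite sinN mulrN opprK; field; rewrite gt_eqF.
Qed.

Lemma ideal_normal_l a b : mdot (ideal a) (left_normal a b) = 0.
Proof. by rewrite mdot_ideal_normal subrr mul0r sin0 mulr0 !mul0r. Qed.

Lemma ideal_normal_r a b : mdot (ideal b) (left_normal a b) = 0.
Proof. by rewrite mdot_ideal_normal subrr mul0r sin0 mulr0 !mul0r. Qed.

Lemma mdot_nondeg z : (forall w, mdot z w = 0) -> z = 0.
Proof.
move=> h.
have h0 := h (vec3 1 0 0); have h1 := h (vec3 0 1 0); have h2 := h (vec3 0 0 1).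
move: h0 h1 h2; rewrite /mdot !vec3E => h0 h1 h2.
by apply: row3P; rewrite mxE; lra.
Qed.

(** The three vectors u, v, w span the space and the form is nondegenerate. *)
Lemma mdot_basis0 u v w z : triple u v w != 0 ->
  mdot z u = 0 -> mdot z v = 0 -> mdot z w = 0 -> z = 0.
Proof.
move=> d0 zu zv zw; apply: mdot_nondeg => q.
apply: (mulfI d0); rewrite mulr0 -mdotZr cramer !mdotE zu zv zw; ring.
Qed.

Lemma triple_ideal_normal a b : a < b < a + 2 * pi ->
  triple (ideal a) (ideal b) (left_normal a b) != 0.
Proof.
move=> hab; have /andP[h1 h2] := hab.
have := triple_plane (ideal ((a + b) / 2)) (left_normal_unit hab)
   (ideal_normal_l a b) (ideal_normal_r a b).
rewrite triple_ideal => e; apply/eqP => t0; move: e; rewrite t0 mul0r.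
have s1 : 0 < sin ((b - a) / 2) by apply: chord_gt0.
have s2 : 0 < sin (((a + b) / 2 - a) / 2) by apply: chord_gt0; apply/andP; split; lra.
have s3 : 0 < sin ((b - (a + b) / 2) / 2) by apply: chord_gt0; apply/andP; split; lra.
have -> : ((a + b) / 2 - b) / 2 = - ((b - (a + b) / 2) / 2) by lra.
rewrite sinN; move/eqP; rewrite !mulf_eq0 oppr_eq0 !gt_eqF //.
Qed.

(** The coefficients are found by pairing with the two null ends, and the
    difference is orthogonal to a basis. *)
Lemma geodesic_span a b p : a < b < a + 2 * pi -> H2 p -> mdot p (left_normal a b) = 0 ->
  exists x y : R, [/\ 0 < x, 0 < y & p = x *: ideal a + y *: ideal b].
Proof.
move=> hab Hp pn; have ch := chord_gt0 hab.
have uv : mdot (ideal a) (ideal b) < 0.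
  by rewrite mdot_ideal nmulr_rlt0 ?exprn_gt0 // ltrN10 || lra.
have uv0 : mdot (ideal a) (ideal b) != 0 by rewrite lt_eqF.
exists (mdot p (ideal b) / mdot (ideal a) (ideal b)),
  (mdot p (ideal a) / mdot (ideal a) (ideal b)); split.
- by rewrite ltr_ndivlMr // mul0r mdot_H2_ideal.
- by rewrite ltr_ndivlMr // mul0r mdot_H2_ideal.
apply/eqP; rewrite -subr_eq0; apply/eqP.
apply: (mdot_basis0 (triple_ideal_normal hab)).
- by rewrite !mdotE ideal_null (mdotC (ideal b) (ideal a)); field.
- by rewrite !mdotE ideal_null; field.
- by rewrite !(mdotDl, mdotNl, mdotZl) ideal_normal_l ideal_normal_r pn; ring.
Qed.

(** The floor brings the argument given by acos into the prescribed turn. *)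
Lemma polar (x y a : R) : x ^+ 2 + y ^+ 2 = 1 ->
  exists t, [/\ a <= t, t < a + 2 * pi, cos t = x & sin t = y].
Proof.
move=> xy.
have x1 : -1 <= x <= 1 by apply/andP; split; nra.
have [s cs ss] : exists2 s, cos s = x & sin s = y.
  case: (leP 0 y) => y0.
    exists (acos x); first by rewrite acosK // in_itv.
    by rewrite sin_acos // (_ : 1 - x ^+ 2 = y ^+ 2) ?sqrtr_sqr ?ger0_norm //; lra.
  exists (- acos x); first by rewrite cosN acosK // in_itv.
  rewrite sinN sin_acos // (_ : 1 - x ^+ 2 = y ^+ 2); last by lra.
  by rewrite sqrtr_sqr ltr0_norm // opprK.
have p0 : 0 < 2 * pi :> R by rewrite mulr_gt0 ?pi_gt0.
pose k := Num.floor ((s - a) / (2 * pi)).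
have hk1 : (k%:~R : R) <= (s - a) / (2 * pi) by exact: floor_le_tmp.
have hk2 : (s - a) / (2 * pi) < (k + 1)%:~R by exact: floorD1_gt.
have shift (m : int) : cos (s - m%:~R * (2 * pi)) = x /\ sin (s - m%:~R * (2 * pi)) = y.
  have gen (m' : nat) (r : R) : cos (r + m'%:R * (2 * pi)) = cos r /\ sin (r + m'%:R * (2 * pi)) = sin r.
    have e : r + m'%:R * (2 * pi) = r + (pi *+ 2) *+ m' by rewrite !mulr_natl.
    by rewrite e (periodicn (@cosD2pi R)) (periodicn (@sinD2pi R)).
  case: m => m.
    have := gen m (s - m%:R * (2 * pi)); rewrite subrK cs ss => -[h1 h2].
    by split; [rewrite h1 | rewrite h2].
  rewrite NegzE mulrNz mulNr opprK.
  by have := gen m.+1 s; rewrite cs ss.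
exists (s - k%:~R * (2 * pi)); have [-> ->] := shift k; split => //.
  by move: hk1; rewrite ler_pdivlMr //; lra.
by move: hk2; rewrite ltr_pdivrMr // intrD; lra.
Qed.

Lemma row_polar v t : v 0 0 != 0 -> v 0 1 / v 0 0 = cos t -> v 0 2 / v 0 0 = sin t ->
  v = v 0 0 *: ideal t.
Proof. by move=> v0 h1 h2; apply: row3P; rewrite !mxE /= -?h1 -?h2; field. Qed.

(** The null vector p + left_normal a b is the direction of the geodesic which
    leaves p orthogonally; its angle lies outside the arc from a to b because
    it pairs positively with the normal. *)
Lemma ray_end a b p : a < b < a + 2 * pi -> H2 p -> mdot p (left_normal a b) = 0 ->
  exists c t : R, [/\ 0 < c, b < t, t < a + 2 * pi & p + left_normal a b = c *: ideal t].
Proof.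
move=> hab Hp pn; have nn := left_normal_unit hab; have [pp p0] := Hp.
set q := p + left_normal a b.
have qq : mdot q q = 0 by rewrite /q !(mdotDl, mdotDr) pp nn (mdotC _ p) pn; ring.
have q0 : 0 < q 0 0.
  apply: (future_of Hp); first by rewrite qq.
  by rewrite /q mdotDl pp mdotC pn; lra.
have h : (q 0 1 / q 0 0) ^+ 2 + (q 0 2 / q 0 0) ^+ 2 = 1.
  move: qq; rewrite /mdot => qq.
  have e : q 0 0 ^+ 2 = q 0 1 ^+ 2 + q 0 2 ^+ 2 by lra.
  rewrite !expr_div_n -mulrDl -e divff // sqrf_eq0 gt_eqF //.
have [t [t1 t2 ct st]] := polar a h.
have e : q = q 0 0 *: ideal t.
  by apply: row_polar; rewrite ?ct ?st ?gt_eqF.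
have pos : 0 < mdot (ideal t) (left_normal a b).
  have : mdot q (left_normal a b) = 1 by rewrite /q mdotDl pn nn add0r.
  by rewrite e mdotZl => h1; rewrite -(pmulr_rgt0 _ q0) h1.
exists (q 0 0), t; split => //.
have /andP[h1 h2] := hab.
rewrite ltNge; apply/negP => tb; move: pos; apply/negP; rewrite -leNgt.
move: t1; rewrite le_eqVlt => /predU1P[<-|t1]; first by rewrite ideal_normal_l.
move: tb; rewrite le_eqVlt => /predU1P[->|t3]; first by rewrite ideal_normal_r.
by rewrite ltW // side_lt0.
Qed.

End angles.

(** * Arches in cyclic order *)

Section unrolled.
Context {R : realType} {n : nat}.
Variables (P : polygon R n) (hP : flippered P) (i : 'I_n).
Implicit Types (j k l m : nat) (t : R).

(** Angles are unrolled from the arch i on, adding 2 * pi at every turn: lo k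
    and hi k are the ends of the k-th arch after i, and the cyclic order
    becomes the order of the real line. *)
Definition arch_idx k : 'I_n := iter k (@ordS n) i.
Definition lo k : R := tail P (arch_idx k) + 2 * pi * ((i + k) %/ n)%:R.
Definition hi k : R := Defs.head P (arch_idx k) + 2 * pi * ((i + k) %/ n)%:R.

Let n3 : (3 <= n)%N. Proof. by case: hP. Qed.

Lemma val_arch_idx k : arch_idx k = ((i + k) %% n)%N :> nat.
Proof.
elim: k => [|k IH]; first by rewrite addn0 modn_small.
rewrite /arch_idx iterS -/(arch_idx k) /= IH addnS -addn1.
by rewrite -[in RHS]addn1 modnDml.
Qed.

Lemma arch_idxS k : arch_idx k.+1 = ordS (arch_idx k).
Proof. by []. Qed.

Lemma arch_idxDn k : arch_idx (k + n) = arch_idx k.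
Proof. by apply/val_inj; rewrite /= !val_arch_idx addnA modnDr. Qed.

Lemma arch_idx_inj k l : (k < n)%N -> (l < n)%N -> arch_idx k = arch_idx l -> k = l.
Proof.
move=> kn ln /(congr1 val) /=; rewrite !val_arch_idx => /eqP.
by rewrite eqn_modDl !modn_small // => /eqP.
Qed.

Lemma arch_idx_surj (j : 'I_n) : exists2 k, (k < n)%N & arch_idx k = j.
Proof.
exists ((j + (n - i)) %% n)%N; first by rewrite ltn_mod; lia.
apply/val_inj; rewrite /= val_arch_idx modnDmr.
have hi := ltn_ord i.
by rewrite (_ : (i + (j + (n - i)) = j + n)%N) ?modnDr ?modn_small //; lia.
Qed.

Lemma div_turn k : ((i + (k + n)) %/ n)%N = ((i + k) %/ n).+1.
Proof. by rewrite addnA divnDr ?dvdnn // divnn (_ : (0 < n)%N) ?addn1; [|lia]. Qed.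

Lemma loDn k : lo (k + n) = lo k + 2 * pi.
Proof. by rewrite /lo arch_idxDn div_turn -natr1; ring. Qed.

Lemma lo_lt_hi k : lo k < hi k.
Proof. by case: hP => _ h _; rewrite ltrD2r. Qed.

Lemma hi_le_lo k : hi k <= lo k.+1.
Proof.
case: hP => _ _ /(_ (arch_idx k)); rewrite -arch_idxS /hi /lo val_arch_idx addnS.
case: eqP => [e|ne] h.
  have -> : ((i + k).+1 %/ n)%N = ((i + k) %/ n).+1.
    by rewrite divnS; [rewrite (_ : n %| _)%N ?add1n //; rewrite /dvdn -addn1 -modnDml addn1 e modnn|lia].
  by rewrite -natr1; lra.
have -> : ((i + k).+1 %/ n)%N = ((i + k) %/ n)%N.
  rewrite divnS; last by lia.
  rewrite (_ : (n %| _)%N = false) //; apply/negP; rewrite /dvdn -addn1 -modnDml addn1 => /eqP e.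
  apply: ne; have := ltn_pmod (i + k) (_ : (0 < n)%N) => /(_ ltac:(lia)).
  rewrite leq_eqVlt => /orP[/eqP //|h2].
  by move: e; rewrite modn_small.
by lra.
Qed.

Lemma lo_le k l : (k <= l)%N -> lo k <= lo l.
Proof.
move=> /subnKC <-; elim: (l - k)%N => [|m IH]; first by rewrite addn0.
by rewrite addnS (le_trans IH) // (le_trans (ltW (lo_lt_hi _))) // hi_le_lo.
Qed.

Lemma hi_le_lo_lt k l : (k < l)%N -> hi k <= lo l.
Proof. by move=> kl; rewrite (le_trans (hi_le_lo _)) // lo_le. Qed.

Lemma hi_le k l : (k <= l)%N -> hi k <= hi l.
Proof.
rewrite leq_eqVlt => /predU1P[->//|kl].
by rewrite (le_trans (hi_le_lo_lt kl)) // ltW // lo_lt_hi.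
Qed.

Lemma lo_lt k l : (k < l)%N -> lo k < lo l.
Proof. by move=> kl; rewrite (lt_le_trans (lo_lt_hi _)) // hi_le_lo_lt. Qed.

Lemma ideal_lo k : ideal (lo k) = ideal (tail P (arch_idx k)).
Proof.
rewrite /lo; elim: (_ %/ _)%N => [|m IH]; first by rewrite mulr0 addr0.
by rewrite -[m.+1%:R]natr1 mulrDr mulr1 addrA idealD2pi.
Qed.

Lemma ideal_hi k : ideal (hi k) = ideal (Defs.head P (arch_idx k)).
Proof.
rewrite /hi; elim: (_ %/ _)%N => [|m IH]; first by rewrite mulr0 addr0.
by rewrite -[m.+1%:R]natr1 mulrDr mulr1 addrA idealD2pi.
Qed.

Lemma normalE k : normal P (arch_idx k) = left_normal (lo k) (hi k).
Proof.
rewrite /normal /lo /hi; elim: (_ %/ _)%N => [|m IH]; first by rewrite mulr0 !addr0.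
by rewrite -[m.+1%:R]natr1 mulrDr mulr1 !addrA left_normalD2pi.
Qed.

Lemma lo_lt_hi_lt k : lo k < hi k < lo k + 2 * pi.
Proof.
rewrite lo_lt_hi -loDn (le_lt_trans (hi_le_lo _)) // lo_lt //; lia.
Qed.

Lemma normal_unit (j : 'I_n) : mdot (normal P j) (normal P j) = 1.
Proof.
by have [k _ <-] := arch_idx_surj j; rewrite normalE left_normal_unit // lo_lt_hi_lt.
Qed.

(** Up to one turn, an angle of the gap lies in the arc which is on the left
    of each arch. *)
Lemma gap_ge0 j (k : 'I_n) t : (j < n)%N -> hi j <= t <= lo j.+1 ->
  0 <= mdot (ideal t) (normal P k).
Proof.
move=> jn /andP[t1 t2]; have [m mn <-] := arch_idx_surj k; rewrite normalE.
have /andP[h1 h2] := lo_lt_hi_lt m.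
have z : hi m <= lo m + 2 * pi by exact: ltW.
case: (leqP m j) => mj.
  apply: side_ge0 => //; first by rewrite (le_trans _ t1) // hi_le.
  by rewrite (le_trans t2) // -loDn lo_le //; lia.
rewrite -idealD2pi; apply: side_ge0 => //.
  apply: (@le_trans _ _ (lo n)); first exact: hi_le_lo_lt.
  rewrite (_ : n = 0 + n)%N // loDn lerD2r (le_trans _ t1) //.
  by rewrite (le_trans (@lo_le _ j _)) // ltW // lo_lt_hi.
by rewrite lerD2r (le_trans t2) // lo_le.
Qed.

Lemma ideal_locate t : lo 0 < t -> t < lo n -> exists2 k, (k < n)%N &
  (lo k < t < hi k) \/ (hi k <= t <= lo k.+1).
Proof.
move=> t0; have : (0 < n)%N by lia.
elim: n => // m IH _ tm.
case: (ltP t (lo m)) => [tlm|mlt].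
  case: m IH tm tlm => [|m] IH tm tlm; first by rewrite ltNge ltW in tlm.
  by have [k km hk] := IH isT tlm; exists k => //; lia.
case: (ltP t (hi m)) => th; last first.
  by exists m => //; right; rewrite th ltW.
move: mlt; rewrite le_eqVlt => /predU1P[e|mlt]; last first.
  by exists m => //; left; rewrite mlt.
case: m e {IH tm th} => [|m] e; first by rewrite e ltxx in t0.
by exists m => //; right; rewrite -e hi_le_lo lexx.
Qed.

End unrolled.

Section arches.
Context {R : realType} {n : nat}.
Variables (P : polygon R n) (hP : flippered P).

(** A point of the arch k is a positive combination of the two ends of k; both
    are on the nonnegative side of l, and since there are at least three
    arches at most one of them is an end of l. *)
Lemma arch_gt0 (k l : 'I_n) p : arch P k p -> k != l -> 0 < mdot p (normal P l).
Proof.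
move=> [Hp pk] kl.
have n3 : (3 <= n)%N by case: hP.
have [m mn ek] := arch_idx_surj hP l k.
have m0 : (0 < m)%N by rewrite lt0n; apply: contra_neq kl => m0; rewrite -ek m0.
move: pk; rewrite -ek normalE => pk.
have [x [y [x0 y0 ->]]] := geodesic_span (lo_lt_hi_lt hP l m) Hp pk.
have /andP[h1 h2] := lo_lt_hi_lt hP l 0.
rewrite -[l in normal P l]/(arch_idx l 0) normalE mdotDl !mdotZl.
have hm := lo_lt_hi hP l m.
have a1 : hi P l 0 <= lo P l m by exact: hi_le_lo_lt.
have a2 : hi P l m <= lo P l 0 + 2 * pi by rewrite -loDn //; apply: hi_le_lo_lt.
case: (ltnP m.+1 n) => [mn1|].
  have a3 : hi P l m < lo P l 0 + 2 * pi.
    by rewrite -loDn // (le_lt_trans (hi_le_lo hP l m)) // lo_lt.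
  rewrite ltr_wpDl ?mulr_ge0 ?mulr_gt0 ?(ltW x0) // ?side_gt0 ?side_ge0 //; lra.
move=> nm.
have a3 : hi P l 0 < lo P l m.
  by rewrite (le_lt_trans (hi_le_lo hP l 0)) // lo_lt //; lia.
rewrite ltr_pwDl ?mulr_ge0 ?mulr_gt0 ?(ltW y0) // ?side_gt0 ?side_ge0 //; lra.
Qed.

End arches.
(** * Domains of orthojectories *)

Section orthojectories.
Context {R : realType} {n : nat}.
Variables (P : polygon R n) (hP : flippered P).
Implicit Types (i j k m : 'I_n) (p q y : 'rV[R]_3) (t : R).

Lemma mdot_normal_normal k : mdot (normal P k) (normal P k) = 1.
Proof. exact: (normal_unit hP k). Qed.

Lemma arch_surface k p : arch P k p -> surface P p.
Proof.
move=> pk; split; first by case: pk.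
move=> m; have [->|km] := eqVneq m k; first by case: pk => _ ->.
by rewrite ltW // (arch_gt0 hP pk) // eq_sym.
Qed.

Lemma not_boundary p : H2 p -> (forall k, 0 < mdot p (normal P k)) -> ~ boundary P p.
Proof. by move=> Hp h [k _ [_ e]]; have := h k; rewrite e ltxx. Qed.

(** The function is expR (- t) * a + sinh t * (a + b). *)
Lemma grow_gt0 (a b t : R) : 0 < a -> 0 <= a + b -> 0 <= t -> 0 < cosh t * a + sinh t * b.
Proof.
move=> a0 ab t0; have s0 := sinh_ge0 t0; have e0 := expR_gt0 (- t).
have h : 0 < expR (- t) * a by rewrite mulr_gt0.
move: h; rewrite -coshBsinh; have := mulr_ge0 s0 ab; lra.
Qed.

(** The function is a multiple of expR (- t) * (r - expR (2 * t)), with r = (a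
    - b) / - (a + b) greater than 1. *)
Lemma shrink_root (a b : R) : 0 < a -> a + b < 0 -> exists2 l, 0 < l &
  forall t, [/\ t < l -> 0 < cosh t * a + sinh t * b,
    t = l -> cosh t * a + sinh t * b = 0 & l < t -> cosh t * a + sinh t * b < 0].
Proof.
move=> a0 ab; pose r := (a - b) / - (a + b).
have r1 : 1 < r by rewrite ltr_pdivlMr ?oppr_gt0 //; lra.
have r0 : 0 < r by lra.
exists (ln r / 2); first by rewrite divr_gt0 // ln_gt0.
move=> t.
have e : cosh t * a + sinh t * b = (- (a + b) / 2) * expR (- t) * (r - expR (2 * t)).
  rewrite /cosh /sinh expRN (_ : expR (2 * t) = expR t ^+ 2) ?expRM_natl //.
  have := expR_gt0 t; set x := expR t => x0; rewrite /r.
  have n1 : x != 0 by rewrite gt_eqF.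
  have n2 : a + b != 0 by rewrite lt_eqF.
  by field; rewrite ?n1 -?opprD ?oppr_eq0 ?n2.
have c0 : 0 < (- (a + b) / 2) * expR (- t) by rewrite mulr_gt0 ?expR_gt0 //; lra.
split => [h|h|h].
- rewrite e mulr_gt0 // subr_gt0 -[ltRHS](lnK r0) ltr_expR; lra.
- rewrite e h (_ : 2 * (ln r / 2) = ln r); last by lra.
  by rewrite lnK // subrr mulr0.
- rewrite e pmulr_rlt0 // subr_lt0 -[ltLHS](lnK r0) ltr_expR; lra.
Qed.

Section based.
Variables (i : 'I_n) (p : 'rV[R]_3) (pi_ : arch P i p).
Local Notation ray := (geodesic p (normal P i)).

Lemma H2_ray t : H2 (ray t).
Proof. by case: pi_ => Hp pn; apply: H2_geodesic => //; exact: mdot_normal_normal. Qed.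

Lemma ray_normal t : mdot (ray t) (normal P i) = sinh t.
Proof. by case: pi_ => _ pn; rewrite mdot_geodesic pn mdot_normal_normal; ring. Qed.

Lemma ray_gt0 k t : k != i -> 0 <= mdot (p + normal P i) (normal P k) -> 0 <= t ->
  0 < mdot (ray t) (normal P k).
Proof.
move=> ki h t0; rewrite mdot_geodesic; apply: grow_gt0 => //.
  by apply: (arch_gt0 hP pi_); rewrite eq_sym.
by rewrite -mdotDl.
Qed.

(** Along the ray the product with the normal of k is cosh t times a positive
    number plus sinh t times another one, and the sum of both numbers is the
    product of that normal with the end of the ray. *)
Lemma dom_ray : (forall k, k != i -> 0 <= mdot (p + normal P i) (normal P k)) ->
  orthojectory_dom P i p = [set t | 0 <= t] /\
  forall t, 0 < t -> ~ boundary P (ray t).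
Proof.
move=> h; split.
  apply/seteqP; split => t /=; first by case.
  move=> t0; split => //; split; first exact: H2_ray.
  move=> k; have [->|ki] := eqVneq k i; first by rewrite ray_normal sinh_ge0.
  by rewrite ltW // ray_gt0 ?h.
move=> t t0; apply: not_boundary; first exact: H2_ray.
move=> k; have [->|ki] := eqVneq k i; first by rewrite ray_normal sinh_gt0.
by rewrite ray_gt0 ?h ?ltW.
Qed.

Lemma dom_segment k : k != i -> mdot (p + normal P i) (normal P k) < 0 ->
  (forall m, m != i -> m != k -> 0 <= mdot (p + normal P i) (normal P m)) ->
  exists2 l, 0 < l &
    [/\ orthojectory_dom P i p = `[0, l]%classic, arch P k (ray l) &
        forall t, 0 < t < l -> ~ boundary P (ray t)].
Proof.
move=> ki hk h.
have pk : 0 < mdot p (normal P k) by apply: (arch_gt0 hP pi_); rewrite eq_sym.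
have hk' := hk; rewrite mdotDl in hk'.
have [l l0 hl] := shrink_root pk hk'.
exists l => //; split.
- apply/seteqP; split => t /=.
    move=> [t0 [_ st]]; rewrite in_itv /= t0 /= leNgt; apply/negP => lt.
    by have := st k; rewrite mdot_geodesic leNgt; case: (hl t) => _ _ ->.
  rewrite in_itv /= => /andP[t0 tl]; split => //; split; first exact: H2_ray.
  move=> m; have [->|mi] := eqVneq m i; first by rewrite ray_normal sinh_ge0.
  have [->|mk] := eqVneq m k; last by rewrite ltW // ray_gt0 ?h.
  rewrite mdot_geodesic; case: (hl t) => h1 h2 _.
  by move: tl; rewrite le_eqVlt => /predU1P[/h2 ->//|/h1 /ltW].
- split; first exact: H2_ray.
  by rewrite mdot_geodesic; case: (hl l) => _ ->.
- move=> t /andP[t0 tl]; apply: not_boundary; first exact: H2_ray.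
  move=> m; have [->|mi] := eqVneq m i; first by rewrite ray_normal sinh_gt0.
  have [->|mk] := eqVneq m k; last by rewrite ray_gt0 ?h ?ltW.
  by rewrite mdot_geodesic; case: (hl t) => ->.
Qed.

End based.
End orthojectories.

Section unitize.
Context {R : realType}.
Implicit Types (y q : 'rV[R]_3).

(** The point of the hyperboloid on the ray of a timelike vector: projecting
    sums of vectors gives deformations inside a convex surface. *)
Definition unitize y := (Num.sqrt (- mdot y y))^-1 *: y.

Lemma unitize_gt0 y : mdot y y < 0 -> 0 < (Num.sqrt (- mdot y y))^-1.
Proof. by move=> h; rewrite invr_gt0 sqrtr_gt0 oppr_gt0. Qed.

Lemma H2_unitize y : mdot y y < 0 -> 0 < y 0 0 -> H2 (unitize y).
Proof.
move=> yy y0; split; last by rewrite /unitize mxE mulr_gt0 // unitize_gt0.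
rewrite /unitize mdotZl mdotZr mulrA -expr2 exprVn sqr_sqrtr ?oppr_ge0 ?ltW //.
by field; rewrite lt_eqF.
Qed.

Lemma mdot_unitize y q : mdot (unitize y) q = (Num.sqrt (- mdot y y))^-1 * mdot y q.
Proof. by rewrite /unitize mdotZl. Qed.

Lemma unitize_H2 y : H2 y -> unitize y = y.
Proof. by move=> [yy _]; rewrite /unitize yy opprK sqrtr1 invr1 scale1r. Qed.

(** The height of y + c *: ideal t grows like c, but its length only like the
    square root of c. The bound on c is uniform in y and t, so that whole
    families of points leave a compact set. *)
Lemma unitize_deep y (G M c t : R) : mdot y y <= 0 -> 0 <= y 0 0 -> y 0 0 <= G -> 0 <= M ->
  1 + M ^+ 2 * (G ^+ 2 + 4 * G) <= c -> mdot (y + c *: ideal t) (y + c *: ideal t) < 0 ->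
  M < unitize (y + c *: ideal t) 0 0.
Proof.
move=> yy y0 yG M0 hc neg.
have G0 : 0 <= G by lra.
have h1 : 0 <= M ^+ 2 * (G ^+ 2 + 4 * G) by rewrite mulr_ge0 ?addr_ge0 ?sqr_ge0 ?mulr_ge0.
have c1 : 1 <= c by lra.
have yi : - mdot y (ideal t) <= 2 * G.
  have cs := cos2Dsin2 t.
  have h : y 0 1 ^+ 2 + y 0 2 ^+ 2 <= y 0 0 ^+ 2 by move: yy; rewrite /mdot; lra.
  rewrite /mdot !mxE /=.
  set x := y 0 1 * cos t + y 0 2 * sin t.
  have hx : x ^+ 2 <= y 0 0 ^+ 2.
    have : x ^+ 2 + (y 0 1 * sin t - y 0 2 * cos t) ^+ 2 = (y 0 1 ^+ 2 + y 0 2 ^+ 2) * (cos t ^+ 2 + sin t ^+ 2).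
      by rewrite /x; ring.
    by rewrite cs mulr1; have := sqr_ge0 (y 0 1 * sin t - y 0 2 * cos t); lra.
  have : - x <= y 0 0.
    rewrite leNgt; apply/negP => hlt.
    have : y 0 0 ^+ 2 < (- x) ^+ 2 by rewrite ltr_pXn2r ?nnegrE //; lra.
    by rewrite sqrrN; lra.
  lra.
set Y := y + c *: ideal t in neg *.
have eY : - mdot Y Y = - mdot y y + 2 * c * - mdot y (ideal t).
  by rewrite /Y mdotDl !mdotDr !mdotZl !mdotZr ideal_null (mdotC (ideal t)); ring.
have eY0 : Y 0 0 = y 0 0 + c by rewrite /Y !mxE /= mulr1.
have yG2 : - mdot y y <= G ^+ 2.
  have : y 0 0 ^+ 2 <= G ^+ 2 by rewrite ler_pXn2r ?nnegrE.
  by rewrite /mdot; have := sqr_ge0 (y 0 1); have := sqr_ge0 (y 0 2); rewrite !expr2; lra.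
have bound : M ^+ 2 * - mdot Y Y < Y 0 0 ^+ 2.
  have b1 : - mdot Y Y <= c * (G ^+ 2 + 4 * G).
    have g1 : G ^+ 2 <= c * G ^+ 2 by rewrite ler_peMl // sqr_ge0.
    have g2 : c * - mdot y (ideal t) <= c * (2 * G) by rewrite ler_wpM2l //; lra.
    rewrite eY; lra.
  have b2 : M ^+ 2 * - mdot Y Y <= c * (c - 1).
    apply: (@le_trans _ _ (c * (M ^+ 2 * (G ^+ 2 + 4 * G)))).
      by rewrite mulrCA ler_wpM2l ?sqr_ge0.
    by rewrite ler_wpM2l //; lra.
  have b3 : c ^+ 2 <= Y 0 0 ^+ 2 by rewrite ler_pXn2r ?nnegrE //; lra.
  move: b3; rewrite expr2; lra.
have sp : 0 < Num.sqrt (- mdot Y Y) by rewrite sqrtr_gt0 oppr_gt0.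
rewrite /unitize [X in _ < X]mxE mulrC ltr_pdivlMr //.
have : (M * Num.sqrt (- mdot Y Y)) ^+ 2 < Y 0 0 ^+ 2.
  by rewrite exprMn sqr_sqrtr // oppr_ge0 ltW.
by rewrite ltr_pXn2r // ?nnegrE ?mulr_ge0 ?(ltW sp) //; lra.
Qed.

End unitize.

(** * Continuity and compactness *)

Lemma continuous_idfun (T : topologicalType) : continuous (fun x : T => x).
Proof. by move=> x A. Qed.

Lemma continuous_fst (T U : topologicalType) : continuous (fun z : T * U => z.1).
Proof. by move=> x; exact: cvg_fst. Qed.

Lemma continuous_snd (T U : topologicalType) : continuous (fun z : T * U => z.2).
Proof. by move=> x; exact: cvg_snd. Qed.

Lemma continuous_pair1 (T U : topologicalType) (a : T) : continuous (fun t : U => (a, t)).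
Proof.
by move=> t; apply: cvg_pair; [exact: (@cst_continuous U T a)|exact: continuous_idfun].
Qed.

Lemma continuous_pair2 (T U : topologicalType) (a : U) : continuous (fun t : T => (t, a)).
Proof.
by move=> t; apply: cvg_pair; [exact: continuous_idfun|exact: (@cst_continuous T U a)].
Qed.

Lemma closed_setX (T U : topologicalType) (A : set T) (B : set U) :
  closed A -> closed B -> closed (A `*` B).
Proof.
move=> cA cB; have -> : A `*` B = fst @^-1` A `&` snd @^-1` B by [].
by apply: closedI; apply: closed_comp => // x _; [exact: continuous_fst|exact: continuous_snd].
Qed.

Section continuity.
Context {R : realType} {T : topologicalType}.
Implicit Types (f g : T -> 'rV[R]_3).

Lemma continuous_mul (a b : T -> R) : continuous a -> continuous b ->
  continuous (fun x => a x * b x).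
Proof. by move=> ca cb x; apply: cvgM; [exact: ca|exact: cb]. Qed.

Lemma continuous_add (a b : T -> R) : continuous a -> continuous b ->
  continuous (fun x => a x + b x).
Proof. by move=> ca cb x; apply: cvgD; [exact: ca|exact: cb]. Qed.

Lemma continuous_abs (a : T -> R) : continuous a -> continuous (fun x => `|a x|).
Proof. by move=> ca x; apply: cvg_norm; exact: ca. Qed.

Lemma continuous_cosh : continuous (@cosh R).
Proof.
move=> x; rewrite /cosh; apply: cvgMl; apply: cvgD; first exact: continuous_expR.
by apply: (@continuous_comp _ _ _ -%R expR); [exact: opp_continuous|exact: continuous_expR].
Qed.

Lemma continuous_sinh : continuous (@sinh R).
Proof.
move=> x; rewrite /sinh; apply: cvgMl; apply: cvgB; first exact: continuous_expR.
by apply: (@continuous_comp _ _ _ -%R expR); [exact: opp_continuous|exact: continuous_expR].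
Qed.

Lemma continuous_coord f k : continuous f -> continuous (fun x => f x 0 k).
Proof.
move=> cf x; apply: (@continuous_comp _ _ _ f (fun M : 'rV[R]_3 => M 0 k)).
  exact: cf.
exact: (@coord_continuous R 1 3).
Qed.

Lemma continuous_mdot f g : continuous f -> continuous g -> continuous (fun x => mdot (f x) (g x)).
Proof.
move=> cf cg x; have h f' k (cf' : continuous f') := @continuous_coord f' k cf' x.
rewrite /mdot; apply: cvgB; first apply: cvgD; apply: cvgM; exact: h.
Qed.

Lemma continuous_vec3 (a b c : T -> R) : continuous a -> continuous b -> continuous c ->
  continuous (fun x => vec3 (a x) (b x) (c x)).
Proof.
move=> ca cb cc.
have -> : (fun x => vec3 (a x) (b x) (c x)) =
    (fun y => a y *: vec3 1 0 0 + b y *: vec3 0 1 0 + c y *: vec3 0 0 1).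
  by apply/funext => y; rewrite !scale_vec3; apply: row3P; rewrite !mxE /=; ring.
by move=> x; apply: cvgD; first apply: cvgD; apply: cvgZr_tmp; [exact: ca|exact: cb|exact: cc].
Qed.

Lemma continuous_ideal (a : T -> R) : continuous a -> continuous (fun x => ideal (a x)).
Proof.
move=> ca; have e : (fun x => ideal (a x)) = (fun x => vec3 1 (cos (a x)) (sin (a x))) by [].
rewrite e; apply: continuous_vec3; first by move=> x; exact: cvg_cst.
  by move=> x; apply: (@continuous_comp _ _ _ a (@cos R)); [exact: ca|exact: continuous_cos].
by move=> x; apply: (@continuous_comp _ _ _ a (@sin R)); [exact: ca|exact: continuous_sin].
Qed.

Lemma continuous_geodesic (a : T -> R) f g : continuous a -> continuous f -> continuous g ->
  continuous (fun x => geodesic (f x) (g x) (a x)).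
Proof.
move=> ca cf cg x; rewrite /geodesic; apply: cvgD; apply: cvgZ => //; try exact: cf; try exact: cg.
  by apply: (@continuous_comp _ _ _ a (@cosh R)); [exact: ca|exact: continuous_cosh].
by apply: (@continuous_comp _ _ _ a (@sinh R)); [exact: ca|exact: continuous_sinh].
Qed.

Lemma continuous_unitize f : continuous f -> (forall x, mdot (f x) (f x) < 0) ->
  continuous (fun x => unitize (f x)).
Proof.
move=> cf neg x; rewrite /unitize; apply: cvgZ; last exact: cf.
apply: cvgV; first by rewrite gt_eqF // sqrtr_gt0 oppr_gt0.
apply: (@continuous_comp _ _ _ (fun x => - mdot (f x) (f x)) Num.sqrt).
  by apply: cvgN; exact: continuous_mdot.
exact: sqrt_continuous.
Qed.

End continuity.

Section push.
Context {R : realType}.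
Implicit Types (y q : 'rV[R]_3) (c t : R).

Lemma mdot_future_ideal y t : mdot y y < 0 -> 0 < y 0 0 -> mdot y (ideal t) < 0.
Proof. by move=> yy y0; rewrite mdotC causal_lt ?ideal_null ?ideal00. Qed.

Lemma push_timelike y c t : mdot y y < 0 -> 0 < y 0 0 -> 0 <= c ->
  mdot (y + c *: ideal t) (y + c *: ideal t) < 0.
Proof.
move=> yy y0 c0; have h := mdot_future_ideal t yy y0.
rewrite mdotDl !mdotDr !mdotZl !mdotZr ideal_null (mdotC (ideal t)).
have : c * mdot y (ideal t) <= 0 by rewrite mulr_ge0_le0 // ltW.
lra.
Qed.

(** Moving y towards a point at infinity. A linear form which is nonnegative,
    or zero, at both remains so. *)
Definition push y c t := unitize (y + c *: ideal t).

Lemma H2_push y c t : mdot y y < 0 -> 0 < y 0 0 -> 0 <= c -> H2 (push y c t).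
Proof.
move=> yy y0 c0; apply: H2_unitize; first exact: push_timelike.
by rewrite !mxE /= mulr1 ltr_pwDl.
Qed.

Lemma push_ge0 y c t q : mdot y y < 0 -> 0 < y 0 0 -> 0 <= c ->
  0 <= mdot y q -> 0 <= mdot (ideal t) q -> 0 <= mdot (push y c t) q.
Proof.
move=> yy y0 c0 yq tq; rewrite /push mdot_unitize; apply: mulr_ge0.
  by apply/ltW/unitize_gt0/push_timelike.
by rewrite mdotDl mdotZl addr_ge0 // mulr_ge0.
Qed.

Lemma push_eq0 y c t q : mdot y q = 0 -> mdot (ideal t) q = 0 -> mdot (push y c t) q = 0.
Proof.
move=> yq tq; have e : mdot (y + c *: ideal t) q = 0 by rewrite mdotDl mdotZl yq tq; ring.
by rewrite /push mdot_unitize e mulr0.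
Qed.

Lemma push0 y t : H2 y -> push y 0 t = y.
Proof. by move=> Hy; rewrite /push scale0r addr0 unitize_H2. Qed.

Lemma continuous_push (T : topologicalType) (y : T -> 'rV[R]_3) (c t : T -> R) :
  continuous y -> continuous c -> continuous t -> (forall x, mdot (y x) (y x) < 0) ->
  (forall x, 0 < y x 0 0) -> (forall x, 0 <= c x) ->
  continuous (fun x => push (y x) (c x) (t x)).
Proof.
move=> cy cc ct yy y0 c0; apply: continuous_unitize => x; last exact: push_timelike.
apply: cvgD; first exact: cy.
by apply: cvgZ; [exact: cc|exact: continuous_ideal].
Qed.

Lemma geodesic00 y q t : geodesic y q t 0 0 = cosh t * y 0 0 + sinh t * q 0 0.
Proof. by rewrite /geodesic !mxE. Qed.

Lemma depth_ge0 (M G : R) : 0 <= G -> 0 <= 1 + M ^+ 2 * (G ^+ 2 + 4 * G).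
Proof. by move=> G0; rewrite addr_ge0 // mulr_ge0 ?addr_ge0 ?sqr_ge0 ?mulr_ge0. Qed.

Lemma compact_above (T : topologicalType) (f : T -> R) (K : set T) : continuous f -> compact K ->
  exists2 M, 0 <= M & forall x, K x -> f x <= M.
Proof.
move=> cf cK.
have : compact [set f x | x in K].
  by apply: (@continuous_compact T _ f) => //; exact: continuous_subspaceT.
move=> /compact_bounded [M [_ hM]].
exists (`|M| + 1); first by rewrite addr_ge0.
move=> x Kx; apply: (le_trans (ler_norm _)).
by apply: (hM (`|M| + 1)); [rewrite (le_lt_trans (ler_norm _)) // ltrDl|exists x].
Qed.

Lemma compact_height (K : set 'rV[R]_3) : compact K ->
  exists2 M, 0 <= M & forall x, K x -> x 0 0 <= M.
Proof. by apply: compact_above; exact: (@coord_continuous R 1 3). Qed.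

Lemma geodesic0 y q : geodesic y q 0 = y.
Proof.
rewrite /geodesic /cosh /sinh oppr0 subrr mul0r scale0r addr0 expR0.
by rewrite (_ : (1 + 1) / 2 = 1) ?scale1r //; lra.
Qed.

Lemma sinh_ge_half t : 0 <= t -> t / 2 <= sinh t.
Proof.
move=> t0; rewrite /sinh ler_pM2r ?invr_gt0 //.
have h1 := expR_ge1Dx t; have : expR (- t) <= expR 0 by rewrite ler_expR; lra.
by rewrite expR0; lra.
Qed.

(** Properness of a homotopy only requires a bound on the parameters which are
    sent to K. *)
Lemma compact_preimage (B B' : set (R * R)) (h : R * R -> 'rV[R]_3) (K : set 'rV[R]_3) :
  continuous h -> closed B -> compact B' -> B `&` h @^-1` K `<=` B' -> compact K ->
  compact (B `&` h @^-1` K).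
Proof.
move=> ch clB cB' sub cK; apply: (subclosed_compact _ cB' sub); apply: closedI => //.
apply: closed_comp => [z _|]; first exact: ch.
by apply: compact_closed => //; exact: norm_hausdorff.
Qed.

End push.
(** * Peripheral orthojectories *)

Section peripheral_orthojectories.
Context {R : realType} {n : nat}.
Variables (P : polygon R n) (hP : flippered P).
Implicit Types (i j k m : 'I_n) (p q : 'rV[R]_3) (t : R).

Lemma closed_coord_le (k : 'I_3) (a : R) : closed [set x : 'rV[R]_3 | a <= x 0 k].
Proof.
have := @closed_comp _ _ (fun x : 'rV[R]_3 => x 0 k) [set y | a <= y].
by apply => [x _|]; [exact: (@coord_continuous R 1 3)|exact: closed_ge].
Qed.

Lemma ge_continuous (T : topologicalType) (f : T -> R) a : continuous f -> closed [set x | a <= f x].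
Proof. by move=> cf; apply: (@closed_comp _ _ f [set y | a <= y]) => [x _|]; [exact: cf|exact: closed_ge]. Qed.

Lemma eq_continuous (T : topologicalType) (f : T -> R) a : continuous f -> closed [set x | f x = a].
Proof. by move=> cf; apply: (@closed_comp _ _ f [set y | y = a]) => [x _|]; [exact: cf|exact: closed_eq]. Qed.

Lemma continuous_mdotr q : continuous (fun x : 'rV[R]_3 => mdot x q).
Proof.
apply: (@continuous_mdot R _ (fun x : 'rV[R]_3 => x) (fun=> q)).
  exact: continuous_idfun.
exact: cst_continuous.
Qed.

(** The hyperboloid has two sheets, and the height is never 0 on it. *)
Lemma closed_H2 : closed (@H2 R).
Proof.
have -> : @H2 R = [set p | mdot p p = -1] `&` [set p | 0 <= p 0 0].
  apply/seteqP; split => p /= [pp p0]; split => //; first exact: ltW.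
  rewrite lt_neqAle p0 andbT; apply/eqP => e.
  by move: pp; rewrite /mdot -e; have := sqr_ge0 (p 0 1); have := sqr_ge0 (p 0 2); rewrite !expr2; lra.
apply: closedI; last exact: closed_coord_le.
apply: (@eq_continuous _ (fun p : 'rV[R]_3 => mdot p p)).
by apply: (@continuous_mdot R _ (fun x => x) (fun x => x)); exact: continuous_idfun.
Qed.

Lemma closed_arch i : closed (arch P i).
Proof.
have -> : arch P i = @H2 R `&` [set p | mdot p (normal P i) = 0] by [].
apply: closedI; first exact: closed_H2.
exact: (@eq_continuous _ (fun p : 'rV[R]_3 => mdot p (normal P i)) 0 (@continuous_mdotr _)).
Qed.

Lemma closed_surface : closed (surface P).
Proof.
have -> : surface P = @H2 R `&` \bigcap_i [set p | 0 <= mdot p (normal P i)].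
  by apply/seteqP; split => p /= [Hp h]; split => // i; [move=> _|]; exact: h.
apply: closedI; first exact: closed_H2.
by apply: closed_bigI => i _; exact: (@ge_continuous _ (fun p : 'rV[R]_3 => mdot p (normal P i)) 0 (@continuous_mdotr _)).
Qed.

(** The sum of the two null ends is timelike and lies on the arch. *)
Lemma arch_nonempty k : exists q, arch P k q.
Proof.
have hk := lo_lt_hi_lt hP k 0; have ek := normalE P k 0.
pose y : 'rV[R]_3 := ideal (lo P k 0) + ideal (hi P k 0).
have yy : mdot y y < 0.
  rewrite /y mdotDl !mdotDr !ideal_null (mdotC (ideal (hi _ _ _))) mdot_ideal.
  have := chord_gt0 hk => ch; have : 0 < sin ((hi P k 0 - lo P k 0) / 2) ^+ 2 by rewrite exprn_gt0.
  lra.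
exists (unitize y); split; first by apply: H2_unitize => //; rewrite /y !mxE /=; lra.
have e : mdot y (normal P k) = 0.
  by rewrite -[k in normal P k]/(arch_idx k 0) ek /y mdotDl ideal_normal_l ideal_normal_r addr0.
by rewrite mdot_unitize e mulr0.
Qed.

(** The segment is pushed into the end: each of its points moves towards the
    ideal point which divides the gap in the same ratio. The end points stay on
    the two arches because they move towards an end of their arch. *)
Lemma peripheral_segment j i k p l th0 th1 :
  let ray := geodesic p (normal P i) in
  (i = j /\ k = ordS j) \/ (i = ordS j /\ k = j) ->
  arch P i p -> 0 < l -> orthojectory_dom P i p = `[0, l]%classic -> arch P k (ray l) ->
  (forall t, 0 < t < l -> ~ boundary P (ray t)) ->
  mdot (ideal th0) (normal P i) = 0 -> mdot (ideal th1) (normal P k) = 0 ->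
  (forall a m, 0 <= a <= 1 -> 0 <= mdot (ideal (th0 + a * (th1 - th0))) (normal P m)) ->
  peripheral P i p.
Proof.
move=> ray ik pi_ l0 dom kl bdry th0i th1k gap; exists j => K cK KS.
have [M M0 hM] := compact_height cK.
pose G := expR l * (p 0 0 + `|normal P i 0 0|).
(* The displacement which unitize_deep requires for points of height at most
   G. *)
pose c := 1 + M ^+ 2 * (G ^+ 2 + 4 * G).
have Hr t : H2 (ray t) by exact: H2_ray.
have rr t : mdot (ray t) (ray t) < 0 by case: (Hr t) => -> _; rewrite ltrN10.
have r0 t : 0 < ray t 0 0 by case: (Hr t).
have [[pp p0] _] := pi_.
have G0 : 0 <= G by rewrite /G mulr_ge0 ?expR_ge0 // addr_ge0 // (ltW p0).
have c0 : 0 <= c by exact: depth_ge0.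
have rG t : 0 <= t <= l -> ray t 0 0 <= G.
  move=> /andP[t0 tl]; rewrite /ray geodesic00.
  have e1 : expR t <= expR l by rewrite ler_expR.
  have e2 : cosh t <= expR t by rewrite -coshDsinh; have := sinh_ge0 t0; lra.
  have e3 : sinh t <= expR t by rewrite -coshDsinh; have := cosh_gt0 t; lra.
  have e4 : sinh t * normal P i 0 0 <= expR l * `|normal P i 0 0|.
    apply: (@le_trans _ _ (sinh t * `|normal P i 0 0|)).
      by rewrite ler_wpM2l ?sinh_ge0 ?ler_norm.
    by rewrite ler_wpM2r //; lra.
  have e5 : cosh t * p 0 0 <= expR l * p 0 0 by rewrite ler_wpM2r ?(ltW p0) //; lra.
  rewrite /G; lra.
pose th t := th0 + t / l * (th1 - th0).
pose h (z : R * R) := push (ray z.2) (c * `|z.1|) (th z.2).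
have ch : continuous h.
  apply: continuous_push.
  - by apply: continuous_geodesic; [exact: continuous_snd|exact: cst_continuous|exact: cst_continuous].
  - apply: continuous_mul; first exact: cst_continuous.
    by apply: continuous_abs; exact: continuous_fst.
  - apply: continuous_add; first exact: cst_continuous.
    apply: continuous_mul; last exact: cst_continuous.
    by apply: continuous_mul; [exact: continuous_snd|exact: cst_continuous].
  - by move=> z; exact: rr.
  - by move=> z; exact: r0.
  - by move=> z; rewrite mulr_ge0.
have tl t : 0 <= t <= l -> 0 <= t / l <= 1.
  by move=> /andP[t0 tl]; rewrite divr_ge0 ?(ltW l0) //= ler_pdivrMr // mul1r.
have hS s t : 0 <= t <= l -> surface P (h (s, t)).
  move=> tl0; split; first by apply: H2_push => //; rewrite mulr_ge0.
  move=> m; apply: push_ge0; rewrite ?mulr_ge0 //; last by apply: gap; exact: tl.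
  have : orthojectory_dom P i p t by rewrite dom.
  by move=> [_ [_ /(_ m)]].
have hi s : arch P i (h (s, 0)).
  split; first by apply: H2_push => //; rewrite mulr_ge0.
  apply: push_eq0; first by rewrite ray_normal // /sinh oppr0 subrr mul0r.
  by rewrite /th mul0r mul0r addr0.
have hk s : arch P k (h (s, l)).
  split; first by apply: H2_push => //; rewrite mulr_ge0.
  apply: push_eq0; first by case: kl.
  by rewrite /th divff ?gt_eqF // mul1r subrKC.
have ch1 : continuous (fun t => h (1, t)).
  move=> t; apply: (@continuous_comp _ _ _ (fun t => (1, t) : R * R) h); last exact: ch.
  exact: continuous_pair1.
pose C := [set h (1, t) | t in `[0, l]%classic].
exists h, C; split.
- split.
  + exact: continuous_subspaceT.
  + by move=> _ [[s t] [/= _ Dt] <-]; apply: hS; move: Dt; rewrite dom /= in_itv.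
  + move=> L cL LS; apply: (@compact_preimage _ _ (`[0, 1]%classic `*` `[0, l]%classic)) => //.
    * rewrite dom; apply: compact_closed; first exact: norm_hausdorff.
      by apply: compact_setX; exact: segment_compact.
    * by apply: compact_setX; exact: segment_compact.
    * by move=> z []; rewrite dom.
  + by move=> t Dt; rewrite /h /= normr0 mulr0 push0.
  + move=> s t [_]; rewrite dom /= in_itv /= => /andP[t0 tl0] bt.
    have [->|tn0] := eqVneq t 0; first by exists i.
    have [->|tnl] := eqVneq t l; first by exists k.
    by exfalso; apply: (bdry t) => //; rewrite !lt_neqAle t0 tl0 eq_sym tn0 tnl.
- split.
    apply: connected_continuous_connected; first exact: segment_connected.
    exact: continuous_subspaceT.
  move=> _ [t Dt <-]; have tl0 : 0 <= t <= l by move: Dt; rewrite /= in_itv.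
  split; first exact: hS.
  move=> Kh; have := hM _ Kh; rewrite leNgt => /negP; apply.
  rewrite /h /= normr1 mulr1; apply: (@unitize_deep _ _ G) => //.
  + exact/ltW/rr.
  + exact/ltW/r0.
  + exact: rG.
  + exact: push_timelike.
- case: ik => -[ei ek].
    by exists (h (1, 0)); split; [exists 0 => //=; rewrite in_itv /= lexx ltW|rewrite -ei].
  by exists (h (1, l)); split; [exists l => //=; rewrite in_itv /= lexx ltW|rewrite -ek].
- case: ik => -[ei ek].
    by exists (h (1, l)); split; [exists l => //=; rewrite in_itv /= lexx ltW|rewrite -ek].
  by exists (h (1, 0)); split; [exists 0 => //=; rewrite in_itv /= lexx ltW|rewrite -ei].
- by move=> t; rewrite dom => Dt; exists t.
Qed.

(** The ray is translated along its arch towards the end. The image alone does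
    not meet the other arch k, so it is completed by a path e, deep in the end,
    from its base point to a point of k. *)
Lemma peripheral_ray j i k p th0 th1 :
  (i = j /\ k = ordS j) \/ (i = ordS j /\ k = j) ->
  arch P i p ->
  mdot (ideal th0) (normal P i) = 0 -> mdot (ideal th1) (normal P k) = 0 ->
  (forall a m, 0 <= a <= 1 -> 0 <= mdot (ideal (th0 + a * (th1 - th0))) (normal P m)) ->
  (forall c m, 0 <= c -> m != i -> 0 <= mdot (push p c th0 + normal P i) (normal P m)) ->
  peripheral P i p.
Proof.
move=> ik pi_ th0i th1k gap shift; exists j => K cK KS.
have [M M0 hM] := compact_height cK.
have [[pp p0] _] := pi_.
have pn : mdot p p < 0 by rewrite pp ltrN10.
pose u := normal P i.
have [q kq] : exists q, arch P k q by exact: arch_nonempty.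
have [[qq q0] _] := kq.
(* The height along a translated ray is at least that of its base point minus
   `|u 0 0|. *)
pose M1 := M + `|u 0 0|.
pose G := p 0 0 + q 0 0.
pose c := 1 + M1 ^+ 2 * (G ^+ 2 + 4 * G).
have M10 : 0 <= M1 by rewrite /M1 addr_ge0.
have G0 : 0 <= G by rewrite /G addr_ge0 // ltW.
have c0 : 0 <= c by exact: depth_ge0.
have ai b : 0 <= b -> arch P i (push p b th0).
  by move=> b0; split; [exact: H2_push|apply: push_eq0 => //; case: pi_].
have domE b : 0 <= b -> orthojectory_dom P i (push p b th0) = [set t | 0 <= t].
  by move=> b0; case: (dom_ray hP (ai b b0)) => // m mi; exact: shift.
have dom0 : orthojectory_dom P i p = [set t | 0 <= t].
  by rewrite -(domE 0) // push0 //; case: pi_.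
have bdry t : 0 < t -> ~ boundary P (geodesic p u t).
  have [] := dom_ray hP pi_; first by move=> m mi; rewrite -[p](push0 th0) ?shift //; case: pi_.
  by move=> _; exact.
pose h (z : R * R) := geodesic (push p (c * `|z.1|) th0) u z.2.
have ch : continuous h.
  apply: continuous_geodesic; [exact: continuous_snd| |exact: cst_continuous].
  apply: continuous_push => //; try exact: cst_continuous; last by move=> z; rewrite mulr_ge0.
  apply: continuous_mul; first exact: cst_continuous.
  by apply: continuous_abs; exact: continuous_fst.
have hS s t : 0 <= t -> surface P (h (s, t)).
  move=> t0; have cs : 0 <= c * `|s| by rewrite mulr_ge0.
  have : orthojectory_dom P i (push p (c * `|s|) th0) t by rewrite domE.
  by case.
(* Absolute values make the path continuous on the whole line with values in
   the forward cone. *)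
pose x b := `|1 - b| *: p + `|b| *: q.
have xx b : mdot (x b) (x b) < 0.
  rewrite /x mdotDl !mdotDr !mdotZl !mdotZr pp qq (mdotC q p).
  have pq : mdot p q < 0 by apply: mdot_H2; [case: pi_|case: kq].
  have a1 := normr_ge0 (1 - b); have a2 := normr_ge0 b.
  have a3 : 1 <= `|1 - b| + `|b| by rewrite -[leLHS]normr1 -{1}(subrK b 1) ler_normD.
  set y := `|1 - b| in a1 a3 *; set z := `|b| in a2 a3 *.
  have a4 : y * (z * mdot p q) <= 0 by rewrite mulr_ge0_le0 // mulr_ge0_le0 // ltW.
  have := sqr_ge0 (y - z); have : 1 <= (y + z) ^+ 2 by rewrite expr_ge1 // addr_ge0.
  nra.
have x00 b : x b 0 0 = `|1 - b| * p 0 0 + `|b| * q 0 0 by rewrite /x !mxE.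
have x0 b : 0 < x b 0 0.
  rewrite x00; have [->|b0] := eqVneq b 0; first by rewrite subr0 normr1 normr0 mul0r mul1r addr0.
  by rewrite ltr_wpDl // ?mulr_ge0 ?(ltW p0) // mulr_gt0 // normr_gt0.
pose th b := th0 + b * (th1 - th0).
pose e b := push (x b) c (th b).
have ce : continuous e.
  apply: continuous_push.
  - move=> b; apply: cvgD; apply: cvgZr_tmp; apply: cvg_norm; last exact: continuous_idfun.
    by apply: cvgB; [exact: cvg_cst|exact: continuous_idfun].
  - exact: cst_continuous.
  - apply: continuous_add; first exact: cst_continuous.
    by apply: continuous_mul; [exact: continuous_idfun|exact: cst_continuous].
  - exact: xx.
  - exact: x0.
  - by move=> b; exact: c0.
have e0 : e 0 = h (1, 0).
  by rewrite /h /= geodesic0 normr1 mulr1 /e /x /th subr0 normr1 normr0 scale1r scale0r mul0r !addr0.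
have eS b : 0 <= b <= 1 -> surface P (e b).
  move=> b01; split; first exact: H2_push.
  move=> m; apply: push_ge0 => //; last exact: gap.
  rewrite /x mdotDl !mdotZl addr_ge0 // mulr_ge0 //.
    by case: (arch_surface hP pi_).
  by case: (arch_surface hP kq).
pose C1 := [set h (1, t) | t in `[0, +oo[%classic].
pose C2 := [set e b | b in `[0, 1]%classic].
have kC : arch P k (e 1).
  split; first exact: H2_push.
  apply: push_eq0; first by rewrite /x subrr normr0 scale0r add0r normr1 scale1r; case: kq.
  by rewrite /th mul1r subrKC.
have iC : arch P i (h (1, 0)) by rewrite /h /= geodesic0 normr1 mulr1; exact: ai.
have C2k : C2 (e 1) by exists 1 => //=; rewrite in_itv /= lexx ler01.
have C1i : C1 (h (1, 0)) by exists 0 => //=; rewrite in_itv /= lexx.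
have deep b : 0 <= b <= 1 -> M1 < e b 0 0.
  move=> /andP[b0 b1]; apply: (@unitize_deep _ _ G) => //; rewrite ?(ltW (xx _)) ?(ltW (x0 _)) //.
    rewrite x00 ger0_norm ?subr_ge0 // ger0_norm //.
    have : (1 - b) * p 0 0 <= p 0 0 by rewrite ger_pMl //; lra.
    have : b * q 0 0 <= q 0 0 by rewrite ger_pMl //; lra.
    by rewrite /G; lra.
  exact: push_timelike.
exists h, (C1 `|` C2); split.
- split.
  + exact: continuous_subspaceT.
  + by move=> _ [[s t] [/= _ Dt] <-]; apply: hS; move: Dt; rewrite dom0.
  + move=> L cL LS.
    have [N N0 hN] := compact_above (@continuous_mdotr u) cL.
    apply: (@compact_preimage _ _ (`[0, 1]%classic `*` `[0, 2 * N]%classic)) => //.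
    * apply: closed_setX; first exact: interval_closed.
      by rewrite dom0; exact: closed_ge.
    * by apply: compact_setX; exact: segment_compact.
    * move=> [s t] [[/= s01 Dt] Lh]; split => //=; rewrite in_itv /=.
      have t0 : 0 <= t by move: Dt; rewrite dom0.
      rewrite t0 /=; have := hN _ Lh; have := sinh_ge_half t0.
      have -> : mdot (h (s, t)) u = sinh t.
        by rewrite /h /= ray_normal //; apply: ai; rewrite mulr_ge0.
      lra.
  + by move=> t Dt; rewrite /h /= normr0 mulr0 push0 //; case: pi_.
  + move=> s t [_]; rewrite dom0 /= => t0 bt.
    have [->|tn0] := eqVneq t 0.
      by exists i => //; rewrite /h /= geodesic0; apply: ai; rewrite mulr_ge0.
    by exfalso; apply: (bdry t) => //; rewrite lt_neqAle t0 eq_sym tn0.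
- split.
    apply: connectedU.
    + by exists (h (1, 0)); split => //; rewrite -e0; exists 0 => //=; rewrite in_itv /= lexx ler01.
    + apply: connected_continuous_connected; first by apply/connected_intervalP; exact: interval_is_interval.
      apply: continuous_subspaceT => t.
      apply: (@continuous_comp _ _ _ (fun t => (1, t) : R * R) h); last exact: ch.
      exact: continuous_pair1.
    + apply: connected_continuous_connected; first exact: segment_connected.
      exact: continuous_subspaceT.
  move=> y [[t /= Dt <-]|[b Db <-]].
    have t0 : 0 <= t by move: Dt; rewrite in_itv /= andbT.
    split; first exact: hS.
    move=> Kh; have := hM _ Kh; rewrite leNgt => /negP; apply.
    rewrite /h /= geodesic00 normr1 mulr1.
    have := deep 0; rewrite lexx ler01 => /(_ isT); rewrite e0 /h /= geodesic0 normr1 mulr1.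
    set y0 := push _ _ _ 0 0 => hy.
    have h1 := cosh_ge1 t.
    have h2 : sinh t <= cosh t by rewrite -subr_ge0 coshBsinh expR_ge0.
    have h3 := sinh_ge0 t0.
    have h4 : - `|u 0 0| <= u 0 0 by rewrite lerNl -normrN ler_norm.
    have h5 : sinh t * - `|u 0 0| <= sinh t * u 0 0 by rewrite ler_wpM2l.
    have h6 : sinh t * `|u 0 0| <= cosh t * `|u 0 0| by rewrite ler_wpM2r.
    have h7 : y0 - `|u 0 0| <= cosh t * (y0 - `|u 0 0|).
      by rewrite ler_peMl // subr_ge0; move: hy; rewrite /M1; lra.
    move: hy; rewrite /M1; lra.
  have b01 : 0 <= b <= 1 by move: Db; rewrite /= in_itv.
  split; first exact: eS.
  move=> Kh; have := hM _ Kh; rewrite leNgt => /negP; apply.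
  have := deep _ b01; rewrite /M1; have := normr_ge0 (u 0 0); lra.
- case: ik => -[ei ek].
    by exists (h (1, 0)); split; [left|rewrite -ei].
  by exists (e 1); split; [right|rewrite -ek].
- case: ik => -[ei ek].
    by exists (e 1); split; [right|rewrite -ek].
  by exists (h (1, 0)); split; [left|rewrite -ei].
- by move=> t; rewrite dom0 => Dt; left; exists t => //=; rewrite in_itv /= andbT.
Qed.

End peripheral_orthojectories.

(** * Essential orthojectories *)

Section essential_orthojectories.
Context {R : realType} {n : nat}.
Variables (P : polygon R n) (hP : flippered P).
Implicit Types (i j k m a b c : 'I_n) (p q x y : 'rV[R]_3) (t : R) (C K : set 'rV[R]_3).

(** A function without zeros on a connected set has constant sign there. *)
Lemma connected_sign (T : topologicalType) (f : T -> R) (C : set T) (x y : T) :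
  continuous f -> connected C -> (forall z, C z -> f z != 0) -> C x -> C y -> 0 < f x * f y.
Proof.
move=> cf cC nz Cx Cy.
have /connected_intervalP itv : connected (f @` C).
  by apply: connected_continuous_connected => //; exact: continuous_subspaceT.
have no0 : ~ (f @` C) 0 by move=> [z /nz /eqP].
have main u v : (f @` C) u -> (f @` C) v -> ~ (u <= 0 <= v).
  by move=> fu fv uv; apply: no0; exact: (itv _ _ fu fv).
have fx : (f @` C) (f x) by exists x.
have fy : (f @` C) (f y) by exists y.
case: (leP (f x) 0) => hx.
  case: (leP (f y) 0) => hy; last by case: (main _ _ fx fy); rewrite hx ltW.
  by rewrite nmulr_rgt0 lt_neqAle ?hy ?hx ?nz.
case: (leP (f y) 0) => hy; first by case: (main _ _ fy fx); rewrite hy ltW.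
exact: mulr_gt0.
Qed.

Lemma continuous_triple x y : continuous (fun p : 'rV[R]_3 => triple x y p).
Proof.
have -> : (fun p => triple x y p) = (fun p => mdot p (vec3
    (- (x 0 1 * y 0 2 - x 0 2 * y 0 1)) (- (x 0 0 * y 0 2 - x 0 2 * y 0 0))
    (x 0 0 * y 0 1 - x 0 1 * y 0 0))).
  by apply/funext => p; rewrite /triple /mdot !vec3E; ring.
exact: continuous_mdotr.
Qed.

(** For x and y on different arches this is the geodesic segment from x to y. *)
Definition cut x y : set 'rV[R]_3 := surface P `&` [set p | triple x y p = 0].

(** By triple_span a point of the cut is k *: x + l *: y; the arches of x and
    y force k and l to be nonnegative, and the equation of the hyperboloid
    bounds them. *)
Lemma compact_cut a b x y : a != b -> arch P a x -> arch P b y -> compact (cut x y).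
Proof.
move=> ab ax by_.
pose f (z : R * R) := z.1 *: x + z.2 *: y.
have cf : continuous f.
  by move=> z; apply: cvgD; apply: cvgZr_tmp; [exact: continuous_fst|exact: continuous_snd].
have yna := arch_gt0 hP by_ (_ : b != a); rewrite eq_sym in yna; have {}yna := yna ab.
have xnb := arch_gt0 hP ax ab.
have [[Hx xn] [Hy yn]] := (ax, by_).
apply: (@subclosed_compact _ _ (f @` (`[0, 1]%classic `*` `[0, 1]%classic))).
- apply: closedI; first exact: closed_surface.
  exact: (@eq_continuous _ _ (fun p => triple x y p) 0 (@continuous_triple x y)).
- apply: continuous_compact; first exact: continuous_subspaceT.
  by apply: compact_setX; exact: segment_compact.
move=> p [[[pp p0] ps] /= tp].
have [k [l e]] := triple_span Hx Hy xn (lt0r_neq0 yna) tp.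
have k0 : 0 <= k.
  have := ps b; rewrite e mdotDl !mdotZl yn mulr0 addr0 => h.
  by rewrite -(pmulr_lge0 _ xnb).
have l0 : 0 <= l.
  have := ps a; rewrite e mdotDl !mdotZl xn mulr0 add0r => h.
  by rewrite -(pmulr_lge0 _ yna).
have xy := mdot_H2 Hx Hy.
have kl : k * (l * mdot x y) <= 0 by rewrite mulr_ge0_le0 // mulr_ge0_le0 // ltW.
have sq : k ^+ 2 + l ^+ 2 <= 1.
  move: pp; rewrite e mdotDl !mdotDr !mdotZl !mdotZr (mdotC y x).
  by case: Hx => -> _; case: Hy => -> _ pp; rewrite !expr2; lra.
exists (k, l) => //; split; rewrite /= in_itv /=; nra.
Qed.

Lemma cut_side a b x y q : a != b -> arch P a x -> arch P b y -> arch P a q ->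
  triple x y q = triple q x (normal P a) * mdot y (normal P a).
Proof.
move=> ab ax by_ aq; rewrite triple_rot triple_rot.
by apply: triple_plane; [exact: mdot_normal_normal|case: aq|case: ax].
Qed.

(** On the arch a, which the two edges from x cross at the same point x, both
    linear forms are multiples of the same coordinate, with opposite signs. *)
Lemma corner a b c x y z q : a != b -> a != c -> arch P a x -> arch P b y ->
  arch P c z -> arch P a q -> triple x y q * triple z x q <= 0.
Proof.
move=> ab ac ax by_ cz aq.
have -> : triple z x q = - triple x z q by rewrite triple_swap.
rewrite (cut_side ab ax by_ aq) (cut_side ac ax cz aq).
have h1 : 0 < mdot y (normal P a) by apply: (arch_gt0 hP by_); rewrite eq_sym.
have h2 : 0 < mdot z (normal P a) by apply: (arch_gt0 hP cz); rewrite eq_sym.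
set s := triple _ _ _; set u := mdot y _ in h1 *; set v := mdot z _ in h2 *.
rewrite (_ : _ * _ = - (s ^+ 2 * (u * v))); last by ring.
by rewrite oppr_le0 mulr_ge0 ?sqr_ge0 // ltW // mulr_gt0.
Qed.

(** The compact set is the boundary of a triangle with a vertex on each arch.
    On a connected set which avoids it the three linear forms of the edges
    have constant signs, whereas by the corner inequality the product of the
    six values at the points of the three arches is not positive. *)
Lemma three_arches a b c : a != b -> b != c -> c != a ->
  exists K, [/\ compact K, K `<=` surface P & forall C, connected C ->
    C `<=` surface P `\` K -> C `&` arch P a !=set0 -> C `&` arch P b !=set0 ->
    C `&` arch P c !=set0 -> False].
Proof.
move=> ab bc ca.
have [[x ax] [y by_] [z cz]] := And3 (arch_nonempty hP a) (arch_nonempty hP b) (arch_nonempty hP c).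
exists (cut x y `|` cut y z `|` cut z x); split.
- apply: compactU; first apply: compactU.
  + exact: compact_cut ab ax by_.
  + exact: compact_cut bc by_ cz.
  + exact: compact_cut ca cz ax.
- by move=> p [[[]|[]]|[]].
move=> C cC CK [qa [Ca aqa]] [qb [Cb bqb]] [qc [Cc cqc]].
have nz1 p : C p -> triple x y p != 0.
  by move=> Cp; apply/eqP => e; case: (CK _ Cp) => sp; apply; left; left.
have nz2 p : C p -> triple y z p != 0.
  by move=> Cp; apply/eqP => e; case: (CK _ Cp) => sp; apply; left; right.
have nz3 p : C p -> triple z x p != 0.
  by move=> Cp; apply/eqP => e; case: (CK _ Cp) => sp; apply; right.
have s1 := connected_sign (@continuous_triple x y) cC nz1.
have s2 := connected_sign (@continuous_triple y z) cC nz2.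
have s3 := connected_sign (@continuous_triple z x) cC nz3.
have k1 := corner ab (_ : a != c) ax by_ cz aqa.
have k2 := corner bc (_ : b != a) by_ cz ax bqb.
have k3 := corner ca (_ : c != b) cz ax by_ cqc.
move: k1 k2 k3; rewrite [a == c]eq_sym [b == a]eq_sym [c == b]eq_sym ca ab bc.
move=> /(_ isT) k1 /(_ isT) k2 /(_ isT) k3.
have := s1 _ _ Ca Cb; have := s2 _ _ Cb Cc; have := s3 _ _ Cc Ca.
have := nz1 _ Ca; have := nz2 _ Cb; have := nz3 _ Cc.
have := nz1 _ Cb; have := nz2 _ Cc; have := nz3 _ Ca.
move: k1 k2 k3.
set A1 := triple x y qa; set B1 := triple x y qb.
set B2 := triple y z qb; set C2 := triple y z qc.
set C3 := triple z x qc; set A3 := triple z x qa.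
move=> k1 k2 k3 n1 n2 n3 n4 n5 n6 h1 h2 h3.
have e : (A1 * A3) * (B2 * B1) * (C3 * C2) = (C3 * A3) * (B2 * C2) * (A1 * B1) by ring.
have pos : 0 < (C3 * A3) * (B2 * C2) * (A1 * B1) by exact: mulr_gt0 (mulr_gt0 h1 h2) h3.
have neg : (A1 * A3) * (B2 * B1) * (C3 * C2) <= 0.
  exact: mulr_ge0_le0 (mulr_le0 k1 k2) k3.
by move: pos; rewrite -e ltNge neg.
Qed.

Lemma slice_connected (D : set R) (h : R * R -> 'rV[R]_3) t :
  {within `[0, 1]%classic `*` D, continuous h} -> D t ->
  connected [set h (s, t) | s in `[0, 1]%classic].
Proof.
move=> ch Dt.
have -> : [set h (s, t) | s in `[0, 1]%classic] = h @` [set (s, t) | s in `[0, 1]%classic].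
  by rewrite image_comp.
apply: connected_continuous_connected.
  apply: connected_continuous_connected; first exact: segment_connected.
  by apply: continuous_subspaceT; exact: continuous_pair2.
by apply: continuous_subspaceW ch => _ [s s01 <-].
Qed.

(** The track of the point is a connected subset of the boundary, of which
    each arch is open and closed. *)
Lemma stays_on_arch (D : set R) g h i t : proper_homotopy P D g h -> D t ->
  arch P i (g t) -> arch P i (h (1, t)).
Proof.
move=> [ch hS _ h0 hb] Dt gi.
pose A := [set h (s, t) | s in `[0, 1]%classic].
have cA : connected A by exact: slice_connected ch Dt.
have i0 : `[0, 1]%classic (0 : R) by rewrite /= in_itv /= lexx ler01.
have i1 : `[0, 1]%classic (1 : R) by rewrite /= in_itv /= lexx ler01.
have Ab p : A p -> boundary P p.
  by move=> [s s01 <-]; apply: hb => //; exists i.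
suff e : A `&` arch P i = A.
  have : A (h (1, t)) by exists 1.
  by rewrite -e => -[].
apply: cA.
- by exists (h (0, t)); split; [exists 0|rewrite h0].
- exists (~` (\bigcup_(k in [set k | k != i]) arch P k)).
    rewrite openC; apply: closed_bigcup; first exact: finite_finset.
    by move=> k _; exact: closed_arch.
  apply/seteqP; split => p [Ap pi_]; split => //.
    move=> [k /= ki pk]; have := arch_gt0 hP pk ki.
    by case: pi_ => _ ->; rewrite ltxx.
  have [k _ pk] := Ab _ Ap; have [<-//|ki] := eqVneq k i.
  by case: pi_; exists k.
- by exists (arch P i) => //; exact: closed_arch.
Qed.

Lemma ordS_neq i : ordS i != i.
Proof.
apply/eqP => /(congr1 val) /=; have := ltn_ord i; case: hP => n3 _ _ ilt.
have [e|ne] := eqVneq i.+1 n; first by rewrite e modnn; lia.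
by rewrite modn_small; lia.
Qed.

(** The connected set deep in the end would meet the arches i and k of the two
    end points and a third arch, one of the two that bound the end. *)
Lemma essential_segment i k p l : k != i -> k != ordS i -> i != ordS k -> 0 <= l ->
  orthojectory_dom P i p = `[0, l]%classic -> arch P i p ->
  arch P k (geodesic p (normal P i) l) -> ~ peripheral P i p.
Proof.
move=> ki kSi iSk l0 dom pi_ pk [j per].
have [m mj [mi mk]] : exists2 m, m = j \/ m = ordS j & m != i /\ m != k.
  have [eji|ji] := eqVneq j i.
    exists (ordS j); first by right.
    by rewrite eji; split; [exact: ordS_neq|rewrite eq_sym].
  have [ejk|jk] := eqVneq j k; last by exists j; [left|].
  exists (ordS j); first by right.
  by rewrite ejk; split; [rewrite eq_sym|exact: ordS_neq].
have im : i != m by rewrite eq_sym.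
have [K [cK KS noC]] := three_arches ki im mk.
have [h [C [ph [cC CK] Cj CSj hC]]] := per K cK KS.
have D0 : orthojectory_dom P i p 0 by rewrite dom /= in_itv /= lexx.
have Dl : orthojectory_dom P i p l by rewrite dom /= in_itv /= lexx l0.
apply: (noC C cC CK).
- by exists (h (1, l)); split; [exact: hC|exact: stays_on_arch ph Dl pk].
- exists (h (1, 0)); split; first exact: hC.
  by apply: (stays_on_arch ph D0); rewrite geodesic0.
- by case: mj => ->.
Qed.

Lemma triple_ideal_le0 (r s t : R) : r <= t -> t <= s -> s < r + 2 * pi ->
  triple (ideal r) (ideal s) (ideal t) <= 0 /\
  (r < t -> t < s -> triple (ideal r) (ideal s) (ideal t) < 0).
Proof.
move=> rt ts sr; rewrite triple_ideal.
have -> : (t - s) / 2 = - ((s - t) / 2) by lra.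
rewrite sinN !mulrN !mulNr; split => [|rt' ts'].
  by rewrite oppr_le0 !mulr_ge0 //; apply: chord_ge0; lra.
by rewrite oppr_lt0 !mulr_gt0 //; apply: chord_gt0; lra.
Qed.

Lemma triple_ideal_ge0 (r s t : R) : r <= s -> s <= t -> t <= r + 2 * pi ->
  0 <= triple (ideal r) (ideal s) (ideal t) /\
  (r < s -> s < t -> t < r + 2 * pi -> 0 < triple (ideal r) (ideal s) (ideal t)).
Proof.
move=> rs st tr; rewrite triple_ideal; split => [|rs' st' tr'].
  by rewrite !mulr_ge0 //; apply: chord_ge0; lra.
by rewrite !mulr_gt0 //; apply: chord_gt0; lra.
Qed.

Section gap_cut.
Variables (i : 'I_n) (j : nat) (j0 : (0 < j)%N) (jn : (j.+1 < n)%N).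
Variables (x y : 'rV[R]_3).
Hypotheses (hx : arch P (arch_idx i j) x) (hy : arch P (arch_idx i j.+1) y).

(** The cut between two consecutive arches j and j.+1, neither of them the
    base arch, isolates their gap: it separates the ideal points of the gap
    from the base arch. *)
Lemma gap_cut_decomp : exists ab cd : R * R, [/\ [/\ 0 < ab.1, 0 < ab.2, 0 < cd.1 & 0 < cd.2],
  x = ab.1 *: ideal (lo P i j) + ab.2 *: ideal (hi P i j) &
  y = cd.1 *: ideal (lo P i j.+1) + cd.2 *: ideal (hi P i j.+1)].
Proof.
have [[Hx xn] [Hy yn]] := (hx, hy); rewrite !normalE in xn yn.
have [a [b [a0 b0 ex]]] := geodesic_span (lo_lt_hi_lt hP i j) Hx xn.
have [c [d [c0 d0 ey]]] := geodesic_span (lo_lt_hi_lt hP i j.+1) Hy yn.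
by exists (a, b), (c, d).
Qed.

Lemma gap_cut_lt0 t : hi P i j <= t <= lo P i j.+1 -> triple x y (ideal t) < 0.
Proof.
move=> /andP[t1 t2].
have [[a b] [[c d] [[/= a0 b0 c0 d0] -> ->]]] := gap_cut_decomp.
have l1 := lo_lt_hi hP i j; have l2 := lo_lt_hi hP i j.+1.
have l3 : hi P i j.+1 < lo P i j + 2 * pi.
  by rewrite -loDn // (le_lt_trans (hi_le_lo hP _ _)) // lo_lt //; lia.
rewrite !tripleDl !tripleDm !tripleZl !tripleZm.
have [h1 _] : _ := @triple_ideal_le0 (lo P i j) (lo P i j.+1) t ltac:(lra) ltac:(lra) ltac:(lra).
have [_ h2] : _ := @triple_ideal_le0 (lo P i j) (hi P i j.+1) t ltac:(lra) ltac:(lra) ltac:(lra).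
have {}h2 := h2 ltac:(lra) ltac:(lra).
have [h3 _] : _ := @triple_ideal_le0 (hi P i j) (lo P i j.+1) t ltac:(lra) ltac:(lra) ltac:(lra).
have [h4 _] : _ := @triple_ideal_le0 (hi P i j) (hi P i j.+1) t ltac:(lra) ltac:(lra) ltac:(lra).
have g1 := mulr_ge0_le0 (ltW a0) (mulr_ge0_le0 (ltW c0) h1).
have g3 := mulr_ge0_le0 (ltW b0) (mulr_ge0_le0 (ltW c0) h3).
have g4 := mulr_ge0_le0 (ltW b0) (mulr_ge0_le0 (ltW d0) h4).
have g2 : a * (d * triple (ideal (lo P i j)) (ideal (hi P i j.+1)) (ideal t)) < 0.
  by rewrite pmulr_rlt0 // pmulr_rlt0.
lra.
Qed.

Lemma gap_cut_gt0 q : arch P i q -> 0 < triple x y q.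
Proof.
move=> [Hq]; rewrite -[i in normal P i]/(arch_idx i 0) -(arch_idxDn i 0) add0n normalE => qn.
have [e [f [e0 f0 ->]]] := geodesic_span (lo_lt_hi_lt hP i n) Hq qn.
have [[a b] [[c d] [[/= a0 b0 c0 d0] -> ->]]] := gap_cut_decomp.
have l1 := lo_lt_hi hP i j; have l2 := lo_lt_hi hP i j.+1; have l3 := lo_lt_hi hP i n.
have l4 : hi P i j <= lo P i j.+1 by exact: hi_le_lo.
have l5 : hi P i j.+1 <= lo P i n by exact: hi_le_lo_lt.
have l6 : hi P i n <= lo P i j + 2 * pi.
  by rewrite -(loDn hP); apply: (hi_le_lo_lt hP); lia.
rewrite !tripleDl !tripleDm !tripleDr !tripleZl !tripleZm !tripleZr.
have T r s t : r <= s -> s <= t -> t <= r + 2 * pi -> 0 <= triple (ideal r) (ideal s) (ideal t).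
  by move=> h1 h2 h3; case: (triple_ideal_ge0 h1 h2 h3).
have h1 := T (lo P i j) (lo P i j.+1) (lo P i n) ltac:(lra) ltac:(lra) ltac:(lra).
have h2 := T (lo P i j) (lo P i j.+1) (hi P i n) ltac:(lra) ltac:(lra) ltac:(lra).
have h3 := T (lo P i j) (hi P i j.+1) (lo P i n) ltac:(lra) ltac:(lra) ltac:(lra).
have h4 := T (lo P i j) (hi P i j.+1) (hi P i n) ltac:(lra) ltac:(lra) ltac:(lra).
have h5 := T (hi P i j) (lo P i j.+1) (lo P i n) ltac:(lra) ltac:(lra) ltac:(lra).
have h6 := T (hi P i j) (lo P i j.+1) (hi P i n) ltac:(lra) ltac:(lra) ltac:(lra).
have h7 := T (hi P i j) (hi P i j.+1) (lo P i n) ltac:(lra) ltac:(lra) ltac:(lra).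
have [_ h8] : _ := @triple_ideal_ge0 (hi P i j) (hi P i j.+1) (hi P i n) ltac:(lra) ltac:(lra) ltac:(lra).
have {}h8 := h8 ltac:(lra) ltac:(lra) ltac:(lra).
have m (u v w z : R) : 0 < u -> 0 < v -> 0 < w -> 0 <= z -> 0 <= u * (v * (w * z)).
  by move=> *; rewrite !mulr_ge0 // ltW.
have := m _ _ _ _ a0 c0 e0 h1; have := m _ _ _ _ a0 c0 f0 h2.
have := m _ _ _ _ a0 d0 e0 h3; have := m _ _ _ _ a0 d0 f0 h4.
have := m _ _ _ _ b0 c0 e0 h5; have := m _ _ _ _ b0 c0 f0 h6.
have := m _ _ _ _ b0 d0 e0 h7; have := mulr_gt0 b0 (mulr_gt0 d0 (mulr_gt0 f0 h8)).
lra.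
Qed.

End gap_cut.

(** The ray starts on one side of the cut around the gap where it ends, and it
    is on the other side from the parameter T0 on. By properness the track of
    the point at a larger parameter T1 never meets the cut. Joined to the
    connected set of the homotopy, which contains the deformed base point, it
    would contradict connectedness. *)
Lemma essential_ray i (j : nat) p (c : R) t : (0 < j)%N -> (j.+1 < n)%N -> arch P i p ->
  0 < c -> p + normal P i = c *: ideal t -> hi P i j <= t <= lo P i j.+1 ->
  ~ peripheral P i p.
Proof.
move=> j0 jn pi_ c0 e tj [j' per].
have dom : orthojectory_dom P i p = [set t | 0 <= t].
  case: (dom_ray hP pi_) => // m mi; rewrite e mdotZl mulr_ge0 ?(ltW c0) //.
  by apply: (gap_ge0 hP _ _ tj); lia.
have [[x hx] [y hy]] := (arch_nonempty hP (arch_idx i j), arch_nonempty hP (arch_idx i j.+1)).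
have xy : arch_idx i j != arch_idx i j.+1 by rewrite arch_idxS eq_sym ordS_neq.
pose f q := triple x y q.
have [h [C [ph [cC CK] Cj CSj hC]]] := per _ (compact_cut xy hx hy) (@subIsetl _ _ _).
have [ch hS hproper h0 hb] := ph.
have cont : continuous f by exact: continuous_triple.
have ft := gap_cut_lt0 j0 jn hx hy tj.
pose T0 := `|f (p - normal P i) / (c * f (ideal t))|.
have far s : T0 <= s -> f (geodesic p (normal P i) s) < 0.
  move=> Ts; have s0 : 0 <= s by apply: le_trans Ts; exact: normr_ge0.
  (* Far along the ray the end dominates the sign of the linear form f. *)
  have -> : geodesic p (normal P i) s =
      (expR s / 2) *: (p + normal P i) + (expR (- s) / 2) *: (p - normal P i).
    rewrite /geodesic /cosh /sinh; move: (normal P i) => v.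
    by apply: row3P; rewrite !mxE; field.
  rewrite /f e !tripleDr !tripleZr -/(f _).
  have e1 : expR (- s) <= 1 by rewrite -expR0 ler_expR; lra.
  have e2 := expR_ge1Dx s; have e3 := expR_gt0 (- s).
  have cf : 0 < - (c * f (ideal t)) by rewrite oppr_gt0 pmulr_rlt0.
  have g1 : f (p - normal P i) <= s * - (c * f (ideal t)).
    rewrite -ler_pdivrMr //; apply: le_trans Ts.
    by rewrite /T0 -[leRHS]normrN invrN mulrN ler_norm.
  have g2 : expR (- s) * f (p - normal P i) <= s * - (c * f (ideal t)).
    case: (leP 0 (f (p - normal P i))) => fs.
      by apply: le_trans g1; rewrite ler_piMl.
    apply: (@le_trans _ _ 0); first exact: mulr_ge0_le0 (ltW e3) (ltW fs).
    exact: mulr_ge0 s0 (ltW cf).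
  have g3 : (1 + s) * - (c * f (ideal t)) <= expR s * - (c * f (ideal t)).
    by rewrite ler_pM2r.
  rewrite -!/(f _); lra.
have [N N0 hN] := compact_above (@continuous_snd R R) (hproper _ (compact_cut xy hx hy) (@subIsetl _ _ _)).
(* Beyond N the homotopy avoids the cut, beyond T0 the ray is behind it. *)
pose T1 := Num.max T0 (N + 1).
have T10 : 0 <= T1 by rewrite le_max normr_ge0.
have DT : orthojectory_dom P i p T1 by rewrite dom.
have D0 : orthojectory_dom P i p 0 by rewrite dom /=.
pose A := [set h (s, T1) | s in `[0, 1]%classic].
have cA : connected A by exact: slice_connected ch DT.
have i0 : `[0, 1]%classic (0 : R) by rewrite /= in_itv /= lexx ler01.
have i1 : `[0, 1]%classic (1 : R) by rewrite /= in_itv /= lexx ler01.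
have AK : A `<=` surface P `\` cut x y.
  move=> _ [s s01 <-]; split; first by apply: hS; exists (s, T1).
  move=> cut_h; have /= := hN (s, T1) (conj (conj s01 DT) cut_h).
  have : N + 1 <= T1 by rewrite le_max lexx orbT.
  lra.
have cCA : connected (C `|` A).
  by apply: connectedU => //; exists (h (1, T1)); split; [exact: hC|exists 1].
have nz q : (C `|` A) q -> f q != 0.
  move=> CAq; apply/eqP => fq; case: CAq => [/CK|/AK] [Sq]; exact.
have := connected_sign cont cCA nz (_ : (C `|` A) (h (1, 0))) (_ : (C `|` A) (h (0, T1))).
have s1 : 0 < f (h (1, 0)).
  apply: (gap_cut_gt0 j0 jn hx hy); apply: (stays_on_arch ph D0).
  by rewrite geodesic0.
have s2 : f (h (0, T1)) < 0 by rewrite h0 // far // le_max lexx.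
have s3 : f (h (1, 0)) * f (h (0, T1)) < 0 by rewrite pmulr_rlt0.
move=> /(_ (or_introl (hC _ D0)) (or_intror _)) h'.
have : 0 < f (h (1, 0)) * f (h (0, T1)) by apply: h'; exists 0.
by rewrite ltNge ltW.
Qed.

End essential_orthojectories.

(** * Base intervals *)

Section base_interval.
Context {R : realType} {n : nat}.
Variables (P : polygon R n) (hP : flippered P) (i : 'I_n).
Implicit Types (p q x y : 'rV[R]_3) (t : R).

Local Notation lo := (lo P i).
Local Notation hi := (hi P i).
Local Notation idx := (arch_idx i).
Local Notation u := (ideal (lo 0)).
Local Notation v := (ideal (hi 0)).

Let n3 : (3 <= n)%N. Proof. by case: hP. Qed.

Lemma normal0 : normal P i = left_normal (lo 0) (hi 0).
Proof. exact: (normalE P i 0). Qed.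

Lemma idx_n : idx n = i.
Proof. exact: (arch_idxDn i 0). Qed.

Lemma lo_n : lo n = lo 0 + 2 * pi.
Proof. by rewrite -loDn // add0n. Qed.

(** The exponential of twice a signed arc length along the base arch. It takes
    the same value at the base point and at the end of an orthogonal ray, and
    thus compares base points with ideal points. *)
Definition position x := mdot x u / mdot x v.

Lemma positionZ (c : R) x : c != 0 -> position (c *: x) = position x.
Proof. by move=> c0; rewrite /position !mdotZl invfM mulrACA divff // mul1r. Qed.

Lemma position_arch p (c : R) t : arch P i p -> 0 < c -> p + normal P i = c *: ideal t ->
  position p = position (ideal t).
Proof.
move=> [_ pn] c0 e; rewrite -(positionZ (ideal t) (lt0r_neq0 c0)) -e /position !mdotDl.
by rewrite (mdotC (normal P i)) (mdotC (normal P i) v) normal0 ideal_normal_l ideal_normal_r !addr0.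
Qed.

Lemma position_ideal t : position (ideal t) =
  (sin ((t - lo 0) / 2) / sin ((t - hi 0) / 2)) ^+ 2.
Proof.
rewrite /position (mdotC _ u) (mdotC _ v) !mdot_ideal expr_div_n.
by rewrite -mulf_div divff ?mul1r //; lra.
Qed.

Lemma position_gt0 t : hi 0 < t -> t < lo n -> 0 < position (ideal t).
Proof.
move=> t1 t2; have /andP[h1 h2] := lo_lt_hi_lt hP i 0; rewrite lo_n in t2.
rewrite position_ideal exprn_gt0 // divr_gt0 //; apply: chord_gt0; apply/andP; split; lra.
Qed.

(** The identity of Ptolemy for the chords. *)
Lemma position_lt t t' : hi 0 < t -> t < t' -> t' < lo n ->
  position (ideal t') < position (ideal t).
Proof.
move=> t1 t2 t3; have /andP[h1 h2] := lo_lt_hi_lt hP i 0; rewrite lo_n in t3.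
have A : 0 < sin ((t - lo 0) / 2) by apply: chord_gt0; apply/andP; split; lra.
have A' : 0 < sin ((t' - lo 0) / 2) by apply: chord_gt0; apply/andP; split; lra.
have B : 0 < sin ((t - hi 0) / 2) by apply: chord_gt0; apply/andP; split; lra.
have B' : 0 < sin ((t' - hi 0) / 2) by apply: chord_gt0; apply/andP; split; lra.
rewrite !position_ideal ltr_pXn2r ?nnegrE ?divr_ge0 ?ltW //.
rewrite ltr_pdivrMr // mulrAC ltr_pdivlMr // -subr_gt0.
have -> : sin ((t - lo 0) / 2) * sin ((t' - hi 0) / 2) - sin ((t' - lo 0) / 2) * sin ((t - hi 0) / 2)
   = sin ((t' - t) / 2) * sin ((hi 0 - lo 0) / 2).
  by rewrite !(mulrBl 2^-1) !sinB; ring.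
by rewrite mulr_gt0 //; apply: chord_gt0; apply/andP; split; lra.
Qed.

(** A ray which ends behind the arch k meets no other arch. *)
Lemma other_ge0 (k m : nat) t : (k < n)%N -> (m < n)%N -> m != k -> lo k < t < hi k ->
  0 <= mdot (ideal t) (normal P (idx m)).
Proof.
move=> kn mn mk /andP[t1 t2]; rewrite normalE.
have /andP[h1 h2] := lo_lt_hi_lt hP i m.
have h3 : hi k <= lo n by exact: hi_le_lo_lt.
have h4 : lo 0 <= lo m by exact: lo_le.
have h5 : lo 0 <= lo k by exact: lo_le.
have h6 : hi m <= lo n by exact: hi_le_lo_lt.
rewrite lo_n in h3 h6.
case: (ltngtP m k) mk => // mk _.
  have h7 : hi m <= lo k by exact: hi_le_lo_lt.
  by apply: side_ge0 => //; lra.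
have h7 : hi k <= lo m by exact: hi_le_lo_lt.
by rewrite -idealD2pi; apply: side_ge0 => //; lra.
Qed.

Section based.
Variables (p : 'rV[R]_3) (c t : R).
Hypotheses (pi_ : arch P i p) (c0 : 0 < c) (t1 : hi 0 < t) (t2 : t < lo n)
  (e : p + normal P i = c *: ideal t).

Lemma segment_at (k : nat) : (0 < k)%N -> (k < n)%N -> lo k < t < hi k ->
  exists2 l, 0 < l &
    [/\ orthojectory_dom P i p = `[0, l]%classic,
        arch P (idx k) (geodesic p (normal P i) l) &
        forall s, 0 < s < l -> ~ boundary P (geodesic p (normal P i) s)].
Proof.
move=> k0 kn tk; have /andP[tk1 tk2] := tk; apply: dom_segment => //.
- rewrite -[X in _ != X]/(idx 0); apply/eqP => /(arch_idx_inj kn) ik.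
  by rewrite ik // in k0; lia.
- by rewrite e mdotZl pmulr_rlt0 // normalE; apply: side_lt0 => //; case/andP: (lo_lt_hi_lt hP i k).
- move=> m mi mk; have [m' m'n em] := arch_idx_surj hP i m.
  rewrite e mdotZl mulr_ge0 ?(ltW c0) // -em; apply: (other_ge0 kn m'n _ tk).
  by apply: contra_neq mk => <-.
Qed.

(** The end of the ray lies behind an arch which is not adjacent to i, or in a
    gap which is not adjacent to i. *)
Lemma essential_at : hi 1 <= t <= lo n.-1 -> ~ peripheral P i p.
Proof.
move=> /andP[h1 h2].
have lt0 : lo 0 < t by rewrite (lt_trans _ t1) // lo_lt_hi.
have [k kn [tk|tk]] := ideal_locate hP lt0 t2; last first.
  have k0 : (0 < k)%N.
    case: k {kn} tk => // /andP[_ tk].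
    by have := lo_lt_hi hP i 1; lra.
  have kn1 : (k.+1 < n)%N.
    rewrite ltnNge; apply/negP => nk; have ek : k = n.-1 by lia.
    by case/andP: tk => tk _; have := lo_lt_hi hP i k; rewrite ek in tk *; lra.
  exact: (essential_ray hP k0 kn1 pi_ c0 e tk).
have k1 : (1 < k)%N.
  case/andP: tk => tk1 tk2; rewrite ltnNge; apply/negP => k1.
  have : hi k <= hi 1 by exact: hi_le.
  lra.
have kn1 : (k.+1 < n)%N.
  case/andP: tk => tk1 tk2; rewrite ltnNge; apply/negP => nk.
  have : lo n.-1 <= lo k by apply: lo_le => //; lia.
  lra.
have [l l0 [dom kl _]] := segment_at (ltnW k1) kn tk.
apply: (essential_segment hP _ _ _ (ltW l0) dom pi_ kl).
- rewrite -[X in _ != X]/(idx 0); apply/eqP => /(arch_idx_inj kn); lia.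
- rewrite -[X in _ != X]/(idx 1); apply/eqP => /(arch_idx_inj kn); lia.
- rewrite -[X in X != _]/(idx 0) -arch_idxS; apply/eqP => /(@arch_idx_inj _ i 0 k.+1); lia.
Qed.

Lemma push_end (b th : R) : 0 <= b -> mdot (ideal th) (normal P i) = 0 ->
  exists c' t', [/\ 0 < c', hi 0 < t', t' < lo n & push p b th + normal P i = c' *: ideal t'] /\
    position (push p b th) = position (ideal t').
Proof.
move=> b0 thi; have [[pp p0] pn] := pi_.
have ai : arch P i (push p b th).
  by split; [apply: H2_push => //; rewrite pp ltrN10|apply: push_eq0].
have [Hq qn] := ai; rewrite normal0 in qn.
have [c' [t' [c'0 h1 h2 e']]] := ray_end (lo_lt_hi_lt hP i 0) Hq qn.
rewrite -normal0 in e'; exists c', t'; split; first by rewrite lo_n.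
exact: position_arch e'.
Qed.

Lemma position_push (b th : R) : 0 <= b -> position (push p b th) =
  (mdot p u + b * mdot (ideal th) u) / (mdot p v + b * mdot (ideal th) v).
Proof.
move=> b0; have [[pp p0] pn] := pi_; rewrite /push /unitize positionZ.
  by rewrite /position !mdotDl !mdotZl.
by rewrite gt_eqF // unitize_gt0 // push_timelike // pp ltrN10.
Qed.

(** The ray ends behind the next arch or in the gap before it. In the second
    case translating the base point towards the gap moves the end of the ray
    monotonically towards it, so that the translated rays stay in the surface. *)
Lemma peripheral_right : t < hi 1 -> peripheral P i p.
Proof.
move=> th1; have [Hp pn] := pi_.
have g0 : mdot (ideal (hi 0)) (normal P i) = 0 by rewrite normal0 ideal_normal_r.
have g1 : mdot (ideal (lo 1)) (normal P (ordS i)) = 0.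
  by rewrite -[ordS i]/(idx 1) normalE ideal_normal_l.
have hl := hi_le_lo hP i 0.
have gap a m : 0 <= a <= 1 -> 0 <= mdot (ideal (hi 0 + a * (lo 1 - hi 0))) (normal P m).
  move=> /andP[a0 a1]; apply: (@gap_ge0 _ _ _ hP i 0); first by lia.
  by apply/andP; split; nra.
have ij : (i = i /\ ordS i = ordS i) \/ (i = ordS i /\ ordS i = i) by left.
case: (leP t (lo 1)) => tl.
  apply: (peripheral_ray hP ij pi_ g0 g1 gap) => b m b0 mi.
  have [c' [t' [[c'0 h1 h2 e'] ep]]] := push_end b0 g0.
  rewrite e' (mdotZl c'); apply: mulr_ge0 (ltW c'0) _; apply: (@gap_ge0 _ _ _ hP i 0); first by lia.
  rewrite (ltW h1) /=; apply: le_trans tl; rewrite leNgt; apply/negP => tt'.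
  have := position_lt t1 tt' h2; rewrite -ep -(position_arch pi_ c0 e) position_push //.
  rewrite ideal_null mulr0 addr0 /position ltNge => /negP; apply.
  have vu : b * mdot v u <= 0.
    by rewrite mulr_ge0_le0 // mdot_ideal mulNr oppr_le0 mulr_ge0 // sqr_ge0.
  by rewrite ler_wnM2r ?invr_le0 ?(ltW (mdot_H2_ideal _ Hp)) //; lra.
have [l l0 [dom kl bd]] := @segment_at 1 isT ltac:(lia) ltac:(by rewrite tl th1).
exact: (peripheral_segment hP ij pi_ l0 dom kl bd g0 g1 gap).
Qed.

(** The mirror image of peripheral_right. *)
Lemma peripheral_left : lo n.-1 < t -> peripheral P i p.
Proof.
move=> tlo; have [Hp pn] := pi_.
have nn : n.-1.+1 = n by lia.
have ui : u = ideal (lo n) by rewrite lo_n idealD2pi.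
have g0 : mdot (ideal (lo n)) (normal P i) = 0 by rewrite -ui normal0 ideal_normal_l.
have g1 : mdot (ideal (hi n.-1)) (normal P (idx n.-1)) = 0 by rewrite normalE ideal_normal_r.
have hl := hi_le_lo hP i n.-1; rewrite nn in hl.
have gap a m : 0 <= a <= 1 -> 0 <= mdot (ideal (lo n + a * (hi n.-1 - lo n))) (normal P m).
  move=> /andP[a0 a1]; apply: (@gap_ge0 _ _ _ hP i n.-1); first by lia.
  by rewrite nn; apply/andP; split; nra.
have ei : ordS (idx n.-1) = i by rewrite -arch_idxS nn idx_n.
have ij : (i = idx n.-1 /\ idx n.-1 = ordS (idx n.-1)) \/ (i = ordS (idx n.-1) /\ idx n.-1 = idx n.-1).
  by right; rewrite ei.
case: (ltP t (hi n.-1)) => tl.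
  have [l l0 [dom kl bd]] := @segment_at n.-1 ltac:(lia) ltac:(lia) ltac:(by rewrite tl tlo).
  exact: (peripheral_segment hP ij pi_ l0 dom kl bd g0 g1 gap).
apply: (peripheral_ray hP ij pi_ g0 g1 gap) => b m b0 mi.
have [c' [t' [[c'0 h1 h2 e'] ep]]] := push_end b0 g0.
rewrite e' (mdotZl c'); apply: mulr_ge0 (ltW c'0) _; apply: (@gap_ge0 _ _ _ hP i n.-1); first by lia.
rewrite nn (ltW h2) andbT; apply: (le_trans tl); rewrite leNgt; apply/negP => tt'.
have := position_lt h1 tt' t2; rewrite -ep -(position_arch pi_ c0 e) position_push //.
rewrite -ui ideal_null mulr0 addr0 /position ltNge => /negP; apply.
have pv : mdot p v < 0 by exact: mdot_H2_ideal.
have uv : b * mdot u v <= 0.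
  by rewrite mulr_ge0_le0 // mdot_ideal mulNr oppr_le0 mulr_ge0 // sqr_ge0.
rewrite ler_wnM2l ?(ltW (mdot_H2_ideal _ Hp)) // lef_nV2 ?negrE //; lra.
Qed.

End based.
Let lo0_lt_hi1 : hi 0 < hi 1.
Proof. by rewrite (le_lt_trans (hi_le_lo hP i 0)) // lo_lt_hi. Qed.

Let hi1_le : hi 1 <= lo n.-1.
Proof. by apply: hi_le_lo_lt => //; lia. Qed.

Let lo_lt_n : lo n.-1 < lo n.
Proof. by apply: lo_lt => //; lia. Qed.

(** The extreme essential orthojectories are asymptotic to the far ends of the
    two adjacent arches. *)
Definition right_end := position (ideal (hi 1)).
Definition left_end := position (ideal (lo n.-1)).

Lemma position_le t t' : hi 0 < t -> t <= t' -> t' < lo n ->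
  position (ideal t') <= position (ideal t).
Proof.
move=> h1; rewrite le_eqVlt => /predU1P[->//|h2] h3.
by apply: ltW; exact: position_lt.
Qed.

Lemma left_end_gt0 : 0 < left_end.
Proof. by have [g1 g2 g3] := And3 lo0_lt_hi1 hi1_le lo_lt_n; apply: position_gt0; lra. Qed.

Lemma left_le_right : left_end <= right_end.
Proof. by have [g1 g2 g3] := And3 lo0_lt_hi1 hi1_le lo_lt_n; apply: position_le; lra. Qed.

Lemma arch_end p : arch P i p -> exists c t,
  [/\ 0 < c, hi 0 < t, t < lo n & p + normal P i = c *: ideal t].
Proof.
move=> [Hp pn]; rewrite normal0 in pn.
have [c [t [c0 t1 t2 e]]] := ray_end (lo_lt_hi_lt hP i 0) Hp pn.
by exists c, t; rewrite lo_n normal0.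
Qed.

Lemma essential_basesE : essential_bases P i =
  [set p | arch P i p /\ left_end <= position p <= right_end].
Proof.
have [g1 g2 g3] := And3 lo0_lt_hi1 hi1_le lo_lt_n.
apply/seteqP; split => p [pi_ h]; split => //.
  have [c [t [c0 t1 t2 e]]] := arch_end pi_.
  rewrite (position_arch pi_ c0 e); apply/andP; split; apply: position_le; try lra.
    by rewrite leNgt; apply/negP => ht; apply: h; exact: (peripheral_left pi_ c0 t1 t2 e).
  by rewrite leNgt; apply/negP => ht; apply: h; exact: (peripheral_right pi_ c0 t1 t2 e).
have [c [t [c0 t1 t2 e]]] := arch_end pi_.
apply: (essential_at pi_ c0 t1 t2 e).
move: h; rewrite (position_arch pi_ c0 e) => /andP[h1 h2].
apply/andP; split; rewrite leNgt; apply/negP => ht.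
  by move: h2; apply/negP; rewrite -ltNge; apply: position_lt => //; lra.
by move: h1; apply/negP; rewrite -ltNge; apply: position_lt => //; lra.
Qed.

(** The parametrization of the base arch by arc length for which position is
    expR (2 * a). *)
Definition arch_point (a : R) : 'rV[R]_3 :=
  (Num.sqrt (- 2 * mdot u v))^-1 *: (expR (- a) *: u + expR a *: v).

Let uv : mdot u v < 0.
Proof.
rewrite mdot_ideal; have := chord_gt0 (lo_lt_hi_lt hP i 0) => ch.
have : 0 < sin ((hi 0 - lo 0) / 2) ^+ 2 by rewrite exprn_gt0.
lra.
Qed.

Let scale_gt0 : 0 < (Num.sqrt (- 2 * mdot u v))^-1.
Proof. by have h := uv; rewrite invr_gt0 sqrtr_gt0; lra. Qed.

Let scale2 : (Num.sqrt (- 2 * mdot u v))^-1 ^+ 2 * mdot u v = - 2^-1.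
Proof.
have h := uv; rewrite exprVn sqr_sqrtr; last by lra.
by field; rewrite lt_eqF.
Qed.

Lemma mdot_arch_point a b : mdot (arch_point a) (arch_point b) = - cosh (a - b).
Proof.
rewrite /arch_point mdotZl mdotZr mulrA -expr2.
rewrite !mdotDl !mdotDr !mdotZl !mdotZr !ideal_null (mdotC v u).
set w := _ ^+ 2; have e := scale2; rewrite -/w in e.
rewrite /cosh opprB !expRD !expRN.
transitivity (w * mdot u v * ((expR a)^-1 * expR b + expR a * (expR b)^-1)); first by ring.
by rewrite e; field; rewrite !gt_eqF ?expR_gt0.
Qed.

Lemma arch_arch_point a : arch P i (arch_point a).
Proof.
split; [split|].
- by rewrite mdot_arch_point subrr /cosh oppr0 expR0; lra.
- by rewrite !mxE /= !mulr1 mulr_gt0 // addr_gt0 ?expR_gt0.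
- by rewrite mdotZl mdotDl !mdotZl normal0 ideal_normal_l ideal_normal_r; ring.
Qed.

Lemma position_arch_point a : position (arch_point a) = expR (2 * a).
Proof.
rewrite (positionZ _ (lt0r_neq0 scale_gt0)) /position !mdotDl !mdotZl !ideal_null (mdotC v u).
rewrite !mulr0 add0r addr0 (_ : 2 * a = a + a); last by lra.
rewrite expRD expRN; have := expR_gt0 a => e0.
by field; rewrite ?(lt_eqF uv) ?(gt_eqF e0).
Qed.

Lemma arch_pointP p : arch P i p -> p = arch_point (ln (position p) / 2).
Proof.
move=> [Hp pn]; rewrite normal0 in pn; have [pp _] := Hp.
have [x [y [x0 y0 e]]] := geodesic_span (lo_lt_hi_lt hP i 0) Hp pn.
have xy : 2 * (x * y) * mdot u v = -1.
  by rewrite -pp e mdotDl !mdotDr !mdotZl !mdotZr !ideal_null (mdotC v u); ring.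
have pos : position p = y / x.
  rewrite /position e !mdotDl !mdotZl !ideal_null (mdotC v u) !mulr0 add0r addr0.
  by field; rewrite ?(lt_eqF uv) ?(gt_eqF x0).
set s := ln (position p) / 2.
have e2 : expR s ^+ 2 = y / x.
  rewrite -expRM_natl /s (_ : _ * _ = ln (position p)); last by lra.
  by rewrite lnK // pos posrE divr_gt0.
have w2 : (Num.sqrt (- 2 * mdot u v))^-1 ^+ 2 = x * y.
  apply: (mulIf (lt0r_neq0 (_ : 0 < - mdot u v))); first by rewrite oppr_gt0.
  by rewrite !mulrN scale2; lra.
rewrite /arch_point scalerDr !scalerA e; congr (_ *: _ + _ *: _); apply/eqP.
  rewrite -(@eqrXn2 _ 2) ?mulr_ge0 ?expR_ge0 ?(ltW scale_gt0) ?(ltW x0) //.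
  rewrite exprMn w2 expRN exprVn e2; apply/eqP; field.
  by rewrite !gt_eqF.
rewrite -(@eqrXn2 _ 2) ?mulr_ge0 ?expR_ge0 ?(ltW scale_gt0) ?(ltW y0) //.
by rewrite exprMn w2 e2; apply/eqP; field; rewrite gt_eqF.
Qed.

Lemma hdist_arch_point a b : hdist (arch_point a) (arch_point b) = `|a - b|.
Proof.
rewrite /hdist mdot_arch_point opprK -[RHS]arcosh_cosh //.
by congr arcosh; case: (ger0P (a - b)) => // _; rewrite coshN.
Qed.

Lemma continuous_arch_point : continuous arch_point.
Proof.
move=> a; apply: cvgZl_tmp; apply: cvgD; apply: cvgZr_tmp.
  by apply: (@continuous_comp _ _ _ -%R expR); [exact: opp_continuous|exact: continuous_expR].
exact: continuous_expR.
Qed.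

Lemma essential_bases_segment : essential_bases P i =
  [set arch_point a | a in `[ln left_end / 2, ln right_end / 2]%classic].
Proof.
have l0 := left_end_gt0; have r0 : 0 < right_end by exact: lt_le_trans left_le_right.
rewrite essential_basesE; apply/seteqP; split => p.
  move=> [pi_ /andP[h1 h2]]; exists (ln (position p) / 2); last by rewrite -arch_pointP.
  have p0 : 0 < position p by exact: lt_le_trans h1.
  by rewrite /= in_itv /= !ler_pM2r ?invr_gt0 // !ler_ln ?posrE // h1 h2.
move=> [a /=]; rewrite in_itv /= => /andP[h1 h2] <-; split; first exact: arch_arch_point.
rewrite position_arch_point -[left_end]lnK ?posrE // -[right_end]lnK ?posrE //.
by rewrite !ler_expR; apply/andP; split; lra.
Qed.

(** The set of essential base points is itself a closed segment. *)
Lemma base_intervalE : base_interval P i =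
  [set arch_point a | a in `[ln left_end / 2, ln right_end / 2]%classic].
Proof.
rewrite -essential_bases_segment; apply/seteqP; split => [p|p h J [_ _ _]]; last exact.
apply => /=; split => //; last by move=> ? [].
- rewrite essential_bases_segment; apply: compact_closed; first exact: norm_hausdorff.
  apply: continuous_compact; last exact: segment_compact.
  by apply: continuous_subspaceT; exact: continuous_arch_point.
- rewrite essential_bases_segment; apply: connected_continuous_connected.
    exact: segment_connected.
  by apply: continuous_subspaceT; exact: continuous_arch_point.
Qed.

Lemma base_lengthE : base_length P i = ln (right_end / left_end) / 2.
Proof.
have l0 := left_end_gt0; have r0 : 0 < right_end by exact: lt_le_trans left_le_right.
rewrite ln_div ?posrE // /base_length base_intervalE.
set a := ln left_end / 2; set b := ln right_end / 2.
have ab : a <= b by rewrite ler_pM2r ?invr_gt0 // ler_ln ?posrE // left_le_right.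
have -> : (ln right_end - ln left_end) / 2 = b - a by rewrite mulrBl.
set E := [set _ | _ in _ & _ in _].
have ub : ubound E (b - a).
  move=> _ [_ [x /= + <-] [_ [y /= + <-] <-]]; rewrite !in_itv /= => xab yab.
  by rewrite hdist_arch_point ler_norml; lra.
have inE : E (b - a).
  exists (arch_point b); first by exists b => //=; rewrite in_itv /= lexx ab.
  exists (arch_point a); first by exists a => //=; rewrite in_itv /= lexx ab.
  by rewrite hdist_arch_point ger0_norm // subr_ge0.
apply/eqP; rewrite eq_le; apply/andP; split.
  by apply: ge_sup => //; exists (b - a).
by apply: ub_le_sup => //; exists (b - a).
Qed.

End base_interval.

Section base_length.
Context {R : realType} {n : nat}.

(** Twice the length of the base interval is the logarithm of the cross ratio
    of the two ends of the arch and the far ends of the two adjacent arches. *)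
Lemma base_length_cross (P : polygon R n) (i : 'I_n) : flippered P ->
  let a := ideal (tail P i) in let b := ideal (Defs.head P i) in
  let a' := ideal (tail P (ord_pred i)) in let b' := ideal (Defs.head P (ordS i)) in
  base_length P i = ln (mdot b' a * mdot a' b / (mdot b' b * mdot a' a)) / 2.
Proof.
move=> hP a b a' b'; rewrite (base_lengthE hP).
have n3 : (3 <= n)%N by case: hP.
have ei : arch_idx i n.-1 = ord_pred i.
  apply: (can_inj (@ordSK n)); rewrite ord_predK -arch_idxS.
  by rewrite prednK ?idx_n //; lia.
rewrite /right_end /left_end /position !ideal_lo !ideal_hi ei -/a -/b -/a' -/b'.
by rewrite invf_div mulf_div.
Qed.

End base_length.

(** * Isometries *)

Section determinants.
Context {R : comPzRingType}.
Implicit Type F : nat -> nat -> R.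

(** Determinants of matrices with entries indexed by natural numbers, for
    sizes which are only known after a rewriting step. *)
Lemma det_fun2 F : \det (\matrix_(i < 2, j < 2) F i j) = F 0%N 0%N * F 1%N 1%N - F 0%N 1%N * F 1%N 0%N.
Proof.
rewrite (expand_det_row _ 0) !big_ord_recl big_ord0 /cofactor !det_mx11 !mxE /=.
by rewrite /bump /=; ring.
Qed.

Lemma det_fun3 F : \det (\matrix_(i < 3, j < 3) F i j) =
  F 0%N 0%N * (F 1%N 1%N * F 2%N 2%N - F 1%N 2%N * F 2%N 1%N)
  - F 0%N 1%N * (F 1%N 0%N * F 2%N 2%N - F 1%N 2%N * F 2%N 0%N)
  + F 0%N 2%N * (F 1%N 0%N * F 2%N 1%N - F 1%N 1%N * F 2%N 0%N).
Proof.
rewrite (expand_det_row _ 0) !big_ord_recl big_ord0 /cofactor.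
have e k : row' 0 (col' k (\matrix_(i < 3, j < 3) F i j)) =
    \matrix_(i < 2, j < 2) F i.+1 (bump k j).
  by apply/matrixP => i j; rewrite !mxE.
by rewrite !e !(det_fun2 (fun i j => F i.+1 (bump _ j))) !mxE /= /bump /=; ring.
Qed.

Lemma det_fun4 F : \det (\matrix_(i < 4, j < 4) F i j) =
  \sum_(k < 4) (-1) ^+ k * F 0%N k * \det (\matrix_(i < 3, j < 3) F i.+1 (bump k j)).
Proof.
rewrite (expand_det_row _ 0); apply: eq_bigr => k _; rewrite /cofactor mxE add0n mulrCA mulrA.
by congr (_ * \det _); apply/matrixP => i j; rewrite !mxE.
Qed.

End determinants.

Section isometries.
Context {R : realType}.
Implicit Types (p q : 'rV[R]_3) (a b c d x y : R).

(** The action of the matrix of rows (a, b), (c, d) on symmetric 2 x 2 matrices,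
    which is the action on squares of spinors. *)
Definition lorentz a b c d : 'M[R]_3 := \matrix_(i < 3, j < 3)
  nth 0 (nth [::] [::
    [:: (a ^+ 2 + b ^+ 2 + c ^+ 2 + d ^+ 2) / 2; (a ^+ 2 - b ^+ 2 + c ^+ 2 - d ^+ 2) / 2; a * b + c * d];
    [:: (a ^+ 2 + b ^+ 2 - c ^+ 2 - d ^+ 2) / 2; (a ^+ 2 - b ^+ 2 - c ^+ 2 + d ^+ 2) / 2; a * b - c * d];
    [:: a * c + b * d; a * c - b * d; a * d + b * c]] i) j.

Lemma mul_lorentz p a b c d : p *m lorentz a b c d = vec3
  (p 0 0 * ((a ^+ 2 + b ^+ 2 + c ^+ 2 + d ^+ 2) / 2) + p 0 1 * ((a ^+ 2 + b ^+ 2 - c ^+ 2 - d ^+ 2) / 2)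
     + p 0 2 * (a * c + b * d))
  (p 0 0 * ((a ^+ 2 - b ^+ 2 + c ^+ 2 - d ^+ 2) / 2) + p 0 1 * ((a ^+ 2 - b ^+ 2 - c ^+ 2 + d ^+ 2) / 2)
     + p 0 2 * (a * c - b * d))
  (p 0 0 * (a * b + c * d) + p 0 1 * (a * b - c * d) + p 0 2 * (a * d + b * c)).
Proof.
have e0 : lift ord0 (ord0 : 'I_2) = 1 :> 'I_3 by apply/val_inj.
have e1 : lift ord0 (lift ord0 ord0) = 2 :> 'I_3 by apply/val_inj.
by apply: row3P; rewrite vec3E !mxE !big_ord_recl big_ord0 e0 e1 !mxE /= addr0 addrA.
Qed.

Lemma det_lorentz a b c d : a * d - b * c = 1 -> \det (lorentz a b c d) = 1.
Proof.
move=> h; rewrite /lorentz (det_fun3 (fun i j => nth 0 (nth [::] _ i) j)) /=.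
by transitivity ((a * d - b * c) ^+ 3); [field|rewrite h expr1n].
Qed.

Lemma mdot_lorentz p q a b c d : a * d - b * c = 1 ->
  mdot (p *m lorentz a b c d) (q *m lorentz a b c d) = mdot p q.
Proof.
move=> h; transitivity ((a * d - b * c) ^+ 2 * mdot p q); last by rewrite h expr1n mul1r.
by rewrite !mul_lorentz /mdot !vec3E; field.
Qed.

Lemma lorentzK p a b c d : a * d - b * c = 1 ->
  p *m lorentz a b c d *m lorentz d (- b) (- c) a = p.
Proof.
move=> h; transitivity ((a * d - b * c) ^+ 2 *: p); last by rewrite h expr1n scale1r.
rewrite !mul_lorentz !vec3E; apply: row3P; rewrite vec3E mxE; by field.
Qed.

(** The new height is half the sum of two values, one for each column, of the
    positive definite form associated with a point of the hyperboloid. *)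
Lemma H2_lorentz p a b c d : a * d - b * c = 1 -> H2 p -> H2 (p *m lorentz a b c d).
Proof.
move=> h [pp p0]; split; first by rewrite mdot_lorentz.
rewrite mul_lorentz vec3E.
have hp : p 0 0 ^+ 2 = 1 + p 0 1 ^+ 2 + p 0 2 ^+ 2 by move: pp; rewrite /mdot; lra.
have key u v : (u, v) <> (0, 0) ->
    0 < p 0 0 * (u ^+ 2 + v ^+ 2) + p 0 1 * (u ^+ 2 - v ^+ 2) + 2 * p 0 2 * (u * v).
  move=> uv.
  have s1 : 0 < p 0 0 + p 0 1.
    by rewrite ltNge; apply/negP => ?; have := sqr_ge0 (p 0 2); nra.
  rewrite -(pmulr_rgt0 _ s1).
  have -> : (p 0 0 + p 0 1) * (p 0 0 * (u ^+ 2 + v ^+ 2) + p 0 1 * (u ^+ 2 - v ^+ 2) + 2 * p 0 2 * (u * v)) =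
     ((p 0 0 + p 0 1) * u + p 0 2 * v) ^+ 2 + (p 0 0 ^+ 2 - p 0 1 ^+ 2 - p 0 2 ^+ 2) * v ^+ 2 by ring.
  rewrite hp (_ : _ - _ - _ = 1) ?mul1r; last by ring.
  have [v0|v0] := eqVneq v 0.
    rewrite v0 in uv *; rewrite mulr0 addr0 expr0n addr0 exprMn.
    apply: mulr_gt0; first exact: exprn_gt0.
    by rewrite exprn_even_gt0 //=; apply/eqP => u0; apply: uv; rewrite u0.
  by rewrite ltr_wpDl ?sqr_ge0 // exprn_even_gt0.
have k1 : (a, c) <> (0, 0) by case=> ea ec; move: h; rewrite ea ec; lra.
have k2 : (b, d) <> (0, 0) by case=> ea ec; move: h; rewrite ea ec; lra.
have := key _ _ k1; have := key _ _ k2; lra.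
Qed.

Lemma nspin_lorentz a b c d x1 x2 y1 y2 : a * d - b * c = 1 ->
  nspin x1 x2 y1 y2 *m lorentz a b c d =
  nspin (x1 * a + x2 * c) (x1 * b + x2 * d) (y1 * a + y2 * c) (y1 * b + y2 * d).
Proof.
move=> h; rewrite /nspin -scalemxAl.
have -> : (x1 * a + x2 * c) * (y1 * b + y2 * d) - (x1 * b + x2 * d) * (y1 * a + y2 * c)
   = (a * d - b * c) * (x1 * y2 - x2 * y1) by ring.
rewrite h mul1r; congr (_ *: _); rewrite mul_lorentz !vec3E; congr vec3; by field.
Qed.

End isometries.

(** The Gram determinant has the opposite sign because the form has signature
    (2, 1). *)
Lemma triple_sqr (R : realType) (u v w : 'rV[R]_3) : triple u v w ^+ 2 =
  - (mdot u u * (mdot v v * mdot w w - mdot v w * mdot w v)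
     - mdot u v * (mdot v u * mdot w w - mdot v w * mdot w u)
     + mdot u w * (mdot v u * mdot w v - mdot v v * mdot w u)).
Proof. by rewrite /triple /mdot; ring. Qed.

Section isometric.
Context {R : realType} {n : nat}.
Implicit Types (P Q : polygon R n).

Lemma isometric_lorentz P Q (a b c d : R) : a * d - b * c = 1 ->
  (forall i, normal P i *m lorentz a b c d = normal Q i) -> isometric P Q.
Proof.
move=> h hn; exists (lorentz a b c d).
have h' : d * a - - b * - c = 1 by lra.
have back (x y : 'rV[R]_3) : mdot (x *m lorentz d (- b) (- c) a) y = mdot x (y *m lorentz a b c d).
  rewrite -(mdot_lorentz (x *m _) y h).
  by have := lorentzK x h'; rewrite !opprK => ->.
have cancel (x : 'rV[R]_3) : x *m lorentz d (- b) (- c) a *m lorentz a b c d = x.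
  by have := lorentzK x h'; rewrite !opprK.
split.
- by move=> x y; exact: mdot_lorentz.
- by move=> x; exact: H2_lorentz.
- exact: det_lorentz.
- apply/seteqP; split => [_ [x [Hx xs] <-]|y [Hy ys]].
    by split; [exact: H2_lorentz|move=> i; rewrite -hn mdot_lorentz].
  exists (y *m lorentz d (- b) (- c) a) => //; split; first exact: H2_lorentz.
  by move=> i; rewrite back hn.
- move=> i; apply/seteqP; split => [_ [x [Hx xs] <-]|y [Hy ys]].
    by split; [exact: H2_lorentz|rewrite -hn mdot_lorentz].
  exists (y *m lorentz d (- b) (- c) a) => //; split; first exact: H2_lorentz.
  by rewrite back hn.
Qed.

(** An isometry maps inward normals to inward normals: the image of a normal is
    orthogonal to the image of the arch, and its sign is fixed by the position
    of another arch. Hence the Gram matrix of the normals is an invariant. *)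
Lemma isometric_gram P Q i j : flippered P -> flippered Q -> isometric P Q ->
  mdot (normal P i) (normal P j) = mdot (normal Q i) (normal Q j).
Proof.
move=> hP hQ [M [Mdot MH2 Mdet Msurf March]].
suff key k : normal P k *m M = normal Q k by rewrite -Mdot !key.
have nP := mdot_normal_normal hP k; have nQ := mdot_normal_normal hQ k.
pose x := arch_point P k 0; pose y := arch_point P k 1.
have ax : arch P k x by exact: arch_arch_point.
have ay : arch P k y by exact: arch_arch_point.
have bx : arch Q k (x *m M) by rewrite -March; exists x.
have by_ : arch Q k (y *m M) by rewrite -March; exists y.
pose m := normal P k *m M.
have mm : mdot m m = 1 by rewrite Mdot.
have xm : mdot (x *m M) m = 0 by rewrite Mdot; case: ax.
have ym : mdot (y *m M) m = 0 by rewrite Mdot; case: ay.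
have xM : mdot (x *m M) (normal Q k) = 0 by case: bx.
have yM : mdot (y *m M) (normal Q k) = 0 by case: by_.
have xy : mdot (x *m M) (y *m M) = - cosh 1.
  by rewrite Mdot mdot_arch_point // -coshN opprB subr0.
have [[xx _] _] := bx; have [[yy _] _] := by_.
have nz : triple (x *m M) (y *m M) (normal Q k) != 0.
  rewrite -sqrf_eq0 triple_sqr (mdotC (y *m M) (x *m M)) (mdotC (normal Q k) (x *m M)).
  rewrite (mdotC (normal Q k) (y *m M)) xx yy xM yM nQ xy.
  rewrite (_ : - _ = cosh 1 ^+ 2 - 1); last by ring.
  rewrite cosh2 addrC addrA addNr add0r.
  by rewrite sqrf_eq0 gt_eqF // sinh_gt0.
have em : m = mdot m (normal Q k) *: normal Q k.
  apply/eqP; rewrite -subr_eq0; apply/eqP; apply: (mdot_basis0 nz).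
  - by rewrite mdotDl mdotNl mdotZl !(mdotC _ (x *m M)) xM xm; ring.
  - by rewrite mdotDl mdotNl mdotZl !(mdotC _ (y *m M)) yM ym; ring.
  - by rewrite mdotDl mdotNl mdotZl nQ; ring.
have sq : mdot m (normal Q k) ^+ 2 = 1.
  rewrite -mm {2 3}em.
  by rewrite mdotZl mdotZr nQ; ring.
have [z az] := arch_nonempty hP (ordS k).
have pos : 0 < mdot (z *m M) m.
  by rewrite Mdot; apply: (arch_gt0 hP az); exact: (ordS_neq hP).
have zQ : 0 <= mdot (z *m M) (normal Q k).
  have : surface Q (z *m M) by rewrite -Msurf; exists z => //; exact: (arch_surface hP az).
  by move=> [_]; exact.
have h : 0 < mdot m (normal Q k).
  rewrite ltNge; apply/negP => h; have := mulr_le0_ge0 h zQ; rewrite -mdotZr -em.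
  by rewrite leNgt pos.
have e1 : mdot m (normal Q k) = 1.
  by apply/eqP; rewrite -(@eqrXn2 _ 2) ?expr1n ?(ltW h) //; apply/eqP.
by rewrite -/m em e1 scale1r.
Qed.

End isometric.

(** * Strap lengths *)

Section straps.
Context {R : realType} {n : nat}.
Variables (P : polygon R n) (hP : flippered P) (j : 'I_n).

Lemma arcosh_ge0 (y : R) : 1 <= y -> 0 <= arcosh y.
Proof. by move=> y1; rewrite ln_ge0 // (le_trans y1) // lerDl sqrtr_ge0. Qed.

Lemma cosh_arcosh (y : R) : 1 <= y -> cosh (arcosh y) = y.
Proof.
move=> y1; have y2 : 0 <= y ^+ 2 - 1 by rewrite subr_ge0 expr_ge1 //; lra.
set s := Num.sqrt (y ^+ 2 - 1).
have s2 : s ^+ 2 = y ^+ 2 - 1 by rewrite sqr_sqrtr.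
have s0 : 0 <= s by exact: sqrtr_ge0.
have ys : 0 < y + s by lra.
rewrite /cosh expRN /arcosh -/s lnK //.
have -> : (y + s)^-1 = y - s.
  by apply: (mulfI (lt0r_neq0 ys)); rewrite divff ?gt_eqF // mulrC -subr_sqr s2; ring.
by lra.
Qed.

Local Notation a := (lo P j 0).
Local Notation b := (hi P j 0).
Local Notation a' := (lo P j 1).
Local Notation b' := (hi P j 1).

Lemma tineP : tine P j <-> b = a'.
Proof.
rewrite /tine -[j in Defs.head P j]/(arch_idx j 0) -ideal_hi.
rewrite -[ordS j]/(arch_idx j 1) -ideal_lo; split => [e|->//].
have h1 := hi_le_lo hP j 0; have h2 := lo_lt_hi hP j 0.
have h3 : a' < a + 2 * pi by rewrite -loDn // lo_lt //; case: hP => n3 _ _; lia.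
move: h1; rewrite le_eqVlt => /predU1P[//|h1].
have := mdot_ideal b a'; rewrite -e ideal_null => /eqP.
have : 0 < sin ((a' - b) / 2) by apply: chord_gt0; apply/andP; split; lra.
by rewrite eq_sym mulf_eq0 oppr_eq0 sqrf_eq0 => /gt_eqF ->; rewrite orbF pnatr_eq0.
Qed.

(** The identity of Ptolemy for the four ends of the two arches. *)
Lemma gap_gram : - mdot (normal P j) (normal P (ordS j)) = 1 +
  2 * (sin ((b' - a) / 2) * sin ((a' - b) / 2)) / (sin ((b - a) / 2) * sin ((b' - a') / 2)).
Proof.
have n1 := chord_gt0 (lo_lt_hi_lt hP j 0); have n2 := chord_gt0 (lo_lt_hi_lt hP j 1).
rewrite -[j in normal P j]/(arch_idx j 0) -[ordS j]/(arch_idx j 1) !normalE mdot_normal.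
rewrite mulNr opprK.
have -> : sin ((a' - a) / 2) * sin ((b' - b) / 2) =
    sin ((b - a) / 2) * sin ((b' - a') / 2) + sin ((b' - a) / 2) * sin ((a' - b) / 2).
  by rewrite !(mulrBl 2^-1) !sinB; ring.
by field; rewrite !gt_eqF.
Qed.

Lemma gap_gram_ge1 : 1 <= - mdot (normal P j) (normal P (ordS j)) /\
  (~ tine P j -> 1 < - mdot (normal P j) (normal P (ordS j))).
Proof.
have n1 := chord_gt0 (lo_lt_hi_lt hP j 0); have n2 := chord_gt0 (lo_lt_hi_lt hP j 1).
have l1 := lo_lt_hi hP j 0; have l2 := lo_lt_hi hP j 1; have l3 := hi_le_lo hP j 0.
have l4 : b' < a + 2 * pi.
  by rewrite -loDn // (le_lt_trans (hi_le_lo hP _ _)) // lo_lt //; case: hP => n3 _ _; lia.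
have s1 : 0 < sin ((b' - a) / 2) by apply: chord_gt0; apply/andP; split; lra.
have s2 : 0 <= sin ((a' - b) / 2) by apply: chord_ge0; apply/andP; split; lra.
rewrite gap_gram; split => [|nt].
  by rewrite lerDl divr_ge0 ?mulr_ge0 // ltW.
have s3 : 0 < sin ((a' - b) / 2).
  apply: chord_gt0; apply/andP; split; last by lra.
  by rewrite lt_neqAle l3 andbT; apply/eqP => /tineP.
by rewrite ltrDl divr_gt0 ?mulr_gt0.
Qed.

(** The strap is the common perpendicular of the two arches, and its length is
    read off the product of their normals. Conversely its foot is the point of
    the arch in the plane of the two normals. *)
Lemma is_strap_lengthE c : ~ tine P j ->
  is_strap_length P j c <-> c = arcosh (- mdot (normal P j) (normal P (ordS j))).
Proof.
move=> nt; have [g1 /(_ nt) g2] := gap_gram_ge1.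
have nn := mdot_normal_normal hP j; have nn' := mdot_normal_normal hP (ordS j).
split.
  move=> [c0 [p [pj pk vel]]].
  have e : mdot (normal P j) (normal P (ordS j)) = - cosh c.
    have : mdot (velocity p (normal P j) c) (normal P j) = cosh c.
      by rewrite /velocity mdotDl (mdotZl (sinh c)) (mdotZl (cosh c)) nn; case: pj => _ ->; ring.
    by rewrite vel mdotNl mdotC => <-; rewrite opprK.
  by rewrite e opprK arcosh_cosh // ltW.
set y := - mdot _ _ in g1 g2 *; move=> ce.
have cy : cosh c = y by rewrite ce cosh_arcosh.
have c0 : 0 < c.
  rewrite lt_neqAle ce arcosh_ge0 // andbT -ce; apply/eqP => c0.
  by move: g2; rewrite -cy -c0 /cosh oppr0 expR0; lra.
have s0 := sinh_gt0 c0; have cs := cosh2 c.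
split => //.
set m := normal P j in nn y g1 g2 cy ce *; set m' := normal P (ordS j) in nn' y g1 g2 cy ce *.
have mm' : mdot m m' = - cosh c by rewrite cy opprK.
pose p := - (sinh c)^-1 *: (m' + cosh c *: m).
have pm : mdot p m = 0 by rewrite /p mdotZl mdotDl mdotZl (mdotC m') mm' nn; ring.
have pm' : mdot p m' = sinh c.
  rewrite /p mdotZl mdotDl mdotZl mm' nn'.
  by transitivity ((cosh c ^+ 2 - 1) / sinh c); [field|rewrite cs; field]; rewrite gt_eqF.
have pp : mdot p p = -1.
  rewrite {2}/p mdotZr mdotDr mdotZr pm pm'; field; by rewrite gt_eqF.
have ub : mdot m (ideal b) = 0.
  by rewrite mdotC /m -[j in normal P j]/(arch_idx j 0) normalE ideal_normal_r.
have l1 := lo_lt_hi hP j 0; have l2 := lo_lt_hi hP j 1; have l3 := hi_le_lo hP j 0.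
have l4 : b' < a + 2 * pi.
  by rewrite -loDn // (le_lt_trans (hi_le_lo hP _ _)) // lo_lt //; case: hP => n3 _ _; lia.
have l5 : b < a' by rewrite lt_neqAle l3 andbT; apply/eqP => /tineP.
have um' : 0 < mdot (ideal b) m'.
  rewrite /m' -[ordS j]/(arch_idx j 1) normalE -idealD2pi.
  by apply: side_gt0 => //; lra.
have pu : mdot p (ideal b) < 0.
  rewrite /p mdotZl mdotDl mdotZl ub mulr0 addr0 mulNr oppr_lt0.
  by rewrite mulr_gt0 ?invr_gt0 // mdotC.
have future q : mdot q q = -1 -> mdot q (ideal b) < 0 -> H2 q.
  move=> qq qu; split => //; rewrite ltNge; apply/negP => q0.
  have [q00|q00] := eqVneq (q 0 0) 0.
    by move: qq; rewrite /mdot q00; have := sqr_ge0 (q 0 1); have := sqr_ge0 (q 0 2); rewrite !expr2; lra.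
  have : mdot (- q) (ideal b) < 0.
    apply: mdot_future_ideal; first by rewrite mdotNl mdotNr opprK qq ltrN10.
    by rewrite mxE oppr_gt0 lt_neqAle q00.
  by rewrite mdotNl; lra.
exists p; split.
- by split => //; exact: future.
- split; last by rewrite mdot_geodesic pm' mm'; ring.
  apply: future.
    rewrite mdot_geodesic (mdotC p) (mdotC m) !mdot_geodesic pp (mdotC m p) pm nn.
    by rewrite -[RHS]opprK -[in RHS](addrK (sinh c ^+ 2) 1) -cs; ring.
  by rewrite mdot_geodesic ub mulr0 addr0 pmulr_rlt0 // cosh_gt0.
- rewrite /velocity -/m /p scalerA.
  have -> : sinh c * - (sinh c)^-1 = -1 by rewrite mulrN divff // gt_eqF.
  by rewrite scaleN1r opprD subrK.
Qed.

(** At a tine the product of the normals is - 1 and arcosh 1 = 0, in agreement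
    with the convention for tines. *)
Lemma strapE : strap P j = arcosh (- mdot (normal P j) (normal P (ordS j))).
Proof.
rewrite /strap; case: asboolP => [t|nt].
  rewrite gap_gram (_ : a' - b = 0) ?mul0r ?sin0 ?mulr0 ?mul0r; last by move/tineP: t => ->; rewrite subrr.
  by rewrite addr0 /arcosh expr1n subrr sqrtr0 addr0 ln1.
by apply: xget_unique => [|y]; rewrite /= is_strap_lengthE.
Qed.

Lemma strap_ge0 : 0 <= strap P j.
Proof. by rewrite strapE arcosh_ge0 //; case: gap_gram_ge1. Qed.

Lemma cosh_strap : cosh (strap P j) = - mdot (normal P j) (normal P (ordS j)).
Proof. by rewrite strapE cosh_arcosh //; case: gap_gram_ge1. Qed.

Lemma strap_gt0 : 0 < strap P j <-> ~ tine P j.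
Proof.
split => [s0 t|nt]; first by move: s0; rewrite /strap; case: asboolP; rewrite ?ltxx.
rewrite lt_neqAle strap_ge0 andbT; apply/eqP => s0.
have [_ /(_ nt)] := gap_gram_ge1.
by rewrite -cosh_strap -s0 /cosh oppr0 expR0; lra.
Qed.

End straps.

(** * Pentagons in the upper half-plane *)

Section upper_half_plane.
Context {R : realType}.
Implicit Types (x y : R).

(** The angle of the point x of the real line; the point at infinity of the upper
    half-plane has angle 0. *)
Definition ang x : R := pi + 2 * atan x.

Lemma ang_gt0 x : 0 < ang x.
Proof. by rewrite /ang; have := atan_gtNpi2 x; lra. Qed.
Lemma ang_lt2pi x : ang x < 2 * pi.
Proof. by rewrite /ang; have := atan_ltpi2 x; lra. Qed.
Lemma ang_le x y : x <= y -> ang x <= ang y.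
Proof. by move=> /le_atan h; rewrite /ang; lra. Qed.
Lemma ang_lt x y : x < y -> ang x < ang y.
Proof. by move=> /lt_atan h; rewrite /ang; lra. Qed.

Lemma cos_atan_gt0 x : 0 < cos (atan x).
Proof. by rewrite cos_atan invr_gt0 sqrtr_gt0 ltr_pwDl // sqr_ge0. Qed.

Lemma sin_atanE x : sin (atan x) = cos (atan x) * x.
Proof. by have := atanK x; rewrite /tan => {3}<-; rewrite mulrC divfK // gt_eqF // cos_atan_gt0. Qed.

Lemma spin_ang x : cos (ang x / 2) = cos (atan x) * - x /\ sin (ang x / 2) = cos (atan x) * 1.
Proof.
have -> : ang x / 2 = atan x + pi / 2 by rewrite /ang; lra.
by rewrite cosDpihalf sinDpihalf sin_atanE mulr1 mulrN.
Qed.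

Lemma spin_2pi : cos ((2 * pi) / 2) = -1 * 1 :> R /\ sin ((2 * pi) / 2) = -1 * 0 :> R.
Proof. by rewrite mulrAC divff // mul1r cospi sinpi mulr1 mulr0. Qed.

Lemma spin_0 : cos (0 / 2) = 1 :> R /\ sin (0 / 2) = 0 :> R.
Proof. by rewrite mul0r cos0 sin0. Qed.

Lemma cos_atan2 x : cos (atan x) ^+ 2 = (1 + x ^+ 2)^-1.
Proof. by rewrite cos_atan exprVn sqr_sqrtr // addr_ge0 // sqr_ge0. Qed.

Lemma ideal_ang x : ideal (ang x) = (1 + x ^+ 2)^-1 *: null (- x) 1.
Proof.
rewrite idealE; case: (spin_ang x) => -> ->; rewrite -cos_atan2 /null scale_vec3.
by congr vec3; ring.
Qed.

Lemma ideal_0 : ideal 0 = null 1 0 :> 'rV[R]_3.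
Proof. by rewrite idealE; case: spin_0 => -> ->. Qed.

Lemma ideal_2pi : ideal (2 * pi) = null 1 0 :> 'rV[R]_3.
Proof. by rewrite -ideal_0 -[in RHS]idealD2pi add0r. Qed.

Lemma left_normal_ang x y : left_normal (ang x) (ang y) = nspin (- x) 1 (- y) 1.
Proof.
rewrite left_normalE; case: (spin_ang x) => -> ->; case: (spin_ang y) => -> ->.
by apply: nspinZ; rewrite gt_eqF // cos_atan_gt0.
Qed.

Lemma left_normal_0ang y : left_normal 0 (ang y) = nspin 1 0 (- y) 1.
Proof.
rewrite left_normalE; case: (spin_ang y) => -> ->; case: spin_0 => -> ->.
have c0 : cos (atan y) != 0 by rewrite gt_eqF // cos_atan_gt0.
by rewrite -(nspinZ 1 0 (- y) 1 (oner_neq0 _) c0) !mul1r.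
Qed.

Lemma left_normal_ang2pi x : left_normal (ang x) (2 * pi) = nspin (- x) 1 1 0.
Proof.
rewrite left_normalE; case: (spin_ang x) => -> ->; case: spin_2pi => -> ->.
by apply: nspinZ; rewrite ?oppr_eq0 ?oner_neq0 // gt_eqF // cos_atan_gt0.
Qed.

Lemma mdot_ang x y : mdot (ideal (ang x)) (ideal (ang y)) =
  - 2 * (x - y) ^+ 2 / ((1 + x ^+ 2) * (1 + y ^+ 2)).
Proof.
rewrite !ideal_ang mdotZl mdotZr mdot_null; field.
by rewrite !gt_eqF // ltr_pwDl // sqr_ge0.
Qed.

Lemma mdot_infty_ang x : mdot (null 1 0) (ideal (ang x)) = - 2 / (1 + x ^+ 2).
Proof. by rewrite ideal_ang mdotZr mdot_null; field; rewrite gt_eqF // ltr_pwDl // sqr_ge0. Qed.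

End upper_half_plane.

Notation ord5 k := (@Ordinal 5 k isT).

Lemma ord5_ind (Q : 'I_5 -> Prop) : Q (ord5 0) -> Q (ord5 1) -> Q (ord5 2) -> Q (ord5 3) -> Q (ord5 4) -> forall i, Q i.
Proof.
move=> h0 h1 h2 h3 h4 [[|[|[|[|[|//]]]]] hi].
- by rewrite (_ : Ordinal hi = (ord5 0)) //; apply/val_inj.
- by rewrite (_ : Ordinal hi = (ord5 1)) //; apply/val_inj.
- by rewrite (_ : Ordinal hi = (ord5 2)) //; apply/val_inj.
- by rewrite (_ : Ordinal hi = (ord5 3)) //; apply/val_inj.
- by rewrite (_ : Ordinal hi = (ord5 4)) //; apply/val_inj.
Qed.

Lemma ordS5 : (ordS (ord5 0) = (ord5 1)) * (ordS (ord5 1) = (ord5 2)) * (ordS (ord5 2) = (ord5 3)) *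
  (ordS (ord5 3) = (ord5 4)) * (ordS (ord5 4) = (ord5 0)).
Proof. by do !split; apply/val_inj. Qed.

Lemma ord_pred5 : (ord_pred (ord5 0) = (ord5 4)) * (ord_pred (ord5 1) = (ord5 0)) * (ord_pred (ord5 2) = (ord5 1)) *
  (ord_pred (ord5 3) = (ord5 2)) * (ord_pred (ord5 4) = (ord5 3)).
Proof. by do !split; apply/val_inj. Qed.

Lemma sum5 (V : nmodType) (f : 'I_5 -> V) :
  \sum_i f i = f (ord5 0) + f (ord5 1) + f (ord5 2) + f (ord5 3) + f (ord5 4).
Proof.
by rewrite !big_ord_recl big_ord0 addr0 !addrA; do !congr (_ + _); congr f; apply/val_inj.
Qed.

Section pentagons.
Context {R : realType}.

(** In the upper half-plane, the pentagon with ends at infinity and at six points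
    of the real line with successive gaps g1, 1, g3, g4, g5: its arches join
    infinity to - g1, 0 to 1, x4 to x5, x5 to x6 and x6 to infinity. The gaps g1
    and g3 separate consecutive arches, and they vanish at tines. *)
Definition pentagon (g1 g3 g4 g5 : R) : polygon R 5 :=
  let x4 := 1 + g3 in let x5 := x4 + g4 in let x6 := x5 + g5 in
  Polygon (fun i : 'I_5 => [:: 0; ang 0; ang x4; ang x5; ang x6]`_i)
          (fun i : 'I_5 => [:: ang (- g1); ang 1; ang x5; ang x6; 2 * pi]`_i).

Section fixed.
Variables (g1 g3 g4 g5 : R).
Hypotheses (h1 : 0 <= g1) (h3 : 0 <= g3) (h4 : 0 < g4) (h5 : 0 < g5).
Local Notation P := (pentagon g1 g3 g4 g5).

Lemma flippered_pentagon : flippered P.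
Proof.
split => //; apply: ord5_ind; rewrite ?ordS5 /=.
- exact: ang_gt0.
- by apply: ang_lt; exact: ltr01.
- by apply: ang_lt; rewrite ltrDl.
- by apply: ang_lt; rewrite ltrDl.
- exact: ang_lt2pi.
- by rewrite addr0; apply: ang_le; rewrite oppr_le0.
- by rewrite addr0; apply: ang_le; rewrite lerDl.
- by rewrite addr0.
- by rewrite addr0.
- by rewrite add0r.
Qed.

Lemma normal_pentagon :
  (normal P (ord5 0) = nspin 1 0 g1 1) * (normal P (ord5 1) = nspin 0 1 (- 1) 1) *
  (normal P (ord5 2) = nspin (- (1 + g3)) 1 (- (1 + g3 + g4)) 1) *
  (normal P (ord5 3) = nspin (- (1 + g3 + g4)) 1 (- (1 + g3 + g4 + g5)) 1) *
  (normal P (ord5 4) = nspin (- (1 + g3 + g4 + g5)) 1 1 0).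
Proof.
by do !split; rewrite /normal /= ?left_normal_0ang ?left_normal_ang2pi ?left_normal_ang ?opprK ?oppr0.
Qed.

Lemma cosh_strap0 : cosh (strap P (ord5 0)) = 1 + 2 * g1.
Proof.
rewrite (cosh_strap flippered_pentagon) ordS5 !normal_pentagon mdot_nspin.
by field; rewrite ?oner_neq0.
Qed.

Lemma cosh_strap1 : cosh (strap P (ord5 1)) = 1 + 2 * (g3 * (1 + g3 + g4) / g4).
Proof.
rewrite (cosh_strap flippered_pentagon) ordS5 !normal_pentagon mdot_nspin.
by field; rewrite !gt_eqF //; lra.
Qed.

Lemma strap_pentagon_tines : (strap P (ord5 2) = 0) * (strap P (ord5 3) = 0) * (strap P (ord5 4) = 0).
Proof.
have t (j : 'I_5) : tine P j -> strap P j = 0 by rewrite /strap; case: asboolP.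
by do !split; apply: t; rewrite /tine ordS5 /= ?ideal_2pi ?ideal_0.
Qed.

(** The products gram02 and gram14 of normals of arches which are not adjacent
    are the two further invariants needed to recover the gaps from the
    isometry class. *)
Lemma gram02 : - mdot (normal P (ord5 0)) (normal P (ord5 2)) = 1 + 2 * (g1 + 1 + g3) / g4.
Proof.
by rewrite !normal_pentagon mdot_nspin; field; rewrite !gt_eqF //; lra.
Qed.

Lemma gram14 : - mdot (normal P (ord5 1)) (normal P (ord5 4)) = 1 + 2 * (g3 + g4 + g5).
Proof.
by rewrite !normal_pentagon mdot_nspin; field; rewrite ?oner_neq0.
Qed.

Lemma ln_sqr_half (x : R) : 0 < x -> ln (x ^+ 2) / 2 = ln x.
Proof. by move=> x0; rewrite lnXn // mulr2n; lra. Qed.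

Lemma ln_cosh_half (x : R) : ln (cosh (x / 2)) = ln ((cosh x + 1) / 2) / 2.
Proof.
rewrite -ln_sqr_half ?cosh_gt0 //; congr (ln _ / 2).
by rewrite (cosh_half x) cosh2; field.
Qed.

Lemma base_length_pentagon :
  (base_length P (ord5 0) = ln ((1 + g3 + g4 + g5 + g1) / (1 + g1))) *
  (base_length P (ord5 1) = ln ((1 + g3 + g4) / (g3 + g4))) *
  (base_length P (ord5 2) = ln ((g4 + g5) * (1 + g3 + g4) / (g5 * (1 + g3)))) *
  (base_length P (ord5 3) = ln ((g4 + g5) / g4)) *
  (base_length P (ord5 4) = ln ((1 + g3 + g4 + g5 + g1) / g5)).
Proof.
have fl := flippered_pentagon.
have nz (x : R) : 1 + x ^+ 2 != 0 by rewrite gt_eqF // ltr_pwDl // sqr_ge0.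
have := h1; have := h3; have := h4; have := h5 => k5 k4 k3 k1.
have p1 : 0 < 1 + g1 by lra.
have p2 : 0 < 1 + g3 by lra.
have p3 : 0 < g3 + g4 by lra.
have p4 : 0 < g4 + g5 by lra.
have p5 : 0 < 1 + g3 + g4 by lra.
have p6 : 0 < 1 + g3 + g4 + g5 + g1 by lra.
have len i (x : R) : 0 < x ->
    mdot (ideal (Defs.head P (ordS i))) (ideal (tail P i)) *
    mdot (ideal (tail P (ord_pred i))) (ideal (Defs.head P i)) /
    (mdot (ideal (Defs.head P (ordS i))) (ideal (Defs.head P i)) *
      mdot (ideal (tail P (ord_pred i))) (ideal (tail P i))) = x ^+ 2 ->
    base_length P i = ln x.
  by move=> x0 e; rewrite base_length_cross // e ln_sqr_half.
do !split; apply: len; rewrite ?ordS5 ?ord_pred5 /= ?ideal_2pi ?ideal_0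
  ?(mdotC _ (null 1 0)) ?mdot_infty_ang ?mdot_ang.
all: try by rewrite ?(divr_gt0, mulr_gt0).
all: field; repeat (apply/andP; split); try exact: nz; try by apply/eqP => e; lra.
Qed.

Lemma action_pentagon : expR (- action P) =
  g5 * g4 / ((1 + g3 + g4 + g5 + g1) * (1 + g3 + g4) * (g4 + g5)).
Proof.
have := h1; have := h3; have := h4; have := h5 => k5 k4 k3 k1.
have p1 : 0 < 1 + g1 by lra.
have p2 : 0 < 1 + g3 by lra.
have p3 : 0 < g3 + g4 by lra.
have p4 : 0 < g4 + g5 by lra.
have p5 : 0 < 1 + g3 + g4 by lra.
have p6 : 0 < 1 + g3 + g4 + g5 + g1 by lra.
rewrite -[RHS]lnK ?posrE ?(divr_gt0, mulr_gt0) //; congr expR.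
have [[[[b0 b1] b2] b3] b4] := base_length_pentagon.
have [[s2 s3] s4] := strap_pentagon_tines.
have s0 := cosh_strap0; have s1 := cosh_strap1.
rewrite /action !sum5.
move: (base_length P) (strap P) b0 b1 b2 b3 b4 s0 s1 s2 s3 s4 => f g b0 b1 b2 b3 b4 s0 s1 s2 s3 s4.
rewrite b0 b1 b2 b3 b4 s2 s3 s4 !ln_cosh_half s0 s1.
have -> : cosh 0 = 1 :> R by rewrite /cosh oppr0 expR0; lra.
have -> : (1 + 2 * g1 + 1) / 2 = 1 + g1 by lra.
have -> : (1 + 2 * (g3 * (1 + g3 + g4) / g4) + 1) / 2 = (1 + g3) * (g3 + g4) / g4.
  by field; rewrite gt_eqF.
have -> : (1 + 1) / 2 = 1 :> R by lra.
rewrite ln1 !(ln_div, lnM) ?posrE ?mulr_gt0 //; lra.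
Qed.

End fixed.
End pentagons.

(** * Normal form of a pentagon with three tines *)

Section normal_form.
Context {R : realType}.

Lemma ideal_inj (s t : R) : s <= t -> t < s + 2 * pi -> ideal s = ideal t -> s = t.
Proof.
rewrite le_eqVlt => /predU1P[//|st] ts e.
have := mdot_ideal s t; rewrite -e ideal_null => /eqP.
have : 0 < sin ((t - s) / 2) by apply: chord_gt0; apply/andP; split; lra.
by rewrite eq_sym mulf_eq0 oppr_eq0 sqrf_eq0 => /gt_eqF ->; rewrite orbF pnatr_eq0.
Qed.

Lemma nspinZr (k x1 x2 y1 y2 : R) : k != 0 -> nspin x1 x2 (k * y1) (k * y2) = nspin x1 x2 y1 y2.
Proof. by move=> k0; rewrite -(nspinZ x1 x2 y1 y2 (oner_neq0 _) k0) !mul1r. Qed.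

Lemma nspinZl (k x1 x2 y1 y2 : R) : k != 0 -> nspin (k * x1) (k * x2) y1 y2 = nspin x1 x2 y1 y2.
Proof. by move=> k0; rewrite -(nspinZ x1 x2 y1 y2 k0 (oner_neq0 _)) !mul1r. Qed.

Section real_line.
Variable A : R.

(** The real coordinate of the point of angle t when A is sent to infinity. *)
Definition coord (t : R) := - (cos ((t - A) / 2) / sin ((t - A) / 2)).

Lemma coordB t t' : A < t < A + 2 * pi -> A < t' < A + 2 * pi ->
  coord t' - coord t = sin ((t' - t) / 2) / (sin ((t - A) / 2) * sin ((t' - A) / 2)).
Proof.
move=> /chord_gt0 h /chord_gt0 h'; rewrite /coord.
have -> : (t' - t) / 2 = (t' - A) / 2 - (t - A) / 2 by lra.
by rewrite sinB; field; rewrite !gt_eqF.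
Qed.

Lemma coord_le t t' : A < t < A + 2 * pi -> A < t' < A + 2 * pi -> t <= t' ->
  0 <= coord t' - coord t.
Proof.
move=> h h' tt; have p := chord_gt0 h; have p' := chord_gt0 h'.
rewrite coordB // divr_ge0 ?mulr_ge0 ?(ltW p) ?(ltW p') //.
by apply: chord_ge0; lra.
Qed.

Lemma coord_lt t t' : A < t < A + 2 * pi -> A < t' < A + 2 * pi -> t < t' ->
  0 < coord t' - coord t.
Proof.
move=> h h' tt; have p := chord_gt0 h; have p' := chord_gt0 h'.
by rewrite coordB // divr_gt0 ?mulr_gt0 //; apply: chord_gt0; lra.
Qed.

Variables (x2 s : R) (s0 : 0 < s).
(** The affine change of coordinate which sends x2 to 0 and x2 + s ^+ 2 to 1;
    ga, gb, gc, gd are the entries of the matrix which undoes it together with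
    the rotation by A. *)
Definition ncoord t := (coord t - x2) / s ^+ 2.
Definition ga := s * cos (A / 2).
Definition gb := s * sin (A / 2).
Definition gc := (- sin (A / 2) - x2 * cos (A / 2)) / s.
Definition gd := (cos (A / 2) - x2 * sin (A / 2)) / s.

Lemma g_unimodular : ga * gd - gb * gc = 1.
Proof.
rewrite -[RHS](cos2Dsin2 (A / 2)) /ga /gb /gc /gd; field.
by rewrite gt_eqF.
Qed.

Lemma spin_ncoord t : A < t < A + 2 * pi ->
  cos (t / 2) = s * sin ((t - A) / 2) * (- ncoord t * ga + 1 * gc) /\
  sin (t / 2) = s * sin ((t - A) / 2) * (- ncoord t * gb + 1 * gd).
Proof.
move=> /chord_gt0 h.
have -> : t / 2 = (t - A) / 2 + A / 2 by lra.
rewrite cosD sinD /ncoord /ga /gb /gc /gd /coord.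
by split; field; rewrite !gt_eqF.
Qed.

Lemma left_normal_ncoord t t' : A < t < A + 2 * pi -> A < t' < A + 2 * pi ->
  nspin (- ncoord t) 1 (- ncoord t') 1 *m lorentz ga gb gc gd = left_normal t t'.
Proof.
move=> h h'; rewrite (nspin_lorentz _ _ _ _ g_unimodular) left_normalE.
case: (spin_ncoord h) => -> ->; case: (spin_ncoord h') => -> ->.
by rewrite nspinZ // mulf_neq0 ?gt_eqF // chord_gt0.
Qed.

Lemma left_normal_ncoord_l t' : A < t' < A + 2 * pi ->
  nspin 1 0 (- ncoord t') 1 *m lorentz ga gb gc gd = left_normal A t'.
Proof.
move=> h'; rewrite (nspin_lorentz _ _ _ _ g_unimodular) left_normalE.
case: (spin_ncoord h') => -> ->.
rewrite nspinZr ?mulf_neq0 ?gt_eqF ?chord_gt0 //.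
by rewrite !mul1r !mul0r !addr0 {1}/ga {1}/gb nspinZl // gt_eqF.
Qed.

Lemma left_normal_ncoord_r t : A < t < A + 2 * pi ->
  nspin (- ncoord t) 1 1 0 *m lorentz ga gb gc gd = left_normal t (A + 2 * pi).
Proof.
move=> h; rewrite (nspin_lorentz _ _ _ _ g_unimodular) left_normalE.
case: (spin_ncoord h) => -> ->.
have -> : (A + 2 * pi) / 2 = A / 2 + pi by lra.
rewrite cosDpi sinDpi.
have sn : s * sin ((t - A) / 2) != 0 by rewrite mulf_neq0 ?gt_eqF // chord_gt0.
have sm : - s^-1 != 0 by rewrite oppr_eq0 invr_eq0 gt_eqF.
rewrite nspinZl // -[in LHS](nspinZr _ _ _ _ sm).
by congr nspin; rewrite /ga /gb; field; rewrite gt_eqF.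
Qed.

End real_line.

(** Send the tail of the first arch to infinity and the ends of the second
    arch to 0 and 1; the gaps are the remaining parameters. *)
Lemma pentagon_normal_form (P : polygon R 5) : flippered P ->
  tine P (ord5 2) -> tine P (ord5 3) -> tine P (ord5 4) ->
  exists g1 g3 g4 g5 : R, [/\ [/\ 0 <= g1, 0 <= g3, 0 < g4 & 0 < g5] &
    isometric (pentagon g1 g3 g4 g5) P].
Proof.
move=> hP t2 t3 t4.
pose o := ord5 0; pose lo := lo P o; pose hi := hi P o.
have idx k (hk : (k < 5)%N) : arch_idx o k = Ordinal hk.
  by apply/val_inj; rewrite /= val_arch_idx add0n modn_small.
have L k : lo k < hi k by exact: lo_lt_hi.
have G k : hi k <= lo k.+1 by exact: hi_le_lo.
have T (k : nat) : tine P (arch_idx o k) -> lo k.+1 = hi k.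
  move=> t; apply/esym; apply: ideal_inj; first exact: G.
    have h := L k.
    have : lo k.+1 < lo k + 2 * pi by rewrite /lo -loDn //; apply: lo_lt => //; lia.
    lra.
  by rewrite /hi /lo ideal_hi ideal_lo arch_idxS.
have e2 : lo 3 = hi 2 by apply: T; rewrite (idx 2 isT).
have e3 : lo 4 = hi 3 by apply: T; rewrite (idx 3 isT).
have e4 : lo 5 = hi 4 by apply: T; rewrite (idx 4 isT).
have e5 : lo 5 = lo 0 + 2 * pi by rewrite /lo -loDn.
have [[[[l0 l1] l2] l3] l4] := (L 0, L 1, L 2, L 3, L 4).
have [g0 g1] := (G 0, G 1).
have b1 : lo 0 < hi 0 < lo 0 + 2 * pi by apply/andP; split; lra.
have b2 : lo 0 < lo 1 < lo 0 + 2 * pi by apply/andP; split; lra.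
have b3 : lo 0 < hi 1 < lo 0 + 2 * pi by apply/andP; split; lra.
have b4 : lo 0 < lo 2 < lo 0 + 2 * pi by apply/andP; split; lra.
have b5 : lo 0 < hi 2 < lo 0 + 2 * pi by apply/andP; split; lra.
have b6 : lo 0 < hi 3 < lo 0 + 2 * pi by apply/andP; split; lra.
pose x := coord (lo 0).
have c12 : 0 <= x (lo 1) - x (hi 0) by exact: coord_le.
have c23 : 0 < x (hi 1) - x (lo 1) by exact: coord_lt.
have c34 : 0 <= x (lo 2) - x (hi 1) by exact: coord_le.
have c45 : 0 < x (hi 2) - x (lo 2) by exact: coord_lt.
have c56 : 0 < x (hi 3) - x (hi 2) by apply: coord_lt => //; lra.
(* The scale for which the gap between the ends of the second arch becomes 1. *)
pose s := Num.sqrt (x (hi 1) - x (lo 1)).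
have s0 : 0 < s by rewrite sqrtr_gt0.
have s2 : s ^+ 2 = x (hi 1) - x (lo 1) by rewrite sqr_sqrtr // ltW.
pose X := ncoord (lo 0) (x (lo 1)) s.
have XB t t' : X t' - X t = (x t' - x t) / s ^+ 2.
  by rewrite /X /ncoord -mulrBl -/(x t) -/(x t'); congr (_ / _); ring.
have X2 : X (lo 1) = 0 by rewrite /X /ncoord subrr mul0r.
have X3 : X (hi 1) = 1 by rewrite -[LHS]subr0 -X2 XB -s2 divff // gt_eqF // exprn_gt0.
have s20 : 0 < s ^+ 2 by rewrite exprn_gt0.
exists (- X (hi 0)), (X (lo 2) - X (hi 1)), (X (hi 2) - X (lo 2)), (X (hi 3) - X (hi 2)).
split.
  split; rewrite ?XB ?divr_gt0 ?divr_ge0 ?(ltW s20) //.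
  have -> : - X (hi 0) = X (lo 1) - X (hi 0) by rewrite X2 add0r.
  by rewrite XB divr_ge0 // ltW.
apply: (@isometric_lorentz _ _ _ _ _ _ _ _ (g_unimodular (lo 0) (x (lo 1)) s0)).
have N k (hk : (k < 5)%N) : normal P (Ordinal hk) = left_normal (lo k) (hi k).
  by rewrite -idx normalE.
have E4 : 1 + (X (lo 2) - X (hi 1)) = X (lo 2) by rewrite X3; ring.
have E5 : X (lo 2) + (X (hi 2) - X (lo 2)) = X (hi 2) by ring.
have E6 : X (hi 2) + (X (hi 3) - X (hi 2)) = X (hi 3) by ring.
apply: ord5_ind; rewrite N !normal_pentagon ?E4 ?E5 ?E6.
- exact: left_normal_ncoord_l.
- by rewrite -[X in nspin X]oppr0 -X2 -[X in nspin _ _ (- X)]X3; exact: left_normal_ncoord.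
- exact: left_normal_ncoord.
- by rewrite e2; exact: left_normal_ncoord.
- by rewrite e3 -e4 e5; exact: left_normal_ncoord_r.
Qed.

End normal_form.

(** * Differentials and Jacobian matrices *)

Section differentials.
Context {R : realType}.

(** The difference of the two functions vanishes near x, hence is
    differentiable with differential 0. *)
Lemma near_eq_is_diff (V W : normedModType R) (f g df : V -> W) (x : V) :
  (\forall y \near x, f y = g y) -> is_diff x f df -> is_diff x g df.
Proof.
move=> fg hf; pose k : V -> W := g - f.
have kx : \forall y \near x, k y = 0.
  by apply: filterS fg => y e; rewrite /k -[LHS]/(g y - f y) e subrr.
have k0 : k x = 0 by exact: nbhs_singleton kx.
have [c0 ek] : continuous (0 : V -> W) /\ k \o shift x = cst (k x) + \0 +o_ 0 id.
  split; first exact: cst_continuous.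
  apply/eqaddoP => e e0.
  have : \forall y \near (0 : V), k (y + x) = 0.
    by move: kx; rewrite (near_shift 0) => h; apply: filterS h => y; rewrite /= subr0.
  apply: filterS => y hy /=.
  rewrite -[X in `|X|]/(k (y + x) - (k x + 0)) hy k0 addr0 subr0 normr0.
  by rewrite mulr_ge0 // ltW.
have dk : 'd k x = 0 :> (V -> W) by exact: diff_unique.
have : differentiable k x by apply/diff_locallyP; rewrite dk.
move=> dk'; have -> : g = f + k by rewrite /k addrC subrK.
by rewrite -[df]addr0; apply: is_diffD; exact: DiffDef.
Qed.

Lemma is_diff_linear (V W : normedModType R) (f : V -> W) (x : V) :
  linear f -> continuous f -> is_diff x f f.
Proof.
move=> lf cf.
pose mx := GRing.isLinear.Build _ _ _ _ _ lf.
pose L : {linear V -> W} := HB.pack f mx.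
have -> : f = L by [].
by apply: DiffDef; [exact/linear_differentiable|exact: diff_lin].
Qed.

Lemma is_diff_real (V : normedModType R) (phi dphi : V -> R) (psi : R -> R) (c : R) (x : V) :
  is_diff x phi dphi -> is_derive (phi x) 1 psi c ->
  is_diff x (fun y => psi (phi y)) (fun v => c * dphi v).
Proof.
move=> dp [dq eq].
have d : differentiable psi (phi x) by exact/derivable1_diffP.
have dpsi : is_diff (phi x) psi (fun h => c * h).
  apply: DiffDef => //; rewrite diff1E //; apply/funext => h.
  by rewrite derive1E eq mulrC.
exact: (@is_diff_comp _ _ _ _ phi dphi psi (fun h => c * h)).
Qed.

Lemma is_diff_row (m n : nat) (F dF : 'I_n -> 'rV[R]_m -> R) (x : 'rV[R]_m) :
  (forall k, is_diff x (F k) (dF k)) ->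
  is_diff x (fun y => \row_k F k y) (fun v => \row_k dF k v).
Proof.
move=> h; set f := fun y => _.
have df : differentiable f x.
  have -> : f = \sum_(k < n) (fun y => F k y *: (delta_mx 0 k : 'rV[R]_n)).
    apply/funext => y; rewrite fct_sumE; apply/rowP => k.
    rewrite !mxE summxE (bigD1 k) //= big1 ?addr0 => [|j jk].
      by rewrite !mxE !eqxx mulr1.
    by rewrite !mxE eq_sym (negbTE jk) andbF mulr0.
  apply: differentiable_sum => k.
  have [dk _] := h k.
  have [ds _] := is_diff_scalel (F k x) (delta_mx 0 k : 'rV[R]_n).
  have := differentiable_comp dk ds.
  by apply.
apply: DiffDef => //; apply/funext => v; apply/rowP => k; rewrite mxE.
have e : F k = (fun M : 'rV[R]_n => M 0 k) \o f by apply/funext => y; rewrite /= mxE.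
have lin : linear (fun M : 'rV[R]_n => M 0 k : R) by move=> a u w; rewrite !mxE.
have dc := is_diff_linear (f x) lin (@coord_continuous R 1 n 0 k).
have := h k; rewrite e => -[_ <-].
rewrite diff_comp //.
by case: dc => _ ->.
Qed.

Lemma jacobian_row (m n : nat) (f df : 'rV[R]_m -> 'rV[R]_n) (x : 'rV[R]_m) :
  is_diff x f df -> 'J f x = \matrix_(i, k) df (delta_mx 0 i) 0 k.
Proof. by move=> [_ e]; apply/matrixP => i k; rewrite /jacobian !mxE e. Qed.

End differentials.

(** * Shearing coordinates *)

Section shears_of_pentagons.
Context {R : realType}.

(** The foot on the vertical line over y lies at Euclidean height equal to the
    distance from x to y, which the horofunction of infinity measures. *)
Lemma foot_infty (x y : R) : x != y ->
  mdot (foot (null 1 0) (ideal (ang y)) (ideal (ang x))) (null 1 0) = - `|y - x|^-1.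
Proof.
move=> xy.
have h (t : R) : 0 < 1 + t ^+ 2 by rewrite ltr_pwDl // sqr_ge0.
have nn : mdot (null 1 0) (null 1 0) = 0 :> R by rewrite mdot_null; ring.
have yy : mdot (ideal (ang y)) (ideal (ang y)) = 0 by exact: ideal_null.
rewrite /foot; set z := _ + _.
have d0 : 0 < `|y - x| by rewrite normr_gt0 subr_eq0 eq_sym.
have d2 : `|y - x| ^+ 2 = (y - x) ^+ 2 by rewrite real_normK // num_real.
have zn : mdot z (null 1 0) = - 2 / (1 + x ^+ 2).
  rewrite /z mdotDl !mdotZl nn !(mdotC _ (null 1 0)) !mdot_infty_ang.
  by field; rewrite !gt_eqF.
have zz : - mdot z z = (2 * `|y - x| / (1 + x ^+ 2)) ^+ 2.
  rewrite /z mdotDl !mdotDr !mdotZl !mdotZr nn yy !(mdotC _ (null 1 0)) !mdot_infty_ang mdot_ang.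
  rewrite expr_div_n exprMn d2.
  by field; rewrite !gt_eqF.
rewrite mdotZl zn zz sqrtr_sqr ger0_norm; last by rewrite divr_ge0 ?mulr_ge0 // ltW.
by field; rewrite !gt_eqF.
Qed.

(** The two feet on the vertical line over y have heights y - x and z - y. *)
Lemma shear_infty (x y z : R) : x < y -> y < z ->
  shear (null 1 0) (ideal (ang y)) (ideal (ang x)) (ideal (ang z)) =
  ln (z - y) - ln (y - x).
Proof.
move=> xy yz; rewrite /shear /signed_dist !foot_infty ?(lt_eqF xy) ?(gt_eqF yz) //.
rewrite -ln_div ?posrE ?subr_gt0 //; congr ln.
rewrite (distrC y z) (gtr0_norm (_ : 0 < z - y)) ?subr_gt0 // (gtr0_norm (_ : 0 < y - x)) ?subr_gt0 //.
have d1 : y - x != 0 by rewrite subr_eq0 gt_eqF.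
have d2 : z - y != 0 by rewrite subr_eq0 gt_eqF.
by field; rewrite d1 d2.
Qed.

Lemma enum5 : enum 'I_5 = [:: ord5 0; ord5 1; ord5 2; ord5 3; ord5 4].
Proof. by apply: (inj_map val_inj); rewrite val_enum_ord. Qed.

(** The diagonals issue from infinity, so that each shear is a difference of the
    logarithms h1, 0, h3, h4, h5 of consecutive gaps; the gaps h1 and h3 are only
    present when the corresponding ends are flippers. *)
Definition shear_list (b0 b1 : bool) (h1 h3 h4 h5 : R) : seq R :=
  (if b0 then [:: - h1] else [::]) ++
  (if b1 then [:: h3; h4 - h3] else [:: h4]) ++ [:: h5 - h4].

Section fixed.
Variables (g1 g3 g4 g5 : R).
Hypotheses (g1_ge0 : 0 <= g1) (g3_ge0 : 0 <= g3) (h4 : 0 < g4) (h5 : 0 < g5).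
Local Notation P := (pentagon g1 g3 g4 g5).
Local Notation b0 := (0 < g1).
Local Notation b1 := (0 < g3).

Lemma tine_pentagon0 : `[< tine P (ord5 0) >] = ~~ b0.
Proof.
have fl := flippered_pentagon g1_ge0 g3_ge0 h4 h5.
have cs := cosh_strap0 g1_ge0 g3_ge0 h4 h5; have [s1 s2] := strap_gt0 fl (ord5 0).
have s0 := strap_ge0 fl (ord5 0).
move: g1_ge0; rewrite le_eqVlt => /predU1P[g10|g1p].
  rewrite -g10 ltxx /=; apply/asboolP; rewrite -g10 in cs s2 *; apply: contrapT => /s2 sp.
  move: cs; rewrite cosh_half mulr0 addr0.
  have : 0 < sinh (strap (pentagon 0 g3 g4 g5) (ord5 0) / 2) by apply: sinh_gt0; rewrite divr_gt0.
  by move=> /(exprn_gt0 2) k; lra.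
rewrite g1p /=; apply/asboolP/s1; rewrite lt_neqAle s0 andbT; apply/eqP => e.
by move: cs; rewrite -e /cosh oppr0 expR0; lra.
Qed.

Lemma tine_pentagon1 : `[< tine P (ord5 1) >] = ~~ b1.
Proof.
have fl := flippered_pentagon g1_ge0 g3_ge0 h4 h5.
have cs := cosh_strap1 g1_ge0 g3_ge0 h4 h5; have [s1 s2] := strap_gt0 fl (ord5 1).
have s0 := strap_ge0 fl (ord5 1); have h4' := h4.
move: g3_ge0; rewrite le_eqVlt => /predU1P[g30|g3p].
  rewrite -g30 ltxx /=; apply/asboolP; rewrite -g30 in cs s2 *; apply: contrapT => /s2 sp.
  move: cs; rewrite cosh_half !mul0r mulr0 addr0.
  have : 0 < sinh (strap (pentagon g1 0 g4 g5) (ord5 1) / 2) by apply: sinh_gt0; rewrite divr_gt0.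
  by move=> /(exprn_gt0 2) k; lra.
rewrite g3p /=; apply/asboolP/s1; rewrite lt_neqAle s0 andbT; apply/eqP => e.
have : 0 < g3 * (1 + g3 + g4) / g4 by rewrite divr_gt0 // mulr_gt0 //; lra.
by move: cs; rewrite -e /cosh oppr0 expR0; lra.
Qed.

Lemma tine_pentagon_rest : (`[< tine P (ord5 2) >] = true) * (`[< tine P (ord5 3) >] = true) *
  (`[< tine P (ord5 4) >] = true).
Proof. by do !split; apply/asboolP; rewrite /tine ordS5 /= ?ideal_2pi ?ideal_0. Qed.

Lemma clip_pentagon : clip_vertices P = 0 :: map ang
  ((if b0 then [:: - g1] else [::]) ++ [:: 0] ++ (if b1 then [:: 1] else [::]) ++
   [:: 1 + g3; 1 + g3 + g4; 1 + g3 + g4 + g5]).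
Proof.
rewrite /clip_vertices enum5 /= tine_pentagon0 tine_pentagon1 !tine_pentagon_rest.
by case: b0; case: b1.
Qed.

Lemma shears_pentagon N : N = (2 + (b0 + b1))%N ->
  shears N P = \row_k (shear_list b0 b1 (ln g1) (ln g3) (ln g4) (ln g5))`_k.
Proof.
move=> ->.
apply/rowP => k; rewrite !mxE clip_pentagon /shear_list.
have k1 := g1_ge0; have k3 := g3_ge0; have k4 := h4; have k5 := h5.
have v0 : ideal 0 = null 1 0 :> 'rV[R]_3 by exact: ideal_0.
have gap (x y d : R) : 0 < d -> y = x + d -> x < y by move=> ? ->; rewrite ltrDl.
have D (x y : R) : x + y - x = y by rewrite addrAC subrr add0r.
case: k => [k hk] /=; rewrite v0; move: hk.
move: k1 k3; rewrite !le_eqVlt => /predU1P[e1|k1] /predU1P[e3|k3];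
  rewrite -?e1 -?e3 ?ltxx ?k1 ?k3; case: k => [|[|[|[|//]]]] //= _;
  rewrite shear_infty; try lra.
all: by rewrite ?addr0 ?subr0 ?opprK ?add0r ?D ?ln1 ?subr0 ?sub0r.
Qed.

End fixed.
End shears_of_pentagons.

(** * Derivatives of real functions *)

Section calculus.
Context {R : realType}.
Implicit Types (f g : R -> R) (x a b c : R).

Lemma drv_eq x f a b : is_derive x 1 f a -> a = b -> is_derive x 1 f b.
Proof. by move=> ? <-. Qed.

Lemma drv_cst x c : is_derive x 1 (fun=> c) 0.
Proof. exact: is_derive_cst. Qed.

Lemma drv_id x : is_derive x 1 (fun t => t) 1.
Proof. exact: is_derive_id. Qed.

Lemma drvD x f g a b : is_derive x 1 f a -> is_derive x 1 g b ->
  is_derive x 1 (fun t => f t + g t) (a + b).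
Proof. by move=> fa gb; exact: is_deriveD. Qed.

Lemma drvN x f a : is_derive x 1 f a -> is_derive x 1 (fun t => - f t) (- a).
Proof. by move=> fa; exact: is_deriveN. Qed.

Lemma drvM x f g a b : is_derive x 1 f a -> is_derive x 1 g b ->
  is_derive x 1 (fun t => f t * g t) (a * g x + f x * b).
Proof.
move=> fa gb; have h : is_derive x 1 (f * g) (f x *: b + g x *: a) by exact: is_deriveM.
by case: h => d e; apply: DeriveDef => //; rewrite -[LHS]/('D_1 (f * g) x) e addrC (mulrC a).
Qed.

Lemma drv_comp x f g a b : is_derive (g x) 1 f a -> is_derive x 1 g b ->
  is_derive x 1 (fun t => f (g t)) (a * b).
Proof. by move=> fa gb; exact: is_derive1_comp. Qed.

Lemma drvV x f a : f x != 0 -> is_derive x 1 f a ->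
  is_derive x 1 (fun t => (f t)^-1) (- a / f x ^+ 2).
Proof.
move=> f0 fa; have [d e] := is_deriveV f0 fa; apply: DeriveDef => //; rewrite e.
by rewrite /GRing.scale /= mulNr mulrC mulNr.
Qed.

Lemma drv_ln x f a : is_derive x 1 f a -> 0 < f x ->
  is_derive x 1 (fun t => ln (f t)) (a / f x).
Proof.
by move=> fa f0; rewrite mulrC; exact: drv_comp (is_derive1_ln f0) fa.
Qed.

Lemma drv_exp x f a : is_derive x 1 f a -> is_derive x 1 (fun t => expR (f t)) (expR (f x) * a).
Proof. by move=> fa; exact: drv_comp (is_derive_expR _) fa. Qed.

Lemma drv_scale x f a c : is_derive x 1 f a -> is_derive x 1 (fun t => c * f t) (c * a).
Proof. by move=> fa; apply: drv_eq (drvM (drv_cst x c) fa) _; rewrite mul0r add0r. Qed.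

Lemma drv_half x : is_derive x 1 (fun t => t / 2) 2^-1.
Proof. by apply: drv_eq (drvM (drv_id x) (drv_cst x 2^-1)) _; rewrite mul1r mulr0 addr0. Qed.

Lemma drv_sinh x : is_derive x 1 (@sinh R) (cosh x).
Proof.
apply: drv_eq (drvM (drvD (drv_exp (drv_id x)) (drvN (drv_exp (drvN (drv_id x))))) (drv_cst x 2^-1)) _.
by rewrite /cosh; ring.
Qed.

Lemma drv_cosh x : is_derive x 1 (@cosh R) (sinh x).
Proof.
apply: drv_eq (drvM (drvD (drv_exp (drv_id x)) (drv_exp (drvN (drv_id x)))) (drv_cst x 2^-1)) _.
by rewrite /sinh; ring.
Qed.

Lemma drv_ln_sinh x : 0 < x -> is_derive x 1 (fun t => 2 * ln (sinh (t / 2)))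
  (cosh (x / 2) / sinh (x / 2)).
Proof.
move=> x0; have s0 : 0 < sinh (x / 2) by apply: sinh_gt0; rewrite divr_gt0.
have ds : is_derive x 1 (fun t => sinh (t / 2)) (cosh (x / 2) / 2).
  exact: (@drv_comp x (@sinh R) (fun t => t / 2) _ _ (drv_sinh (x / 2)) (drv_half x)).
apply: drv_eq (drv_scale 2 (drv_ln ds s0)) _.
by field; rewrite gt_eqF.
Qed.

Lemma drv_softplus x : is_derive x 1 (fun t => ln (1 + expR t)) (expR x / (1 + expR x)).
Proof.
have p : 0 < 1 + expR x by rewrite addr_gt0 ?expR_gt0.
apply: drv_eq (drv_ln (drvD (drv_cst x 1) (drv_exp (drv_id x))) p) _.
by rewrite mulr1 add0r.
Qed.

Lemma drv_cosh_half2 x : is_derive x 1 (fun t => cosh (t / 2) ^+ 2) (cosh (x / 2) * sinh (x / 2)).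
Proof.
have h : is_derive x 1 (fun t => cosh (t / 2)) (sinh (x / 2) / 2).
  exact: (@drv_comp x (@cosh R) (fun t => t / 2) _ _ (drv_cosh (x / 2)) (drv_half x)).
by apply: drv_eq (drvM h h) _; field.
Qed.

Lemma drv_ln1 x : 0 < 1 + x -> is_derive x 1 (fun t => ln (1 + t)) (1 + x)^-1.
Proof.
move=> p; apply: drv_eq (drv_ln (drvD (drv_cst x 1) (drv_id x)) p) _.
by rewrite add0r mul1r.
Qed.

End calculus.

(** * A chart of the moduli space *)

Section chart.
Context {R : realType}.
Implicit Types (s u w : R) (P : polygon R 5).

Definition logistic u : R := expR u / (1 + expR u).

Lemma logistic_gt0 u : 0 < logistic u.
Proof. by rewrite divr_gt0 ?expR_gt0 // addr_gt0 ?expR_gt0. Qed.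

Lemma expD1_gt0 u : 0 < 1 + expR u :> R.
Proof. by rewrite addr_gt0 ?expR_gt0. Qed.

(** The coordinate u is the logarithm of g4 / (1 + g3) and w that of g5. The
    gaps g1 and g3 are then determined by the two strap lengths. *)
Definition chart (s0 s1 u w : R) : polygon R 5 :=
  let g3 := sinh (s1 / 2) ^+ 2 * logistic u in
  pentagon (sinh (s0 / 2) ^+ 2) g3 (expR u * (1 + g3)) (expR w).

Lemma gap1_ge0 (s0 : R) : 0 <= sinh (s0 / 2) ^+ 2.
Proof. exact: sqr_ge0. Qed.

Lemma gap3_ge0 (s1 u : R) : 0 <= sinh (s1 / 2) ^+ 2 * logistic u.
Proof. by rewrite mulr_ge0 ?sqr_ge0 // ltW ?logistic_gt0. Qed.

Lemma gap4_gt0 (s1 u : R) : 0 < expR u * (1 + sinh (s1 / 2) ^+ 2 * logistic u).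
Proof. by rewrite mulr_gt0 ?expR_gt0 // ltr_pwDl ?gap3_ge0. Qed.

Lemma flippered_chart (s0 s1 u w : R) : flippered (chart s0 s1 u w).
Proof. exact: flippered_pentagon (gap1_ge0 _) (gap3_ge0 _ _) (gap4_gt0 _ _) (expR_gt0 _). Qed.

Lemma cosh_inj s t : 0 <= s -> 0 <= t -> cosh s = cosh t -> s = t :> R.
Proof. by move=> s0 t0 e; rewrite -(arcosh_cosh s0) -(arcosh_cosh t0) e. Qed.

Lemma strap_chart0 (s0 s1 u w : R) : 0 <= s0 -> strap (chart s0 s1 u w) (ord5 0) = s0.
Proof.
move=> s00; apply: cosh_inj => //; first exact: strap_ge0 (flippered_chart _ _ _ _) _.
rewrite (cosh_strap0 (gap1_ge0 s0) (gap3_ge0 s1 u) (gap4_gt0 s1 u) (expR_gt0 w)).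
by rewrite cosh_half addrC.
Qed.

Lemma strap_chart1 (s0 s1 u w : R) : 0 <= s1 -> strap (chart s0 s1 u w) (ord5 1) = s1.
Proof.
move=> s10; apply: cosh_inj => //; first exact: strap_ge0 (flippered_chart _ _ _ _) _.
rewrite (cosh_strap1 (gap1_ge0 s0) (gap3_ge0 s1 u) (gap4_gt0 s1 u) (expR_gt0 w)).
have p := gap3_ge0 s1 u; have e := expR_gt0 u; have e1 := expD1_gt0 u.
rewrite cosh_half addrC; congr (2 * _ + _).
set g := _ * logistic u; have g0 : 0 < 1 + g by rewrite ltr_pwDl // gap3_ge0.
by rewrite {1}/g /logistic; field; rewrite !gt_eqF.
Qed.

(** Strap lengths are functions of the Gram matrix of the normals. *)
Lemma strap_isometric n (P Q : polygon R n) j : flippered P -> flippered Q -> isometric P Q ->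
  strap P j = strap Q j.
Proof.
move=> hP hQ PQ; apply: cosh_inj (strap_ge0 hP j) (strap_ge0 hQ j) _.
by rewrite (cosh_strap hP) (cosh_strap hQ) (isometric_gram _ _ hP hQ PQ).
Qed.

(** Solve the two strap equations for the gaps of the normal form. *)
Lemma chart_surj P : flippered P -> tine P (ord5 2) -> tine P (ord5 3) -> tine P (ord5 4) ->
  exists u w, isometric (chart (strap P (ord5 0)) (strap P (ord5 1)) u w) P.
Proof.
move=> hP t2 t3 t4; have [g1 [g3 [g4 [g5 [[h1 h3 h4 h5] i]]]]] := pentagon_normal_form hP t2 t3 t4.
have fl := flippered_pentagon h1 h3 h4 h5.
have p : 0 < 1 + g3 by lra.
have p' : 0 < 1 + g3 + g4 by lra.
exists (ln (g4 / (1 + g3))), (ln g5).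
have E : expR (ln (g4 / (1 + g3))) = g4 / (1 + g3) by rewrite lnK // posrE divr_gt0.
have e : logistic (ln (g4 / (1 + g3))) = g4 / (1 + g3 + g4).
  by rewrite /logistic E; field; rewrite !gt_eqF.
have := cosh_strap0 h1 h3 h4 h5; have := cosh_strap1 h1 h3 h4 h5.
rewrite !(strap_isometric _ fl hP i) !cosh_half.
move: (strap P (ord5 0)) (strap P (ord5 1)) => s0 s1 e1 e0.
rewrite /chart; have -> : sinh (s0 / 2) ^+ 2 = g1.
  by move: e0; move: (sinh _ ^+ 2) => y; clear; lra.
have -> : sinh (s1 / 2) ^+ 2 = g3 * (1 + g3 + g4) / g4.
  by move: e1; move: (sinh _ ^+ 2) (_ / g4) => y z; clear; lra.
have -> : g3 * (1 + g3 + g4) / g4 * logistic (ln (g4 / (1 + g3))) = g3.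
  by rewrite e; field; rewrite !gt_eqF.
by rewrite E lnK ?posrE // (_ : g4 / (1 + g3) * _ = g4) //; field; rewrite gt_eqF.
Qed.

Lemma logistic_le u v : u <= v -> logistic u <= logistic v.
Proof.
move=> uv; rewrite /logistic; have a := expD1_gt0 u; have b := expD1_gt0 v.
rewrite ler_pdivrMr // mulrAC ler_pdivlMr // !mulrDr !mulr1 mulrC lerD2r.
by rewrite ler_expR.
Qed.

(** The distance between the first and the third arch decreases with u. *)
Lemma gram02_lt (a B u v : R) : 1 <= a -> 0 <= B -> u < v ->
  (a + B * logistic v) / (expR v * (1 + B * logistic v)) < (a + B * logistic u) / (expR u * (1 + B * logistic u)).
Proof.
move=> a1 B0 uv; have s := logistic_le (ltW uv).
have := ler_wpM2l B0 s; have := mulr_ge0 B0 (ltW (logistic_gt0 u)).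
set t := B * logistic u; set t' := B * logistic v => t0 tt'.
have Ep := expR_gt0 u; have : expR u < expR v by rewrite ltr_expR.
move: (expR u) (expR v) Ep => x y x0 xy.
have y0 : 0 < y by exact: lt_trans xy.
rewrite ltr_pdivrMr ?mulr_gt0 //; last lra.
rewrite mulrAC ltr_pdivlMr ?mulr_gt0 //; last lra.
have k : (a + t') * (1 + t) <= (a + t) * (1 + t').
  have : 0 <= (a - 1) * (t' - t) by rewrite mulr_ge0; lra.
  have -> : (a - 1) * (t' - t) = (a + t) * (1 + t') - (a + t') * (1 + t) by ring.
  by rewrite subr_ge0.
have k' : 0 < (a + t') * (1 + t) by rewrite mulr_gt0; lra.
have := ler_wpM2r (ltW y0) k; have := mulr_gt0 k' (_ : 0 < y - x); rewrite subr_gt0 => /(_ xy).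
by lra.
Qed.

(** The straps give the first two coordinates, then gram02 gives u by
    monotonicity, and gram14 gives g5. *)
Lemma chart_inj (s0 s1 u w t0 t1 u' w' : R) : 0 <= s0 -> 0 <= s1 -> 0 <= t0 -> 0 <= t1 ->
  isometric (chart s0 s1 u w) (chart t0 t1 u' w') -> [/\ s0 = t0, s1 = t1, u = u' & w = w'].
Proof.
move=> s00 s10 t00 t10 i; have fl := flippered_chart s0 s1 u w.
have fl' := flippered_chart t0 t1 u' w'.
have e0 : s0 = t0.
  by have := strap_isometric (ord5 0) fl fl' i; rewrite !strap_chart0.
have e1 : s1 = t1.
  by have := strap_isometric (ord5 1) fl fl' i; rewrite !strap_chart1.
have := isometric_gram (ord5 0) (ord5 2) fl fl' i.
have := isometric_gram (ord5 1) (ord5 4) fl fl' i.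
move=> /(congr1 -%R); rewrite !gram14 => E1.
move=> /(congr1 -%R); rewrite !gram02 ?gap4_gt0 //; rewrite -e0 -e1 in E1 *.
move=> E0.
have a1 : 1 <= sinh (s0 / 2) ^+ 2 + 1 by have := sqr_ge0 (sinh (s0 / 2)); lra.
have B0 := sqr_ge0 (sinh (s1 / 2)).
have eu : u = u'.
  case: (ltgtP u u') => // /(gram02_lt a1 B0); lra.
split=> //; apply: expR_inj; rewrite -eu in E1; lra.
Qed.

Definition log_gap1 (s0 : R) : R := 2 * ln (sinh (s0 / 2)).
Definition log_gap3 (s1 u : R) : R := 2 * ln (sinh (s1 / 2)) + u - ln (1 + expR u).
Definition log_gap4 (s1 u : R) : R := u + ln (1 + cosh (s1 / 2) ^+ 2 * expR u) - ln (1 + expR u).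

Lemma ln_sqr (s0 : R) : 0 < s0 -> ln (sinh (s0 / 2) ^+ 2) = 2 * ln (sinh (s0 / 2)).
Proof.
move=> s00; have p : 0 < sinh (s0 / 2) by apply: sinh_gt0; rewrite divr_gt0.
by rewrite lnXn // mulr_natl.
Qed.

Lemma sinh2_gt0 (s0 : R) : 0 <= s0 -> (0 < sinh (s0 / 2) ^+ 2) = (0 < s0).
Proof.
rewrite le_eqVlt => /predU1P[<-|p]; first by rewrite mul0r /sinh oppr0 subrr mul0r expr0n /= ltxx.
by rewrite p exprn_gt0 // sinh_gt0 // divr_gt0.
Qed.

Lemma shears_chart N (s0 s1 u w : R) : 0 <= s0 -> 0 <= s1 -> N = (2 + ((0 < s0)%R + (0 < s1)%R))%N ->
  shears N (chart s0 s1 u w) =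
  \row_k (shear_list (0 < s0) (0 < s1) (log_gap1 s0) (log_gap3 s1 u) (log_gap4 s1 u) w)`_k.
Proof.
move=> s00 s10 hN; have e := expR_gt0 u; have e1 := expD1_gt0 u.
have b0 := sinh2_gt0 s00.
have b1 : (0 < sinh (s1 / 2) ^+ 2 * logistic u) = (0 < s1).
  by rewrite pmulr_lgt0 ?logistic_gt0 // sinh2_gt0.
rewrite /chart (shears_pentagon (gap1_ge0 s0) (gap3_ge0 s1 u) (gap4_gt0 s1 u) (expR_gt0 w)) ?b0 ?b1 //.
apply/rowP => k; rewrite !mxE; congr (nth _ _ _).
rewrite /shear_list expRK.
have -> : ln (expR u * (1 + sinh (s1 / 2) ^+ 2 * logistic u)) = log_gap4 s1 u.
  have c := cosh_ge1 (s1 / 2); have p : 0 < 1 + cosh (s1 / 2) ^+ 2 * expR u.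
    by rewrite ltr_pwDl // mulr_ge0 ?sqr_ge0 // ltW.
  rewrite lnM ?posrE //; last by rewrite ltr_pwDl ?gap3_ge0.
  rewrite expRK /log_gap4 -addrA; congr (_ + _).
  rewrite -ln_div ?posrE //; congr ln; rewrite cosh2 /logistic; field; rewrite gt_eqF //.
congr (_ ++ _); first by case: ifP => // /ln_sqr ->.
case: ifP => // s1p; congr [:: _, _ - _ & _].
all: rewrite lnM ?posrE ?logistic_gt0 ?sinh2_gt0 // ln_sqr // /log_gap3 -addrA; congr (_ + _).
all: by rewrite /logistic ln_div ?posrE // expRK.
Qed.

Lemma action_chart (s0 s1 u w : R) :
  expR (- action (chart s0 s1 u w)) =
  let g4 := expR u * (1 + sinh (s1 / 2) ^+ 2 * logistic u) in
  logistic u * expR w /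
   ((cosh (s0 / 2) ^+ 2 + sinh (s1 / 2) ^+ 2 * logistic u + g4 + expR w) * (g4 + expR w)).
Proof.
rewrite (action_pentagon (gap1_ge0 s0) (gap3_ge0 s1 u) (gap4_gt0 s1 u) (expR_gt0 w)) /= cosh2.
have p1 := gap1_ge0 s0; have p3 := gap3_ge0 s1 u; have p4 := gap4_gt0 s1 u; have p5 := expR_gt0 w.
have e := expR_gt0 u; have e1 := expD1_gt0 u.
have es : logistic u = expR u * (1 + sinh (s1 / 2) ^+ 2 * logistic u) /
    (1 + sinh (s1 / 2) ^+ 2 * logistic u + expR u * (1 + sinh (s1 / 2) ^+ 2 * logistic u)) :> R.
  by rewrite {1}/logistic; field; rewrite !gt_eqF //; lra.
move: p1 p3 p4 p5 es; set g1 := sinh (s0 / 2) ^+ 2; set g3 := _ * logistic u; set g4 := expR u * _.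
move: (expR w) => g5 p1 p3 p4 p5 ->.
by field; rewrite !gt_eqF //; lra.
Qed.

End chart.

(** * Adapted coordinates *)

Section coordinates.
Context {R : realType}.
Variable A : {set 'I_5}.
Hypothesis A01 : A \subset [set ord5 0; ord5 1]%SET.
Local Notation b0 := (ord5 0 \in A).
Local Notation b1 := (ord5 1 \in A).
Local Notation N := (5 - 3 + #|A|)%N.
Implicit Types (x y v : 'rV[R]_N) (j : 'I_5).

Definition cu y : R := y 0 (lshift #|A| (@Ordinal (5 - 3) 0 isT)).
Definition cw y : R := y 0 (lshift #|A| (@Ordinal (5 - 3) 1 isT)).
(** The strap length of the end j as a linear form in the coordinates, which
    is 0 when j is not a flipper. Writing it as a sum avoids choosing an index
    for j. *)
Definition cs j y : R := \sum_(k < #|A| | enum_val k == j) y 0 (rshift (5 - 3) k).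
Definition Phi y : polygon R 5 := chart (cs (ord5 0) y) (cs (ord5 1) y) (cu y) (cw y).
Definition dom : set 'rV[R]_N := [set y | forall k : 'I_#|A|, 0 < y 0 (rshift (5 - 3) k)].

Lemma flipperless j : j \notin [set ord5 0; ord5 1]%SET -> j \notin A.
Proof. by apply: contra => /(fintype.subsetP A01). Qed.

Lemma cs_enum_val (k : 'I_#|A|) y : cs (enum_val k) y = y 0 (rshift (5 - 3) k).
Proof. by rewrite /cs (big_pred1 k) // => i /=; rewrite (inj_eq enum_val_inj). Qed.

Lemma cs_out j y : j \notin A -> cs j y = 0.
Proof.
move=> jA; rewrite /cs big_pred0 // => k; apply: contraNF jA => /eqP <-; exact: enum_valP.
Qed.

Lemma cs_gt0 j y : dom y -> (0 < cs j y) = (j \in A).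
Proof.
move=> dy; have [jA|jA] := boolP (j \in A); last by rewrite cs_out ?ltxx.
by rewrite -(enum_rankK_in jA jA) cs_enum_val; exact: dy.
Qed.

Lemma cs_ge0 j y : dom y -> 0 <= cs j y.
Proof. by move=> dy; apply: sumr_ge0 => k _; exact/ltW/dy. Qed.

Lemma strap_Phi j y : dom y -> strap (Phi y) j = cs j y.
Proof.
move=> dy; move: j; apply: ord5_ind.
- by rewrite strap_chart0 ?cs_ge0.
- by rewrite strap_chart1 ?cs_ge0.
all: by rewrite strap_pentagon_tines cs_out // flipperless // !inE.
Qed.

Lemma enumA : enum A = (if b0 then [:: ord5 0] else [::]) ++ (if b1 then [:: ord5 1] else [::]).
Proof.
have e j : j \notin [set ord5 0; ord5 1]%SET -> (j \in A) = false by move=> /flipperless /negbTE.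
rewrite {1}/enum_mem -enumT enum5 /= (e (ord5 2)) ?(e (ord5 3)) ?(e (ord5 4)) ?inE //.
by do 2!case: ifP.
Qed.

Lemma cardA : #|A| = (b0 + b1)%N.
Proof. by rewrite cardE enumA; case: b0; case: b1. Qed.

Lemma enum_val0 (k : 'I_#|A|) : (enum_val k == ord5 0) = b0 && (k == 0%N :> nat).
Proof.
rewrite (enum_val_nth (ord5 0)) enumA; case: k => k /=; rewrite cardA.
by case: b0; case: b1; case: k => [|[|[]]].
Qed.

Lemma enum_val1 (k : 'I_#|A|) : (enum_val k == ord5 1) = b1 && (k == b0 :> nat).
Proof.
rewrite (enum_val_nth (ord5 0)) enumA; case: k => k /=; rewrite cardA.
by case: b0; case: b1; case: k => [|[|[]]].
Qed.

(** The partial derivatives of the strap coordinates, with the position i of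
    the variable as a natural number. *)
Lemma cs_delta j (b : bool) (m : nat) (i : 'I_N) : (b -> m < #|A|)%N ->
  (forall k : 'I_#|A|, (enum_val k == j) = b && (k == m :> nat)) ->
  cs j (delta_mx 0 i) = (b && (i == 2 + m :> nat)%N)%:R.
Proof.
move=> hm h; rewrite /cs (eq_bigl _ _ h); case: b hm {h} => [/(_ isT) hm|_] /=; last first.
  by rewrite big_pred0.
rewrite (big_pred1 (Ordinal hm)) // mxE eqxx /=; congr (nat_of_bool _)%:R.
by rewrite eq_sym -val_eqE.
Qed.

Lemma slice_rshift (c : 'I_5 -> R) u (k : 'I_#|A|) : slice c A u 0 (rshift (5 - 3) k) = c (enum_val k).
Proof. by rewrite /slice row_mxEr mxE. Qed.

Lemma cu_slice (c : 'I_5 -> R) u : cu (slice c A u) = u.1.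
Proof. by rewrite /cu /slice row_mxEl mxE. Qed.

Lemma cw_slice (c : 'I_5 -> R) u : cw (slice c A u) = u.2.
Proof. by rewrite /cw /slice row_mxEl mxE. Qed.

Lemma cs_slice (c : 'I_5 -> R) u j : cs j (slice c A u) = if j \in A then c j else 0.
Proof.
case: ifPn => jA; last exact: cs_out.
by rewrite -{1 2}(enum_rankK_in jA jA) cs_enum_val slice_rshift.
Qed.

Lemma dom_slice (c : 'I_5 -> R) u : (forall j, j \in A -> 0 < c j) -> dom (slice c A u).
Proof. by move=> h k; rewrite slice_rshift; exact/h/enum_valP. Qed.

Lemma open_dom : open dom.
Proof.
rewrite openE => x dx; have F : Filter (nbhs x) by exact: nbhs_filter.
have h (k : 'I_#|A|) : nbhs x [set y : 'rV[R]_N | 0 < y 0 (rshift (5 - 3) k)].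
  refine (@cvgr_gt R _ (nbhs x) F (fun M : 'rV[R]_N => M 0 (rshift (5 - 3) k)) (x 0 (rshift (5 - 3) k)) _ 0 (dx k)).
  exact: (@coord_continuous R 1 N 0 (rshift (5 - 3) k) x).
by apply: filterS (filter_forall F h) => y hy k; exact: hy.
Qed.

Lemma coordinates_inj x y : dom x -> dom y -> isometric (Phi x) (Phi y) -> x = y.
Proof.
move=> dx dy /(chart_inj (cs_ge0 _ dx) (cs_ge0 _ dx) (cs_ge0 _ dy) (cs_ge0 _ dy))[e0 e1 eu ew].
apply/rowP => k; case: (split_ordP k) => k' ->.
  case: k' => -[|[|//]] h.
    by rewrite (_ : Ordinal h = @Ordinal (5 - 3) 0 isT) //; exact: val_inj.
  by rewrite (_ : Ordinal h = @Ordinal (5 - 3) 1 isT) //; exact: val_inj.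
rewrite -!cs_enum_val; have := fintype.subsetP A01 _ (enum_valP k'); rewrite !inE.
by move=> /orP[] /eqP ->.
Qed.

Lemma coordinates_surj (P : polygon R 5) : flippered P -> flippers_at A P ->
  exists2 x, dom x & isometric (Phi x) P.
Proof.
move=> hP fP; have t j : j \notin A -> tine P j.
  move=> jA; apply: contrapT => /(strap_gt0 hP); rewrite -fP; exact/negP.
have e j : (if j \in A then strap P j else 0) = strap P j.
  case: ifPn => //; rewrite fP -leNgt => h; apply/eqP; rewrite eq_le h andbT; exact: strap_ge0.
have [||| u [w i]] := chart_surj hP; try by apply/t/flipperless; rewrite !inE.
exists (slice (strap P) A (u, w)); first by apply: dom_slice => j; rewrite fP.
by rewrite /Phi cu_slice cw_slice !cs_slice !e.
Qed.

Lemma is_diff_coord (k : 'I_N) x : is_diff x (fun y : 'rV[R]_N => y 0 k) (fun v : 'rV[R]_N => v 0 k).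
Proof.
apply: is_diff_linear; last exact: coord_continuous.
by move=> a u v; rewrite !mxE.
Qed.

Lemma is_diff_cs j x : is_diff x (cs j) (cs j).
Proof.
apply: is_diff_linear.
  move=> a u v; rewrite -[_ *: cs j u]/(a * cs j u) /cs mulr_sumr -big_split /=.
  by apply: eq_bigr => k _; rewrite !mxE.
apply: continuous_big => [y|k _]; [exact: add_continuous|exact: coord_continuous].
Qed.

Definition coth (s : R) := cosh (s / 2) / sinh (s / 2).

Lemma is_diff_log_gap1 j x : 0 < cs j x -> is_diff x (fun y => log_gap1 (cs j y)) (fun v => coth (cs j x) * cs j v).
Proof. by move=> p; apply: is_diff_real (is_diff_cs j x) (drv_ln_sinh p). Qed.

Lemma is_diff_softplus x :
  is_diff x (fun y => ln (1 + expR (cu y))) (fun v => logistic (cu x) * cu v).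
Proof. exact: (is_diff_real (is_diff_coord _ x) (drv_softplus (cu x))). Qed.

Lemma is_diff_log_gap3 j x : 0 < cs j x ->
  is_diff x (fun y => log_gap3 (cs j y) (cu y))
    (fun v => coth (cs j x) * cs j v + cu v - logistic (cu x) * cu v).
Proof.
move=> p; apply: is_diffB (is_diff_softplus x).
exact: is_diffD (is_diff_log_gap1 p) (is_diff_coord _ x).
Qed.

Lemma is_diff_log_gap4 j x : let c := cosh (cs j x / 2) ^+ 2 in
  is_diff x (fun y => log_gap4 (cs j y) (cu y))
    (fun v => cu v + (1 + c * expR (cu x))^-1 *
       (c * (expR (cu x) * cu v) + expR (cu x) * (cosh (cs j x / 2) * sinh (cs j x / 2) * cs j v))
       - logistic (cu x) * cu v).
Proof.
move=> c; apply: is_diffB (is_diff_softplus x).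
apply: is_diffD; first exact: is_diff_coord.
have p : 0 < 1 + c * expR (cu x).
  by rewrite ltr_pwDl // mulr_ge0 ?sqr_ge0 // ltW ?expR_gt0.
pose K y := cosh (cs j y / 2) ^+ 2 * expR (cu y).
apply: (@is_diff_real R _ K _ (fun t => ln (1 + t)) _ x _ (drv_ln1 p)).
apply: (@is_diffM _ _ (fun y => cosh (cs j y / 2) ^+ 2) (fun y => expR (cu y))).
  exact: is_diff_real (is_diff_cs j x) (drv_cosh_half2 _).
exact: is_diff_real (is_diff_coord _ x) (is_derive_expR _).
Qed.

Lemma is_diff_shear_list (f1 f3 f4 f5 d1 d3 d4 d5 : 'rV[R]_N -> R) (c0 c1 : bool) x k :
  (c0 -> is_diff x f1 d1) -> (c1 -> is_diff x f3 d3) -> is_diff x f4 d4 -> is_diff x f5 d5 ->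
  is_diff x (fun y => (shear_list c0 c1 (f1 y) (f3 y) (f4 y) (f5 y))`_k)
            (fun v => (shear_list c0 c1 (d1 v) (d3 v) (d4 v) (d5 v))`_k).
Proof.
move=> i1 i3 i4 i5; have z : is_diff x (fun=> 0 : R) (fun=> 0 : R) by exact: is_diff_cst.
rewrite /shear_list; case: c0 i1 => [/(_ isT) i1|_]; case: c1 i3 => [/(_ isT) i3|_] /=;
  case: k => [|[|[|[|[|k]]]]] //=; try exact: is_diffN; exact: is_diffB.
Qed.

(** The entry k of the differential of the shears at x. It is shear_list
    again, because shear_list is linear in the logarithms of the gaps. *)
Definition dshear x (v : 'rV[R]_N) (k : nat) : R :=
  let c := cosh (cs (ord5 1) x / 2) ^+ 2 in
  (shear_list b0 b1 (coth (cs (ord5 0) x) * cs (ord5 0) v)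
    (coth (cs (ord5 1) x) * cs (ord5 1) v + cu v - logistic (cu x) * cu v)
    (cu v + (1 + c * expR (cu x))^-1 *
       (c * (expR (cu x) * cu v) +
        expR (cu x) * (cosh (cs (ord5 1) x / 2) * sinh (cs (ord5 1) x / 2) * cs (ord5 1) v))
       - logistic (cu x) * cu v)
    (cw v))`_k.

Lemma shears_Phi y : dom y -> shears N (Phi y) =
  \row_k (shear_list b0 b1 (log_gap1 (cs (ord5 0) y)) (log_gap3 (cs (ord5 1) y) (cu y))
    (log_gap4 (cs (ord5 1) y) (cu y)) (cw y))`_k.
Proof.
by move=> dy; rewrite /Phi shears_chart ?cs_ge0 // !cs_gt0 // cardA.
Qed.

(** The formula of shears_chart distinguishes cases according to the flippers,
    which are fixed near a point of the domain. *)
Lemma is_diff_shears x : dom x -> is_diff x (shears N \o Phi) (fun v => \row_k dshear x v k).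
Proof.
move=> dx; apply: (@near_eq_is_diff _ _ _ (fun y => \row_k (shear_list b0 b1 (log_gap1 (cs (ord5 0) y))
    (log_gap3 (cs (ord5 1) y) (cu y)) (log_gap4 (cs (ord5 1) y) (cu y)) (cw y))`_k)).
  have := open_nbhs_nbhs (conj open_dom dx).
  by apply: filterS => y dy; rewrite /= shears_Phi.
apply: is_diff_row => k; apply: is_diff_shear_list.
- by move=> h; apply: is_diff_log_gap1; rewrite cs_gt0.
- by move=> h; apply: is_diff_log_gap3; rewrite cs_gt0.
- exact: is_diff_log_gap4.
- exact: is_diff_coord.
Qed.

Lemma coth_gt0 (s : R) : 0 < s -> 0 < coth s.
Proof. by move=> s0; rewrite divr_gt0 ?cosh_gt0 // sinh_gt0 // divr_gt0. Qed.

(** The Jacobian determinant is the product of the factors coth by which the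
    shears are normalised. Indeed X and Y are the derivatives of log_gap3 and
    log_gap4 in u, and C1 and q those in the strap length; the determinant is
    C1 * Y - X * q up to the factor C0, and this is C1. *)
Lemma det_shears x : dom x -> `|\det ('J (shears N \o Phi) x)| =
  (if b0 then coth (cs (ord5 0) x) else 1) * (if b1 then coth (cs (ord5 1) x) else 1).
Proof.
move=> dx; rewrite (jacobian_row (is_diff_shears dx)).
pose E := expR (cu x); pose r := logistic (cu x).
pose C0 := coth (cs (ord5 0) x); pose C1 := coth (cs (ord5 1) x).
pose ch := cosh (cs (ord5 1) x / 2); pose sh := sinh (cs (ord5 1) x / 2).
pose X := 1 - r; pose Y := 1 + (1 + ch ^+ 2 * E)^-1 * (ch ^+ 2 * E) - r.
pose q := (1 + ch ^+ 2 * E)^-1 * (E * (ch * sh)).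
pose G (i k : nat) : R := let U := (i == 0%N)%:R in let S1 := (b1 && (i == 2 + b0)%N)%:R in
  (shear_list b0 b1 (C0 * (b0 && (i == 2 + 0)%N)%:R) (C1 * S1 + X * U) (q * S1 + Y * U)
    (i == 1%N)%:R)`_k.
have -> : \matrix_(i, k) (\row_k dshear x (delta_mx 0 i) k) 0 k = \matrix_(i < N, k < N) G i k.
  apply/matrixP => i k; rewrite !mxE /dshear /G.
  rewrite (@cs_delta _ b0 0%N) ?(@cs_delta _ b1 b0) //; last exact: enum_val0.
  - have e (m : 'I_(5 - 3)) : (delta_mx 0 i : 'rV[R]_N) 0 (lshift #|A| m) = (i == m :> nat)%:R.
      by rewrite mxE eqxx /= eq_sym -val_eqE.
    rewrite /cu /cw !e -/(cu x) -/E -/r -/C0 -/C1 -/ch -/sh /=.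
    congr (nth 0 (shear_list _ _ _ _ _ _) _); first by rewrite /X; ring.
    by rewrite /Y /q; ring.
  - by rewrite cardA => ->; rewrite addn1.
  - exact: enum_val1.
  - by rewrite cardA => ->.
have resize n : N = n -> \det (\matrix_(i < N, k < N) G i k) = \det (\matrix_(i < n, k < n) G i k).
  by move=> <-.
have Ep : 0 < E by exact: expR_gt0.
have c2 : ch ^+ 2 = 1 + sh ^+ 2 by exact: cosh2.
have p0 : 0 < 1 + E by rewrite addr_gt0.
have p1 : 0 < 1 + (1 + sh ^+ 2) * E by rewrite -c2 ltr_pwDl // mulr_ge0 ?sqr_ge0 // ltW.
have Y1 : sh = 0 -> Y = 1.
  by move=> s0; rewrite /Y c2 s0 /r /logistic -/E; field; rewrite gt_eqF.
have key : 0 < sh -> C1 * Y - X * q = C1.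
  move=> s0; rewrite /X /Y /q c2 /C1 /coth -/ch -/sh /r /logistic -/E.
  by field; rewrite !gt_eqF.
have nb0 : b0 = false \/ b0 = true /\ 0 < C0.
  case: (boolP b0) => h; [right|by left]; split=> //; apply: coth_gt0; by rewrite cs_gt0.
have nb1 : b1 = false /\ sh = 0 \/ b1 = true /\ 0 < C1 /\ 0 < sh.
  case: (boolP b1) => h; [right|left]; split=> //.
    by split; [apply: coth_gt0|apply: sinh_gt0; rewrite divr_gt0 //]; rewrite cs_gt0.
  by rewrite /sh cs_out // mul0r /sinh oppr0 subrr mul0r.
have eN : N = (2 + (b0 + b1))%N by rewrite cardA.
rewrite -/C0 -/C1.
case: nb0 => [e0|[e0 k0]]; case: nb1 => [[e1 /Y1 s0]|[e1 [k1 /key s0]]]; rewrite e0 e1 in eN *.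
- rewrite (resize 2%N eN) det_fun2 /G e0 e1 /= s0 mulr1 -[RHS]normr1; congr `|_|; ring.
- rewrite (resize 3%N eN) det_fun3 /G e0 e1 /= mul1r -[RHS]gtr0_norm //; congr `|_|.
  by rewrite -[RHS]s0; ring.
- rewrite (resize 3%N eN) det_fun3 /G e0 e1 /= s0 mulr1 -[RHS]gtr0_norm // -[in RHS]normrN.
  by congr `|_|; ring.
- rewrite (resize 4%N eN) det_fun4 !big_ord_recl big_ord0.
  rewrite !(det_fun3 (fun a b => G a.+1 (bump _ b))) /G e0 e1 /=.
  have -> : C0 * C1 = `|- (C0 * (C1 * Y - X * q))| by rewrite s0 normrN gtr0_norm // mulr_gt0.
  congr `|_|.
  by rewrite /bump /=; ring.
Qed.

Lemma derive_strap (s : R) : 0 < s -> derive1 (fun l : R => 2 * ln (sinh (l / 2))) s = coth s.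
Proof. by move=> /drv_ln_sinh[d e]; rewrite derive1E. Qed.

Lemma jacobian_neq0 x : dom x ->
  (if b0 then coth (cs (ord5 0) x) else 1) * (if b1 then coth (cs (ord5 1) x) else 1) != 0.
Proof.
by move=> dx; apply: mulf_neq0; case: ifP => // h; rewrite gt_eqF ?coth_gt0 ?cs_gt0.
Qed.

(** In these coordinates the volume form is du dw. *)
Lemma wp_density1 x : dom x -> wp_density Phi x = 1.
Proof.
move=> dx; rewrite /wp_density det_shears //.
rewrite (eq_bigr (fun j => coth (cs j x))); last first.
  by move=> j jA; rewrite strap_Phi // derive_strap ?cs_gt0 // gtr0_norm // coth_gt0 ?cs_gt0.
rewrite -big_enum enumA -[RHS](divff (jacobian_neq0 dx)); congr (_ / _).
by case: ifP => _; case: ifP => _; rewrite ?big_cons big_nil /= ?mulr1 ?mul1r.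
Qed.

Lemma adapted_pentagons : adapted_coordinates dom Phi.
Proof.
split.
- exact: open_dom.
- move=> x dx; split; first exact: flippered_chart.
    by move=> j; rewrite strap_Phi // cs_gt0.
  by move=> k; rewrite strap_Phi // cs_enum_val.
- exact: coordinates_surj.
- exact: coordinates_inj.
- move=> x dx; have [d _] := is_diff_shears dx; split=> //.
  by rewrite unitmxE unitfE -normr_eq0 det_shears // jacobian_neq0.
Qed.

End coordinates.

(** * The dilogarithm *)

Section dilogarithm.
Context {R : realType}.
Implicit Types (x t K : R) (c : nat -> R).

Lemma sum_succ_expr K n : (1 - K) ^+ 2 * (\sum_(0 <= i < n) i.+1%:R * K ^+ i) =
  1 - n.+1%:R * K ^+ n + n%:R * K ^+ n.+1.
Proof.
elim: n => [|n IH]; first by rewrite big_nil !expr0 mul0r; ring.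
rewrite big_nat_recr //= mulrDr IH !exprS -!natr1; ring.
Qed.

(** Comparison with the series of i.+1%:R * K ^+ i, whose partial sums are
    known in closed form. *)
Lemma cvg_pseries_le c K : 0 <= K < 1 -> (forall i, 0 <= c i <= i.+1%:R) -> cvgn (pseries c K).
Proof.
move=> /andP[K0 K1] hc; have p i : 0 <= i.+1%:R * K ^+ i by rewrite mulr_ge0 ?exprn_ge0.
apply: (@series_le_cvg _ _ (fun i => i.+1%:R * K ^+ i)) => //.
- by move=> i; rewrite mulr_ge0 ?exprn_ge0 //; case/andP: (hc i).
- by move=> i; rewrite ler_wpM2r ?exprn_ge0 //; case/andP: (hc i).
apply: nondecreasing_is_cvgn.
  by apply/nondecreasing_seqP => n; rewrite seriesSr lerDl.
exists (((1 - K) ^+ 2)^-1) => _ [n _ <-].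
have q : 0 < (1 - K) ^+ 2 by rewrite exprn_gt0 // subr_gt0.
rewrite -(ler_pM2l q) divff ?gt_eqF // sum_succ_expr exprS.
have k0 : 0 <= K ^+ n by rewrite exprn_ge0.
have : n%:R * (K * K ^+ n) <= n%:R * K ^+ n.
  by rewrite ler_wpM2l // -[leRHS]mul1r ler_wpM2r // ltW.
by rewrite -natr1; lra.
Qed.

(** With the convention that the inverse of 0 is 0, these are all the
    coefficients of the dilogarithm as a power series. *)
Definition invsq (i : nat) : R := (i%:R ^+ 2)^-1.
Definition inv1 (i : nat) : R := i.+1%:R^-1.

Lemma Li2_pseries x : Li2 x = limn (pseries invsq x).
Proof.
have e : series (fun k => x ^+ k.+1 / k.+1%:R ^+ 2) = (fun n => pseries invsq x n.+1).
  apply/funext => n; rewrite /pseries /series /= big_nat_recl //= /invsq expr0n invr0 mul0r add0r.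
  by apply: eq_bigr => i _; rewrite mulrC.
rewrite /Li2 e /lim_in; congr get; apply/funext => l; apply/propext.
by have := cvg_shiftS (pseries invsq x) (nbhs l) => ->.
Qed.

Lemma pseries_diffs_invsq : pseries_diffs invsq = inv1.
Proof.
apply/funext => i; rewrite /pseries_diffs /invsq /inv1.
have : i.+1%:R != 0 :> R by rewrite pnatr_eq0.
by move: i.+1%:R => y y0; field.
Qed.

Lemma inv1_le i : 0 <= inv1 i <= 1.
Proof. by rewrite /inv1 invr_ge0 ler0n invf_le1 ?ltr0n // ler1n. Qed.

Lemma le1S i : 1 <= i.+1%:R :> R.
Proof. by rewrite ler1n. Qed.

(** The derivative of the dilogarithm as a power series, which has the value 1
    at 0 where - ln (1 - x) / x is not defined. *)
Definition Li2' x : R := limn (pseries inv1 x).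

Lemma is_derive_Li2 x : `|x| < 1 -> is_derive x 1 Li2 (Li2' x).
Proof.
move=> x1; pose K := (1 + `|x|) / 2.
have K0 : 0 <= K < 1 by rewrite /K; have := normr_ge0 x; lra.
have xK : `|x| < `|K| by rewrite [ltRHS]ger0_norm; rewrite /K; have := normr_ge0 x; lra.
have -> : Li2 = (fun x => limn (pseries invsq x)) by apply/funext => y; exact: Li2_pseries.
rewrite /Li2' -pseries_diffs_invsq.
apply: pseries_snd_diffs xK; rewrite ?pseries_diffs_invsq; apply: cvg_pseries_le => // i.
- case: i => [|i]; first by rewrite /invsq expr0n invr0 lexx ler0n.
  rewrite /invsq invr_ge0 exprn_ge0 //= (le_trans _ (le1S _)) // invf_le1 ?exprn_gt0 //.
  by rewrite exprn_ege1 // ler1n.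
- by case/andP: (inv1_le i) => -> /= h; exact: le_trans h (le1S _).
- rewrite /pseries_diffs mulr_ge0 //=; last by case/andP: (inv1_le i.+1).
  by rewrite ler_piMr ?ler0n //; case/andP: (inv1_le i.+1).
Qed.

Lemma MVT_const (f : R -> R) a b : a <= b -> {within `[a, b], continuous f} ->
  (forall x, a < x < b -> is_derive x 1 f 0) -> f a = f b.
Proof.
rewrite le_eqVlt => /predU1P[->//|ab] cf df.
have df' x : x \in `]a, b[%R -> is_derive x 1 f 0 by rewrite in_itv /=; exact: df.
have [c _ /eqP] := @MVT _ f (fun=> 0) a b ab df' cf.
by rewrite mul0r subr_eq0 eq_sym => /eqP.
Qed.

(** Both x * Li2' x and - ln (1 - x) have derivative (1 - x)^-1 and vanish at
    0. *)
Lemma Li2'_ln x : 0 <= x < 1 -> x * Li2' x = - ln (1 - x).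
Proof.
move=> /andP[x0 x1]; pose c (i : nat) : R := i%:R^-1.
have c1 i : 0 <= c i <= 1.
  case: i => [|i]; first by rewrite /c invr0 lexx ler01.
  exact: inv1_le.
have dc : pseries_diffs c = fun=> 1.
  by apply/funext => i; rewrite /pseries_diffs /c divff // pnatr_eq0.
have dh t : 0 <= t < 1 -> is_derive t 1 (fun x => limn (pseries c x)) (1 - t)^-1.
  move=> t01; pose K := (1 + t) / 2.
  have K0 : 0 <= K < 1 by rewrite /K; lra.
  have tK : `|t| < `|K| by rewrite !ger0_norm /K; lra.
  have -> : (1 - t)^-1 = limn (pseries (pseries_diffs c) t).
    rewrite dc; apply/esym/cvg_lim => //.
    have -> : pseries (fun=> 1) t = series (geometric 1 t).
      by apply/funext => n; rewrite /pseries /series /=; apply: eq_bigr => i _.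
    by rewrite -[X in _ --> X]mul1r; apply: cvg_geometric_series; rewrite ger0_norm; lra.
  apply: pseries_snd_diffs tK; rewrite ?dc; apply: cvg_pseries_le => // i.
  - by case/andP: (c1 i) => -> /= h; exact: le_trans h (le1S _).
  - by rewrite ler01 le1S.
  - by rewrite /pseries_diffs mulr1 lexx ler0n.
have hE t : 0 <= t < 1 -> limn (pseries c t) = t * Li2' t.
  move=> t01; have cv : cvgn (pseries inv1 t).
    by apply: cvg_pseries_le => // i; case/andP: (inv1_le i) => -> /= h; exact: le_trans h (le1S _).
  apply/cvg_lim => //; rewrite -cvg_shiftS.
  have -> : (fun n => pseries c t n.+1) = (fun n => t * pseries inv1 t n).
    apply/funext => n; rewrite /pseries /series /= big_nat_recl //= /c invr0 mul0r add0r mulr_sumr.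
    by apply: eq_bigr => i _; rewrite exprS /inv1; ring.
  exact: cvgMl_tmp cv.
pose f t := limn (pseries c t) + ln (1 - t).
have df t : 0 <= t < 1 -> is_derive t 1 f 0.
  move=> t01; have p : 0 < 1 - t by lra.
  apply: drv_eq (drvD (dh t t01) (drv_ln (drvD (drv_cst t 1) (drvN (drv_id t))) p)) _.
  by field; rewrite gt_eqF.
have : f 0 = f x.
  apply: MVT_const => //.
    apply: derivable_within_continuous => t; rewrite in_itv /= => /andP[t0 tx].
    by have [] := df t; first by rewrite t0 (le_lt_trans tx).
  by move=> t /andP[t0 tx]; apply: df; rewrite ltW // (lt_trans tx).
rewrite /f !hE ?lexx ?ltr01 ?x0 // mul0r subr0 ln1 addr0 => e.
by apply/eqP; rewrite -addr_eq0 -e.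
Qed.

Lemma Li2_0 : Li2 0 = 0 :> R.
Proof.
rewrite /Li2; apply/cvg_lim => //.
have -> : series (fun k => 0 ^+ k.+1 / k.+1%:R ^+ 2) = (fun=> 0 : R).
  by apply/funext => n; rewrite /series /= big1 // => i _; rewrite exprS !mul0r.
exact: cvg_cst.
Qed.

Lemma cvg_invsq x : 0 <= x <= 1 -> cvgn (pseries invsq x).
Proof.
move=> /andP[x0 x1]; have p i : 0 <= invsq i by rewrite /invsq invr_ge0 exprn_ge0.
apply: (@series_le_cvg _ _ invsq) => //.
- by move=> i; rewrite mulr_ge0 ?exprn_ge0.
- by move=> i; rewrite ler_piMr // exprn_ile1.
apply: nondecreasing_is_cvgn.
  by apply/nondecreasing_seqP => n; rewrite seriesSr lerDl.
exists 2 => _ [n _ <-].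
have h m : series invsq m.+2 <= 2 - m.+1%:R^-1.
  elim: m => [|m IH].
    by rewrite !seriesSr [series _ 0]big_geq // /invsq expr0n /= invr0 expr1n invr1; lra.
  rewrite seriesSr; apply: le_trans (lerD IH (lexx _)) _; rewrite /invsq.
  have m0 : 0 < m.+1%:R :> R by rewrite ltr0n.
  have m2 : m.+2%:R = m.+1%:R + 1 :> R by rewrite natr1.
  have : (m.+2%:R ^+ 2)^-1 <= m.+1%:R^-1 - m.+2%:R^-1 :> R.
    rewrite m2; move: (m.+1%:R) m0 => y y0.
    rewrite -subr_ge0 (_ : _ - _ = (y * (y + 1) ^+ 2)^-1); last by field; rewrite !gt_eqF //; lra.
    by rewrite invr_ge0 mulr_ge0 ?exprn_ge0 ?ltW ?addr_gt0.
  by move: (_ ^+ 2)^-1 (m.+1%:R^-1) (m.+2%:R^-1) => u v w; lra.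
apply: le_trans (_ : series invsq n.+2 <= _).
  by rewrite !seriesSr -addrA lerDl addr_ge0.
by apply: le_trans (h n) _; rewrite lerBlDr lerDl invr_ge0.
Qed.

Lemma pseries_le_Li2 x n : 0 <= x <= 1 -> pseries invsq x n <= Li2 x.
Proof.
move=> x01; rewrite Li2_pseries; apply: nondecreasing_cvgn_le (cvg_invsq x01) n.
apply/nondecreasing_seqP => m; rewrite /pseries seriesSr lerDl mulr_ge0 ?exprn_ge0 //.
  by rewrite /invsq invr_ge0 exprn_ge0.
by case/andP: x01.
Qed.

Lemma Li2_le1 x : 0 <= x <= 1 -> Li2 x <= Li2 1.
Proof.
move=> x01; have i1 : 0 <= (1 : R) <= 1 by rewrite lexx ler01.
rewrite !Li2_pseries; apply: ler_lim; [exact: cvg_invsq|exact: cvg_invsq|].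
near=> n; rewrite /pseries /series /=; apply: ler_sum => i _.
case/andP: x01 => x0 x1.
by rewrite ler_wpM2l ?expr1n ?exprn_ile1 // /invsq invr_ge0 exprn_ge0.
Unshelve. all: by end_near. Qed.

(** Continuity at the boundary of the disk of convergence: the values are below
    Li2 1 and above the partial sums, which are continuous. *)
Lemma Li2_cvg1 (T : Type) (F : set_system T) (FF : Filter F) (f : T -> R) :
  f t @[t --> F] --> (1 : R) -> (\forall t \near F, 0 <= f t <= 1) ->
  Li2 (f t) @[t --> F] --> (Li2 1 : R).
Proof.
move=> f1 f01; apply/cvgrPdist_lt => e e0.
have i1 : 0 <= (1 : R) <= 1 by rewrite lexx ler01.
have e2 : 0 < e / 2 by rewrite divr_gt0.
have [n hn] : exists n, Li2 1 - e / 2 < pseries invsq 1 n :> R.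
  have := cvg_invsq i1; rewrite -/(cvgn _) => cv.
  have : pseries invsq 1 n @[n --> \oo] --> (Li2 1 : R) by rewrite Li2_pseries.
  move=> /cvgr_gt /(_ (Li2 1 - e / 2)) []; first by lra.
  by move=> N _ /(_ N (leqnn N)) h; exists N.
have c : pseries invsq (f t) n @[t --> F] --> pseries invsq 1 n.
  have : {for 1, continuous (fun x : R => pseries invsq x n)}.
    rewrite /pseries /series /=; apply: continuous_big => [y|i _]; first exact: add_continuous.
    move=> y; apply: cvgM; [exact: cvg_cst|exact: exprn_continuous].
  by move=> cc; exact: cvg_comp f1 cc.
have : \forall t \near F, pseries invsq 1 n - e / 2 < pseries invsq (f t) n.
  by apply: (cvgr_gt _ c); lra.
move=> h; near=> t.
have t01 : 0 <= f t <= 1 by near: t.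
have ht : pseries invsq 1 n - e / 2 < pseries invsq (f t) n by near: t.
have := pseries_le_Li2 n t01; have := Li2_le1 t01.
by move=> k1 k2; rewrite ger0_norm; lra.
Unshelve. all: by end_near. Qed.

Lemma drv_Li2 x (f : R -> R) a : is_derive x 1 f a -> 0 <= f x < 1 ->
  is_derive x 1 (fun t => Li2 (f t)) (Li2' (f x) * a).
Proof.
move=> fa /andP[f0 f1]; have h : is_derive (f x) 1 Li2 (Li2' (f x)).
  by apply: is_derive_Li2; rewrite ger0_norm.
exact: (drv_comp h fa).
Qed.

Lemma drv_div x (f g : R -> R) a b : is_derive x 1 f a -> is_derive x 1 g b -> g x != 0 ->
  is_derive x 1 (fun t => f t / g t) ((a * g x - f x * b) / g x ^+ 2).
Proof.
move=> fa gb g0; apply: drv_eq (drvM fa (drvV g0 gb)) _.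
by field.
Qed.

(** The five-term relation. Both sides agree for A = 0, and they have the same
    derivative in A because all the logarithms - ln (1 - x) split into those
    of 1 + A, 1 + B and 1 + A + B. *)
Lemma five_term (A B : R) : 0 <= A -> 0 <= B ->
  Li2 (A / (1 + A)) + Li2 (B / (1 + B)) - Li2 (A * B / ((1 + A) * (1 + B))) =
  Li2 (A / (1 + A + B)) + Li2 (B / (1 + A + B)) +
  (ln (1 + A + B) - ln (1 + A)) * (ln (1 + A + B) - ln (1 + B)).
Proof.
move=> A0; rewrite le_eqVlt => /predU1P[<-|B0].
  by rewrite !addr0 mulr0 !mul0r Li2_0 ln1; ring.
pose F t := Li2 (t / (1 + t)) + Li2 (B / (1 + B)) - Li2 (t * B / ((1 + t) * (1 + B)))
  - Li2 (t / (1 + t + B)) - Li2 (B / (1 + t + B))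
  - (ln (1 + t + B) - ln (1 + t)) * (ln (1 + t + B) - ln (1 + B)).
have dF t : 0 <= t -> exists2 d, is_derive t 1 F d & (0 < t -> d = 0).
  move=> t0; have a0 : 0 < 1 + t by lra.
  have b0 : 0 < 1 + B by lra.
  have s0 : 0 < 1 + t + B by lra.
  have ab0 : 0 < (1 + t) * (1 + B) by exact: mulr_gt0.
  have da := drvD (drv_cst t 1) (drv_id t).
  have ds := drvD da (drv_cst t B).
  have dab := drvM da (drv_cst t (1 + B)).
  have x1 : 0 <= t / (1 + t) < 1.
    by rewrite divr_ge0 ?ltr_pdivrMr ?mul1r //=; lra.
  have x3 : 0 <= t * B / ((1 + t) * (1 + B)) < 1.
    rewrite divr_ge0 ?ltr_pdivrMr ?mul1r ?mulr_ge0 //=; [|lra..].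
    by rewrite -subr_gt0 (_ : _ - _ = 1 + t + B) //; ring.
  have x4 : 0 <= t / (1 + t + B) < 1.
    by rewrite divr_ge0 ?ltr_pdivrMr ?mul1r //=; lra.
  have x5 : 0 <= B / (1 + t + B) < 1.
    by rewrite divr_ge0 ?ltr_pdivrMr ?mul1r //=; lra.
  have d1 := drv_Li2 (drv_div (drv_id t) da (lt0r_neq0 a0)) x1.
  have d3 := drv_Li2 (drv_div (drvM (drv_id t) (drv_cst t B)) dab (lt0r_neq0 ab0)) x3.
  have d4 := drv_Li2 (drv_div (drv_id t) ds (lt0r_neq0 s0)) x4.
  have d5 := drv_Li2 (drv_div (drv_cst t B) ds (lt0r_neq0 s0)) x5.
  have dla := drv_ln da a0; have dls := drv_ln ds s0.
  have dl := drvM (drvD dls (drvN dla)) (drvD dls (drvN (drv_cst t (ln (1 + B))))).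
  have := drvD (drvD (drvD (drvD (drvD d1 (drv_cst t (Li2 (B / (1 + B))))) (drvN d3)) (drvN d4)) (drvN d5)) (drvN dl).
  set d := (X in is_derive _ _ _ X) => dd; exists d; first exact: dd.
  move=> tp; rewrite /d.
  have e1 : Li2' (t / (1 + t)) = (1 + t) / t * ln (1 + t).
    have := Li2'_ln x1; have -> : 1 - t / (1 + t) = (1 + t)^-1 by field; rewrite gt_eqF.
    rewrite lnV ?posrE // opprK => <-; field; rewrite !gt_eqF //.
  have e3 : Li2' (t * B / ((1 + t) * (1 + B))) =
      (1 + t) * (1 + B) / (t * B) * (ln (1 + t) + ln (1 + B) - ln (1 + t + B)).
    have := Li2'_ln x3.
    have -> : 1 - t * B / ((1 + t) * (1 + B)) = (1 + t + B) / ((1 + t) * (1 + B)).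
      by field; rewrite !gt_eqF.
    rewrite ln_div ?posrE // lnM ?posrE // opprB => <-; field; rewrite !gt_eqF //.
  have e4 : Li2' (t / (1 + t + B)) = (1 + t + B) / t * (ln (1 + t + B) - ln (1 + B)).
    have := Li2'_ln x4.
    have -> : 1 - t / (1 + t + B) = (1 + B) / (1 + t + B) by field; rewrite !gt_eqF.
    rewrite ln_div ?posrE // opprB => <-; field; rewrite !gt_eqF //.
  have e5 : Li2' (B / (1 + t + B)) = (1 + t + B) / B * (ln (1 + t + B) - ln (1 + t)).
    have := Li2'_ln x5.
    have -> : 1 - B / (1 + t + B) = (1 + t) / (1 + t + B) by field; rewrite !gt_eqF.
    rewrite ln_div ?posrE // opprB => <-; field; rewrite !gt_eqF //.
  rewrite e1 e3 e4 e5; move: (ln (1 + t)) (ln (1 + B)) (ln (1 + t + B)) => la lb ls.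
  by field; rewrite !gt_eqF.
have : F 0 = F A.
  apply: MVT_const => //.
    apply: derivable_within_continuous => t; rewrite in_itv /= => /andP[t0 tA].
    by have [d [? _] _] := dF t t0.
  move=> t /andP[t0 tA]; have [d dd /(_ t0) d0] := dF t (ltW t0).
  by rewrite d0 in dd.
rewrite /F !mul0r !addr0 Li2_0 ln1.
move: (Li2 (A / _)) (Li2 (A / _)) (Li2 (B / (1 + A + B))) (Li2 (B / (1 + B))) (Li2 (A * B / _)).
by move: (ln (1 + A)) (ln (1 + B)) (ln (1 + A + B)) => x y z a b c d e h; lra.
Qed.

(** The two kinds of functions from which the primitive is assembled have as
    derivatives logarithms of linear functions over z. Multiplying the derivative
    by z makes the statement hold at z = 0 too. *)
Lemma drv_Li2_scale (k z : R) : 0 <= k * z < 1 ->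
  exists2 d, is_derive z 1 (fun t => Li2 (k * t)) d & z * d = - ln (1 - k * z).
Proof.
move=> kz; exists (Li2' (k * z) * k).
  by apply: drv_eq (drv_Li2 (drv_scale k (drv_id z)) kz) _; rewrite mulr1.
by rewrite -Li2'_ln //; ring.
Qed.

(** By Landen's identity the function is t |-> - Li2 (- (k * t)), written with
    arguments between 0 and 1. *)
Lemma drv_Li2_neg (k z : R) : 0 <= k -> 0 <= z ->
  exists2 d, is_derive z 1 (fun t => Li2 (k * t / (1 + k * t)) + ln (1 + k * t) ^+ 2 / 2) d &
    z * d = ln (1 + k * z).
Proof.
move=> k0 z0; have kz := mulr_ge0 k0 z0; have p : 0 < 1 + k * z by lra.
have w : 0 <= k * z / (1 + k * z) < 1.
  by rewrite divr_ge0 ?ltr_pdivrMr ?mul1r //=; lra.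
have dk := drv_scale k (drv_id z); have d1 := drvD (drv_cst z 1) dk.
have dL := drv_Li2 (drv_div dk d1 (lt0r_neq0 p)) w.
have dl := drv_ln d1 p.
have := drvD dL (drvM (drvM dl dl) (drv_cst z 2^-1)).
set d := (X in is_derive _ _ _ X) => dd; exists d; first exact: dd.
have := Li2'_ln w; have -> : 1 - k * z / (1 + k * z) = (1 + k * z)^-1 by field; rewrite gt_eqF.
rewrite lnV ?posrE // opprK => e.
have -> : z * d = k * z / (1 + k * z) * Li2' (k * z / (1 + k * z)) * (1 + k * z)^-1 +
   k * z / (1 + k * z) * ln (1 + k * z) by rewrite /d; field; rewrite gt_eqF.
by rewrite e; field; rewrite gt_eqF.
Qed.

Lemma drv_continuous (f : R -> R) x a : is_derive x 1 f a -> {for x, continuous f}.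
Proof. by move=> [d _]; apply: differentiable_continuous; exact/derivable1_diffP. Qed.

End dilogarithm.

(** * Integration *)

Section integrals.
Context {R : realType}.
Local Notation mu := (@lebesgue_measure R).
Implicit Types (f F : R -> R).

Lemma cvg_cont (T : Type) (Fl : set_system T) (h : T -> R) (l : R) (f : R -> R) :
  h t @[t --> Fl] --> l -> {for l, continuous f} -> f (h t) @[t --> Fl] --> f l.
Proof. by move=> c cf; exact: (cvg_comp h f c cf). Qed.

(** The fundamental theorem of calculus on a half-line, applied on both sides
    of 0. *)
Lemma integral_line f F (l m : R) : (forall x, 0 <= f x) -> continuous f ->
  (forall x : R, is_derive x 1 F (f x)) -> F x @[x --> -oo] --> l -> F x @[x --> +oo] --> m ->
  (\int[mu]_x (f x)%:E = (m - l)%:E)%E.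
Proof.
move=> f0 cf dF Fl Fm.
have cF : continuous F by move=> x; exact: drv_continuous (dF x).
have mf : measurable_fun [set: R] f by exact: continuous_measurable_fun.
have mpos : measurable [set x : R | 0 <= x]%R by rewrite -set_itvcy.
have half (g G : R -> R) (k : R) : (forall x, 0 <= g x) -> continuous g ->
    (forall x : R, is_derive x 1 G (g x)) -> G x @[x --> +oo] --> k ->
    (\int[mu]_(x in `[0%R, +oo[) (g x)%:E = (k - G 0)%:E)%E.
  move=> g0 cg dG Gk; rewrite (@ge0_continuous_FTC2y _ g G 0 k) ?EFinB //.
  - exact: continuous_subspaceT.
  - by apply: cvg_at_right_filter; exact: (drv_continuous (dG 0)).
  - by move=> x _; rewrite derive1E; have [_ ->] := dG x.
rewrite -(setUv [set x : R | 0 <= x]%R) ge0_integral_setU //= ; last 4 first.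
  exact: measurableC.
  by apply/measurable_EFinP; rewrite setUv.
  by move=> x _; rewrite lee_fin.
  exact/disj_setPCl.
rewrite -set_itvcy // setCitvr.
rewrite integral_itv_bndo_bndc; last exact/measurable_EFinP/measurable_funTS.
rewrite -{2}oppr0 ge0_integration_by_substitutionNy //; last exact: continuous_subspaceT.
have cfN : continuous (f \o -%R).
  by move=> x; apply: continuous_comp; [exact: opp_continuous|exact: cf].
have dFN (x : R) : is_derive x 1 (fun t => - F (- t)) ((f \o -%R) x).
  apply: drv_eq (drvN (@drv_comp _ x F (fun t => - t) _ _ (dF (- x)) (drvN (drv_id x)))) _.
  by rewrite /= mulrN1 opprK.
have FN : - F (- x) @[x --> +oo] --> (- l : R).
  by apply: cvgN; exact: (proj1 (cvgNy_compNP F _) Fl).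
rewrite (half f F m) // (half (f \o -%R) (fun t => - F (- t)) (- l)) //.
  by rewrite oppr0 -EFinD; congr (_%:E); ring.
by move=> x; exact: f0.
Qed.

(** Partial fractions. *)
Lemma integral_inner (L g : R) : 0 < g -> g < L ->
  (\int[mu]_w (expR w / ((L + expR w) * (g + expR w)))%:E = ((ln L - ln g) / (L - g))%:E)%E.
Proof.
move=> g0 gL; have L0 : 0 < L by exact: lt_trans gL.
have p (x w : R) : 0 < x -> 0 < x + expR w by move=> x0; rewrite addr_gt0 ?expR_gt0.
have q : 0 < L - g by rewrite subr_gt0.
pose F w := (ln (g + expR w) - ln (L + expR w)) / (L - g).
have dx (x w : R) : is_derive w 1 (fun t => x + expR t) (expR w).
  by apply: drv_eq (drvD (drv_cst w x) (drv_exp (drv_id w))) _; rewrite mulr1 add0r.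
have dF (w : R) : is_derive w 1 F (expR w / ((L + expR w) * (g + expR w))).
  apply: drv_eq (drvM (drvD (drv_ln (dx g w) (p _ _ g0)) (drvN (drv_ln (dx L w) (p _ _ L0))))
    (drv_cst w (L - g)^-1)) _.
  by field; rewrite !gt_eqF ?p.
have e0 : (expR w : R) @[w --> -oo] --> (0 : R).
  by apply/cvgNy_compNP; exact: cvgr_expR.
have lnx (x : R) : 0 < x -> ln (x + expR w) @[w --> -oo] --> (ln x : R).
  move=> x0; have c : (x + expR w : R) @[w --> -oo] --> x.
    by rewrite -[X in _ --> X]addr0; apply: cvgD; [exact: cvg_cst|exact: e0].
  apply: (cvg_cont c); exact: continuous_ln.
have lny (x : R) : 0 < x -> ln (x + expR w) - w @[w --> +oo] --> (0 : R).
  move=> x0; have -> : (fun w => ln (x + expR w) - w) = (fun w => ln (1 + x * expR (- w))).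
    apply/funext => w; have -> : x + expR w = expR w * (1 + x * expR (- w)).
      by rewrite mulrDr mulr1 mulrCA -expRD subrr expR0 mulr1 addrC.
    by rewrite lnM ?posrE ?expR_gt0 ?addr_gt0 ?mulr_gt0 ?expR_gt0 // expRK addrC addKr.
  have c : (1 + x * expR (- w) : R) @[w --> +oo] --> (1 : R).
    rewrite -[X in _ --> X]addr0 -(mulr0 x); apply: cvgD; [exact: cvg_cst|].
    by apply: cvgM; [exact: cvg_cst|exact: cvgr_expR].
  by rewrite -(@ln1 R); apply: (cvg_cont c); exact: continuous_ln.
have -> : (ln L - ln g) / (L - g) = 0 - (ln g - ln L) / (L - g) by rewrite -mulrN1; ring.
apply: (@integral_line _ F) => //.
- by move=> w; rewrite divr_ge0 ?mulr_ge0 ?expR_ge0 // ltW // p.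
- move=> w; have h := drv_div (drv_exp (drv_id w)) (drvM (dx L w) (dx g w))
    (lt0r_neq0 (mulr_gt0 (p L w L0) (p g w g0))).
  exact: drv_continuous h.
- apply: cvgM; last exact: cvg_cst.
  by apply: cvgB; exact: lnx.
have -> : F = fun w => ((ln (g + expR w) - w) - (ln (L + expR w) - w)) / (L - g).
  by apply/funext => w; rewrite /F; congr (_ / _); ring.
rewrite -[X in _ --> X](mul0r (L - g)^-1); apply: cvgM; last exact: cvg_cst.
by rewrite -[X in _ --> X](subrr 0); apply: cvgB; exact: lny.
Qed.

Lemma measurable_inv_gt0 d (T : measurableType d) (f : T -> R) : (forall x, 0 < f x) ->
  measurable_fun setT f -> measurable_fun setT (fun x => (f x)^-1).
Proof.
move=> f0 mf; have -> : (fun x => (f x)^-1) = (fun x => expR (- ln (f x))).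
  by apply/funext => x; rewrite expRN lnK // posrE.
apply: measurableT_comp; first exact: measurable_expR.
apply: measurableT_comp; first exact: oppr_measurable.
by apply: measurableT_comp mf; exact: measurable_ln.
Qed.

Section outer.
Variables (A B : R).
Hypotheses (A0 : 0 <= A) (B0 : 0 <= B).
Local Notation a := (1 + A).
Local Notation b := (1 + B).
Local Notation s := (1 + A + B).

(** In the variable z = (a + s * expR u)^-1, the logarithm in the outer
    integral is a sum of four logarithms of linear functions of z. Up to the
    factor - s^-1 the primitive is the sum of Li2 (a * z), singular at the
    limit z = a^-1, and of dilogs z, which is differentiable there. *)
Definition dilogs (z : R) : R :=
  Li2 (A * B / b * z) +
  (Li2 (a * A / b * z / (1 + a * A / b * z)) + ln (1 + a * A / b * z) ^+ 2 / 2) +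
  (Li2 (B * z / (1 + B * z)) + ln (1 + B * z) ^+ 2 / 2).

Lemma drv_dilogs (z : R) : 0 <= z -> a * z <= 1 -> exists2 d, is_derive z 1 dilogs d &
  z * d = ln (1 + a * A / b * z) + ln (1 + B * z) - ln (1 - A * B / b * z).
Proof.
have hA := A0; have hB := B0; have b0 : 0 < b by lra.
move=> z0 az; have k : 0 <= A * B / b * z < 1.
  rewrite mulr_ge0 ?divr_ge0 ?mulr_ge0 //=; last lra.
  rewrite mulrAC ltr_pdivrMr // mul1r.
  have /ler_wpM2r h : A * z <= 1 by lra.
  by have := h _ B0; lra.
have [d1 D1 e1] := drv_Li2_scale k.
have [|d2 D2 e2] := @drv_Li2_neg _ (a * A / b) z _ z0.
  by rewrite divr_ge0 ?mulr_ge0 //; lra.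
have [d3 D3 e3] := drv_Li2_neg B0 z0.
by exists (d1 + d2 + d3); [exact: drvD (drvD D1 D2) D3|rewrite !mulrDr e1 e2 e3; ring].
Qed.

(** The integral over the second coordinate. *)
Definition outer (u : R) : R := logistic u *
  (let g := expR u * (1 + B * logistic u) in
  (ln (a + B * logistic u + g) - ln g) / (a + B * logistic u)).

Lemma outer_ge0 u : 0 <= outer u.
Proof.
have hA := A0; have hB := B0.
have t0 : 0 <= B * logistic u by rewrite mulr_ge0 // ltW // logistic_gt0.
have e0 : 0 < expR u * (1 + B * logistic u) by rewrite mulr_gt0 ?expR_gt0 //; lra.
rewrite mulr_ge0 ?(ltW (logistic_gt0 u)) // divr_ge0 //; last lra.
by rewrite subr_ge0 ler_ln ?posrE //; lra.
Qed.

(** The quotient of the arguments of the two logarithms of outer is (a + b *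
    E) * (1 + E) / (E * (1 + b * E)). *)
Lemma outer_logs u : let E := expR u in outer u =
  E / (a + s * E) * (ln (a + b * E) + ln (1 + E) - u - ln (1 + b * E)).
Proof.
move=> E; have hA := A0; have hB := B0; have E0 : 0 < E by exact: expR_gt0.
have bE : 0 <= B * E by rewrite mulr_ge0 // ltW.
have aE : 0 <= A * E by rewrite mulr_ge0 // ltW.
have p1 : 0 < 1 + E by lra.
have p2 : 0 < 1 + b * E by lra.
have p3 : 0 < a + b * E by lra.
have p4 : 0 < a + s * E by lra.
have p5 : 0 < E * (1 + b * E) / (1 + E) by rewrite divr_gt0 // mulr_gt0.
rewrite /outer /= /logistic -/E.
have -> : E * (1 + B * (E / (1 + E))) = E * (1 + b * E) / (1 + E) by field; rewrite gt_eqF.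
have -> : a + B * (E / (1 + E)) + E * (1 + b * E) / (1 + E) = a + b * E by field; rewrite gt_eqF.
have -> : a + B * (E / (1 + E)) = (a + s * E) / (1 + E) by field; rewrite gt_eqF.
rewrite ln_div ?posrE ?mulr_gt0 // lnM ?posrE // /E expRK -/E.
by field; rewrite !gt_eqF.
Qed.

Lemma continuous_outer : continuous outer.
Proof.
move=> u; have hA := A0; have hB := B0; have E0 : 0 < expR u :> R by exact: expR_gt0.
have bE : 0 <= B * expR u by rewrite mulr_ge0 // ltW.
have aE : 0 <= A * expR u by rewrite mulr_ge0 // ltW.
have -> : outer = (fun u => expR u / (a + s * expR u) *
   (ln (a + b * expR u) + ln (1 + expR u) - u - ln (1 + b * expR u))).
  by apply/funext => v; rewrite outer_logs.
have dE := drv_exp (drv_id u).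
have aff (x y : R) : is_derive u 1 (fun t => x + y * expR t) (0 + y * (expR u * 1)).
  exact: drvD (drv_cst u x) (drv_scale y dE).
have q1 : 0 < a + b * expR u by lra.
have q2 : 0 < 1 + expR u by lra.
have q3 : 0 < 1 + b * expR u by lra.
have q4 : a + s * expR u != 0 by rewrite gt_eqF //; lra.
exact: drv_continuous (drvM (drv_div dE (aff a s) q4)
  (drvD (drvD (drvD (drv_ln (aff a b) q1) (drv_ln (drvD (drv_cst u 1) dE) q2)) (drvN (drv_id u)))
    (drvN (drv_ln (aff 1 b) q3)))).
Qed.

Definition zof (u : R) : R := (a + s * expR u)^-1.
Definition prim (u : R) : R := - ((Li2 (a * zof u) + dilogs (zof u)) / s).

Lemma zof_itv u : 0 < zof u /\ a * zof u < 1.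
Proof.
have hA := A0; have hB := B0; have E0 : 0 < expR u :> R by exact: expR_gt0.
have sE : 0 < s * expR u by rewrite mulr_gt0 //; lra.
have p : 0 < a + s * expR u by lra.
by rewrite /zof invr_gt0 p ltr_pdivrMr // mul1r; split=> //; lra.
Qed.

Lemma drv_prim (u : R) : is_derive u 1 prim (outer u).
Proof.
have hA := A0; have hB := B0; have [z0 az] := zof_itv u.
have E0 : 0 < expR u :> R by exact: expR_gt0.
have [d1 D1 e1] : exists2 d, is_derive (zof u) 1 (fun t => Li2 (a * t)) d &
    zof u * d = - ln (1 - a * zof u).
  by apply: drv_Li2_scale; rewrite az mulr_ge0 ?ltW //; lra.
have [d2 D2 e2] := drv_dilogs (ltW z0) (ltW az).
have sE : 0 < s * expR u by rewrite mulr_gt0 //; lra.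
have p : 0 < a + s * expR u by lra.
have dz : is_derive u 1 zof (- (s * expR u) * zof u ^+ 2).
  have h := drvD (drv_cst u a) (drv_scale s (drv_exp (drv_id u))).
  apply: drv_eq (@drvV _ u (fun t => a + s * expR t) _ (lt0r_neq0 p) h) _.
  by rewrite /zof; field; rewrite gt_eqF.
have dp := drvN (drvM (@drv_comp _ u (fun z => Li2 (a * z) + dilogs z) zof _ _ (drvD D1 D2) dz)
  (drv_cst u s^-1)).
apply: drv_eq dp _; rewrite outer_logs -/(zof u).
have bE : 0 <= B * expR u by rewrite mulr_ge0 // ltW.
have aE : 0 <= A * expR u by rewrite mulr_ge0 // ltW.
have q1 : 0 < a + b * expR u by lra.
have q2 : 0 < 1 + expR u by lra.
have q3 : 0 < 1 + b * expR u by lra.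
have b0 : 0 < b by lra.
have s0 : 0 < s by lra.
have sz : 0 < s * zof u by rewrite mulr_gt0.
have f1 : 1 - a * zof u = s * zof u * expR u by rewrite /zof; field; rewrite gt_eqF.
have f2 : 1 + B * zof u = s * zof u * (1 + expR u) by rewrite /zof; field; rewrite gt_eqF.
have f3 : 1 + a * A / b * zof u = s * zof u * (a + b * expR u) / b.
  by rewrite /zof; field; rewrite !gt_eqF.
have f4 : 1 - A * B / b * zof u = s * zof u * (1 + b * expR u) / b.
  by rewrite /zof; field; rewrite !gt_eqF.
have : zof u * (d1 + d2) = ln (a + b * expR u) + ln (1 + expR u) - u - ln (1 + b * expR u).
  rewrite mulrDr e1 e2 f1 f2 f3 f4 !ln_div ?posrE ?mulr_gt0 // !(lnM sz) ?posrE ?expR_gt0 // expRK.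
  by ring.
move=> <-; rewrite -/(zof u); field; rewrite gt_eqF //.
Qed.

Lemma dilogs0 : dilogs 0 = 0.
Proof. by rewrite /dilogs !mulr0 !mul0r Li2_0 addr0 ln1 expr0n /= mul0r !addr0. Qed.

Lemma cvg_prim_pinfty : prim u @[u --> +oo] --> (0 : R).
Proof.
have hA := A0; have hB := B0; have s0 : 0 < s by lra.
have zc : zof u @[u --> +oo] --> (0 : R).
  have -> : zof = fun u => expR (- u) / (a * expR (- u) + s).
    apply/funext => u; rewrite /zof expRN; have E0 : 0 < expR u :> R by exact: expR_gt0.
    have sE : 0 < s * expR u by rewrite mulr_gt0.
    by field; rewrite !gt_eqF //; lra.
  have -> : 0 = 0 / (a * 0 + s) :> R by rewrite mul0r.
  apply: cvgM; first exact: cvgr_expR.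
  apply: cvgV; first by rewrite mulr0 add0r gt_eqF.
  by apply: cvgD; [apply: cvgM; [exact: cvg_cst|exact: cvgr_expR]|exact: cvg_cst].
have [|d1 D1 _] := @drv_Li2_scale _ a 0; first by rewrite mulr0 lexx ltr01.
have [||d2 D2 _] := @drv_dilogs 0; rewrite ?mulr0 //.
have -> : 0 = - ((Li2 (a * 0) + dilogs 0) / s) :> R by rewrite mulr0 Li2_0 dilogs0 addr0 mul0r oppr0.
apply: cvgN; apply: cvgM; last exact: cvg_cst.
exact: (cvg_cont zc (drv_continuous (drvD D1 D2))).
Qed.

Lemma cvg_prim_ninfty : prim u @[u --> -oo] --> - ((Li2 1 + dilogs a^-1) / s).
Proof.
have hA := A0; have hB := B0; have s0 : 0 < s by lra.
have a0 : 0 < a by lra.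
have e0 : (expR w : R) @[w --> -oo] --> (0 : R).
  by apply/cvgNy_compNP; exact: cvgr_expR.
have zc : zof u @[u --> -oo] --> a^-1.
  have -> : a^-1 = (a + s * 0)^-1 by rewrite mulr0 addr0.
  apply: cvgV; first by rewrite mulr0 addr0 gt_eqF.
  by apply: cvgD; [exact: cvg_cst|apply: cvgM; [exact: cvg_cst|exact: e0]].
have [|| d D _] := @drv_dilogs a^-1; first by rewrite invr_ge0 ltW.
  by rewrite divff ?gt_eqF.
have h1 : a * zof u @[u --> -oo] --> (1 : R).
  rewrite -[X in _ --> X](divff (lt0r_neq0 a0)).
  by apply: cvgM; [exact: cvg_cst|exact: zc].
have h2 : \forall u \near -oo, 0 <= a * zof u <= 1.
  near=> u; have [z0 az] := zof_itv u.
  by rewrite (ltW az) andbT mulr_ge0 // ltW.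
have h3 : Li2 (a * zof u) @[u --> -oo] --> (Li2 1 : R) by exact: Li2_cvg1 h1 h2.
have h4 := cvg_cont zc (drv_continuous D).
have h5 : Li2 (a * zof u) + dilogs (zof u) @[u --> -oo] --> Li2 1 + dilogs a^-1 := cvgD h3 h4.
by apply: cvgN; apply: cvgM; [exact: h5|exact: cvg_cst].
Unshelve. all: by end_near. Qed.

(** The five-term relation trades the three dilogarithms at z = a^-1 for Li2
    (A / a) and Li2 (B / b), and its logarithms complete the square. *)
Lemma dilogs_value : dilogs a^-1 = Li2 (A / a) + Li2 (B / b) + (ln a - ln b) ^+ 2 / 2.
Proof.
have hA := A0; have hB := B0; have a0 : 0 < a by lra.
have b0 : 0 < b by lra.
have s0 : 0 < s by lra.
have := five_term A0 B0; rewrite /dilogs.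
have -> : A * B / b * a^-1 = A * B / (a * b) by field; rewrite !gt_eqF.
have -> : 1 + a * A / b * a^-1 = s / b by field; rewrite !gt_eqF.
have -> : 1 + B * a^-1 = s / a by field; rewrite !gt_eqF.
have -> : a * A / b * a^-1 / (s / b) = A / s by field; rewrite !gt_eqF.
have -> : B * a^-1 / (s / a) = B / s by field; rewrite !gt_eqF.
rewrite !ln_div ?posrE //.
move: (Li2 (A / a)) (Li2 (A / s)) (Li2 (B / s)) (Li2 (B / b)) (Li2 (A * B / _)).
by move: (ln a) (ln b) (ln s) => x y z k l m n o h; lra.
Qed.

Lemma integral_outer : (\int[mu]_u (outer u)%:E =
  ((Li2 1 + Li2 (A / a) + Li2 (B / b) + (ln a - ln b) ^+ 2 / 2) / s)%:E)%E.
Proof.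
rewrite (integral_line outer_ge0 continuous_outer drv_prim cvg_prim_ninfty cvg_prim_pinfty).
by rewrite dilogs_value sub0r opprK !addrA.
Qed.

(** The exponential of minus the action, by action_chart. *)
Definition density (p : R * R) : R := let g := expR p.1 * (1 + B * logistic p.1) in
  logistic p.1 * expR p.2 / ((a + B * logistic p.1 + g + expR p.2) * (g + expR p.2)).

Lemma integral_density : (\int[mu \x mu]_p (density p)%:E =
  ((Li2 1 + Li2 (A / a) + Li2 (B / b) + (ln a - ln b) ^+ 2 / 2) / s)%:E)%E.
Proof.
have hA := A0; have hB := B0.
have t0 u : 0 <= B * logistic u by rewrite mulr_ge0 // ltW // logistic_gt0.
have g0 u : 0 < expR u * (1 + B * logistic u) by rewrite mulr_gt0 ?expR_gt0 //; have := t0 u; lra.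
have q1 p : 0 < a + B * logistic p.1 + expR p.1 * (1 + B * logistic p.1) + expR p.2.
  by have := t0 p.1; have := g0 p.1; have := expR_gt0 p.2; lra.
have q2 (p : R * R) : 0 < expR p.1 * (1 + B * logistic p.1) + expR p.2.
  by rewrite addr_gt0 ?expR_gt0.
have m1 : measurable_fun setT (fun p : R * R => p.1) by exact: measurable_fst.
have m2 : measurable_fun setT (fun p : R * R => p.2) by exact: measurable_snd.
have me1 : measurable_fun setT (fun p : R * R => expR p.1).
  by apply: measurableT_comp m1; exact: measurable_expR.
have me2 : measurable_fun setT (fun p : R * R => expR p.2).
  by apply: measurableT_comp m2; exact: measurable_expR.
have ms : measurable_fun setT (fun p : R * R => logistic p.1).
  apply: measurable_funM => //; apply: measurable_inv_gt0; first by move=> p; exact: expD1_gt0.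
  by apply: measurable_funD => //; exact: measurable_cst.
have mt : measurable_fun setT (fun p : R * R => B * logistic p.1).
  by apply: measurable_funM => //; exact: measurable_cst.
have mg : measurable_fun setT (fun p : R * R => expR p.1 * (1 + B * logistic p.1)).
  by apply: measurable_funM => //; apply: measurable_funD => //; exact: measurable_cst.
have md : measurable_fun setT density.
  apply: measurable_funM; first exact: measurable_funM.
  apply: measurable_inv_gt0; first by move=> p; rewrite mulr_gt0.
  apply: measurable_funM; last exact: measurable_funD.
  do 2!apply: measurable_funD => //; apply: measurable_funD => //; exact: measurable_cst.
rewrite fubini_tonelli1; last 2 first.
- exact/measurable_EFinP.
- by move=> p; rewrite lee_fin divr_ge0 ?mulr_ge0 ?expR_ge0 // ltW ?logistic_gt0.
rewrite -integral_outer; apply: eq_integral => u _; rewrite /fubini_F.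
pose f w := expR w / ((a + B * logistic u + expR u * (1 + B * logistic u) + expR w) * (expR u * (1 + B * logistic u) + expR w)).
have -> : (fun w => (density (u, w))%:E) = (fun w => (logistic u)%:E * (f w)%:E)%E.
  by apply/funext => w; rewrite -EFinM; congr (_%:E); exact/esym/mulrA.
rewrite ge0_integralZl_EFin //; last 3 first.
- by move=> w _; rewrite lee_fin divr_ge0 ?expR_ge0 // mulr_ge0 // ltW ?(q1 (u, w)) ?(q2 (u, w)).
- apply/measurable_EFinP; apply: measurable_funM; first exact: measurable_expR.
  apply: measurable_inv_gt0; first by move=> w; rewrite mulr_gt0 ?(q1 (u, w)) ?(q2 (u, w)).
  by apply: measurable_funM; apply: measurable_funD => //; exact: measurable_expR.
- exact/ltW/logistic_gt0.
rewrite integral_inner //; last by have := t0 u; lra.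
by rewrite -EFinM /outer /= addrK.
Qed.

End outer.
End integrals.

(** * The volume *)

Theorem proposition7p4 (R : realType) (c1 c2 : R) (hc1 : 0 <= c1) (hc2 : 0 <= c2) :
  pentagon_volume (tnth [tuple c1; c2; 0; 0; 0])
    ((2 * Li2 1 + ln ((cosh c1 + 1) / (cosh c2 + 1)) ^+ 2
      + 2 * \sum_(c <- [:: c1; c2]) Li2 ((cosh c - 1) / (cosh c + 1)))
     / (cosh c1 + cosh c2))%:E.
Proof.
set c := tnth _; rewrite /pentagon_volume; set S := [set j | 0 < c j]%SET.
have e0 : c (ord5 0) = c1 by [].
have e1 : c (ord5 1) = c2 by [].
have c0 : forall j, 0 <= c j by apply: ord5_ind.
have S01 : S \subset [set ord5 0; ord5 1]%SET.
  apply/fintype.subsetP; apply: ord5_ind; rewrite !inE // /c (tnth_nth 0) /= ltxx //.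
exists (dom (A := S)), (Phi (A := S)); split; first exact: adapted_pentagons.
have -> : [set u : R * R | dom (slice c S u)] = setT.
  by apply/seteqP; split=> // u _; apply: dom_slice => j; rewrite inE.
have cS j u : cs j (slice c S u) = c j.
  rewrite cs_slice inE; case: ifPn => //; rewrite -leNgt => h.
  by apply/eqP; rewrite eq_le c0 h.
have A0 := sqr_ge0 (sinh (c1 / 2)); have B0 := sqr_ge0 (sinh (c2 / 2)).
transitivity (\int[(@lebesgue_measure R \x @lebesgue_measure R)%E]_u
  (density (sinh (c1 / 2) ^+ 2) (sinh (c2 / 2) ^+ 2) u)%:E)%E; last first.
  apply: eq_integral => u _; rewrite (wp_density1 S01); last first.
    by apply: dom_slice => j; rewrite inE.
  by rewrite mulr1 /Phi cu_slice cw_slice !cS e0 e1 action_chart cosh2.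
rewrite integral_density //; apply/esym; congr (_%:E).
rewrite big_cons big_seq1 !(cosh_half c1) !(cosh_half c2).
(* Now cosh c1 = 2 * A + 1 and cosh c2 = 2 * B + 1. *)
move: (sinh (c1 / 2) ^+ 2) (sinh (c2 / 2) ^+ 2) A0 B0 => A B A0 B0.
have a0 : 0 < 1 + A by lra.
have b0 : 0 < 1 + B by lra.
have s0 : 0 < 1 + A + B by lra.
have -> : (2 * A + 1 + 1) / (2 * B + 1 + 1) = (1 + A) / (1 + B) by field; rewrite !gt_eqF //; lra.
have -> : (2 * A + 1 - 1) / (2 * A + 1 + 1) = A / (1 + A) by field; rewrite !gt_eqF //; lra.
have -> : (2 * B + 1 - 1) / (2 * B + 1 + 1) = B / (1 + B) by field; rewrite !gt_eqF //; lra.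
have -> : 2 * A + 1 + (2 * B + 1) = 2 * (1 + A + B) by ring.
rewrite ln_div ?posrE //.
by field; rewrite gt_eqF.
Qed.
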